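(* Let $L>0$ and let $\gamma(s)=(x(s),y(s))$, $s\in[0,L]$, be a smooth, non-closed, simple planar curve parametrized with respect to its arc length, with $$x(L-s)=-x(s),\qquad y(L-s)=y(s),\qquad s\in\left[0,\tfrac{L}{2}\right].$$ Suppose that the signed curvature $k(s)=x'(s)y''(s)-y'(s)x''(s)$ of $\gamma$ is concave in $[0,L]$, and let $\delta>0$ be such that $1+\delta k(s)>0$ for all $s\in[0,L]$. Let $$D=\left\{(x(s)+ry'(s),\,y(s)-rx'(s)):\ s\in(0,L),\ r\in(0,\delta)\right\}.$$ If $D$ is simply connected, then $$\mu_1^{odd}(D)\ge B\,\frac{\pi^2}{L^2},\qquad\text{where}\quad B=\min_{r\in[0,\delta],\,s\in[0,L]}\frac{1}{(1+rk(s))^2},$$ and equality holds if $\gamma$ is a line segment.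
   Context: For a bounded, connected, Lipschitz domain $D$, the Neumann eigenvalues of $D$ are the numbers $\mu$ for which the problem $-\Delta u=\mu u$ in $D$, $\partial u/\partial\mathbf{n}=0$ on $\partial D$ (with $\mathbf{n}$ the exterior unit normal) has a nonzero solution (an eigenfunction). All functions are real-valued. $\mu_1^{odd}(D)$ denotes the smallest nontrivial (nonzero) Neumann eigenvalue of $D$ having a corresponding eigenfunction that is odd with respect to the $y$-axis, i.e. $u(-x,y)=-u(x,y)$. *)

(* Defs.v *)
From HB Require Import structures.
From mathcomp Require Import all_boot all_order all_algebra.
From mathcomp Require Import all_classical all_reals all_analysis.

Set Implicit Arguments.
Unset Strict Implicit.
Unset Printing Implicit Defensive.

Import Order.TTheory GRing.Theory Num.Theory.
Import numFieldNormedType.Exports.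

Local Open Scope classical_set_scope.
Local Open Scope ring_scope.

Section curve.
Context {R : realType}.

(* Smoothness on a closed interval is rendered by functions that are C^oo on
   the whole line: every function smooth on [0, L] up to the endpoints is the
   restriction of such a function, and one-sided derivatives at the endpoints
   agree with those of the extension. *)
Definition smooth (f : R -> R) : Prop :=
  forall (n : nat) (t : R), derivable (derive1n n f) t 1.

Definition curvature (x y : R -> R) (s : R) : R :=
  derive1 x s * derive1n 2 y s - derive1 y s * derive1n 2 x s.

Definition concave_on (A : set R) (f : R -> R) : Prop :=
  forall a b t : R, A a -> A b -> t \in `[0, 1] ->
    (1 - t) * f a + t * f b <= f ((1 - t) * a + t * b).

(* (y', -x') is the unit normal to the right of the direction of travel. *)
Definition strip (x y : R -> R) (L delta : R) : set (R * R) :=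
  [set p | exists s r : R, [/\ 0 < s < L, 0 < r < delta &
     p = (x s + r * derive1 y s, y s - r * derive1 x s)]].

Definition segment (p q : R * R) : set (R * R) :=
  [set ((1 - t) * p.1 + t * q.1, (1 - t) * p.2 + t * q.2) | t in `[0, 1]].

Definition is_min (A : set R) (m : R) : Prop := A m /\ lbound A m.

(* Connected, and every loop c (a map on [0, 1] with c 0 = c 1) contracts
   inside D: H (t, a) is the position of the point t of the loop at time a. *)
Definition simply_connected (D : set (R * R)) : Prop :=
  connected D /\
  forall c : R -> R * R,
    {within `[0, 1], continuous c} -> c 0 = c 1 ->
    (forall t : R, t \in `[0, 1] -> D (c t)) ->
    exists H : R * R -> R * R,
      [/\ {within `[0, 1] `*` `[0, 1], continuous H},
          forall t a : R, t \in `[0, 1] -> a \in `[0, 1] -> D (H (t, a)),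
          forall a : R, a \in `[0, 1] -> H (0, a) = H (1, a),
          forall t : R, t \in `[0, 1] -> H (t, 0) = c t &
          exists p, forall t : R, t \in `[0, 1] -> H (t, 1) = p].

End curve.

Section neumann.
Context {R : realType}.

(* Lebesgue measure of the plane; measurableTypeR R is R with its Borel sets. *)
Definition leb2 : set (measurableTypeR R * measurableTypeR R) -> \bar R :=
  (@lebesgue_measure R \x @lebesgue_measure R)%E.

HB.instance Definition _ := Measure.on leb2.

Definition partial1 (f : R * R -> R) (p : R * R) : R :=
  derive1 (fun t => f (t, p.2)) p.1.

Definition partial2 (f : R * R -> R) (p : R * R) : R :=
  derive1 (fun t => f (p.1, t)) p.2.

Fixpoint Ck (n : nat) (f : R * R -> R) : Prop :=
  continuous f /\
  if n is m.+1 then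
    [/\ forall p, derivable (fun t => f (t, p.2)) p.1 1,
        forall p, derivable (fun t => f (p.1, t)) p.2 1,
        Ck m (partial1 f) & Ck m (partial2 f)]
  else True.

Definition test_function (D : set (R * R)) (phi : R * R -> R) : Prop :=
  (forall n, Ck n phi) /\
  exists K, [/\ compact K, K `<=` D & forall p, ~ K p -> phi p = 0].

Definition L2 (D : set (R * R)) (u : R * R -> R) : Prop :=
  measurable_fun (D : set (measurableTypeR R * measurableTypeR R)) u /\
  leb2.-integrable D (fun p => (u p ^+ 2)%:E).

(* u is in the Sobolev space H^1(D), with weak gradient (g1, g2). *)
Definition H1 (D : set (R * R)) (u g1 g2 : R * R -> R) : Prop :=
  [/\ L2 D u, L2 D g1, L2 D g2 &
  forall phi, test_function D phi ->
    (\int[leb2]_(p in D) (u p * partial1 phi p))%R =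
      (- \int[leb2]_(p in D) (g1 p * phi p))%R /\
    (\int[leb2]_(p in D) (u p * partial2 phi p))%R =
      (- \int[leb2]_(p in D) (g2 p * phi p))%R].

(* The Neumann problem on a Lipschitz domain, whose normal is only defined
   almost everywhere on the boundary, is understood in the weak sense:
   u in H^1(D) and, for every v in H^1(D),
   int_D grad u . grad v = mu int_D u v.  Letting v range over all of H^1(D)
   encodes the natural boundary condition du/dn = 0. *)
Definition neumann_solution (D : set (R * R)) (mu : R) (u : R * R -> R)
    : Prop :=
  exists g1 g2, H1 D u g1 g2 /\
    forall v h1 h2, H1 D v h1 h2 ->
      (\int[leb2]_(p in D) (g1 p * h1 p + g2 p * h2 p))%R =
      (mu * \int[leb2]_(p in D) (u p * v p))%R.

(* Functions stand for their classes modulo equality almost everywhere. *)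
Definition neumann_eigenfunction (D : set (R * R)) (mu : R) (u : R * R -> R)
    : Prop :=
  ~ {ae leb2, forall p, D p -> u p = 0} /\ neumann_solution D mu u.

Definition odd_wrt_y_axis (D : set (R * R)) (u : R * R -> R) : Prop :=
  {ae leb2, forall p, D p -> u (- p.1, p.2) = - u p}.

Definition odd_neumann_eigenvalue (D : set (R * R)) (mu : R) : Prop :=
  exists u, neumann_eigenfunction D mu u /\ odd_wrt_y_axis D u.

(* The smallest nonzero odd eigenvalue, as an infimum in the extended reals
   so that it is defined for every D; see mu1_odd_smallest. *)
Definition mu1_odd (D : set (R * R)) : \bar R :=
  ereal_inf [set mu%:E | mu in
    [set mu : R | mu != 0 /\ odd_neumann_eigenvalue D mu]].

Lemma mu1_odd_smallest (D : set (R * R)) (m : R) :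
  is_min [set mu : R | mu != 0 /\ odd_neumann_eigenvalue D mu] m ->
  mu1_odd D = m%:E.
Proof.
move=> [mA mlb]; apply/eqP; rewrite eq_le; apply/andP; split.
- by apply: ereal_inf_lbound; exists m.
- by apply: le_ereal_inf_tmp => _ [mu muA <-]; rewrite lee_fin; exact: mlb.
Qed.

End neumann.

(* Main.v *)
(** In the coordinates [Phi s r = gamma s + r n s], whose Jacobian is [J = 1 + r k s], the
    field [Z T] along the unit tangent [T] has divergence [Z_s / J]. Since [J] is even, an
    odd function of compact support has weighted mean zero along each curve [r = const], so
    it equals [w = Z_s / J] for some [Z] of compact support; such [w] approximate in L^2 any
    odd eigenfunction [u]. Testing the weak gradient of [u] against [Z T] gives

      [2 int u w = - 2 int grad u . Z T <= (1 / lam) int |grad u|^2 + lam int Z^2],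

    and for [lam = B pi^2 / L^2] the last term is at most [int w^2] by Wirtinger's inequality
    in the pointwise form [Z_s^2 >= (Z^2 f)_s + (pi / L)^2 Z^2] with
    [f = (pi / L) cot (pi s / L)], since [(Z^2 f)_s / J] is again a divergence. Hence
    [lam int u^2 <= int |grad u|^2], and no change of variables is needed.

    [Phi] is injective because [D] is simply connected: [k] is symmetric and concave, so on
    the half [s >= L / 2] it is first nonnegative, where the normals diverge, and then
    negative. There the osculating disks are nested, so the center of curvature at the end of
    [gamma] lies outside [D], beyond the strip in each normal direction. If two parameters
    gave one point, the curve between them would be a contractible loop in the complement of
    this center, so that the tangent turns by less than [pi] along it; comparison with the
    last osculating disk excludes this.

    When [gamma] is a segment, [k = 0], [B = 1] and [sin (pi x / L)] is an eigenfunction. *)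

Require Import Defs.
From mathcomp Require Import all_boot all_order all_algebra.
From mathcomp Require Import all_classical all_reals all_analysis.
From mathcomp Require Import measurable_realfun ring lra.

Set Implicit Arguments.
Unset Strict Implicit.
Unset Printing Implicit Defensive.

Import Order.TTheory GRing.Theory Num.Theory.
Import numFieldNormedType.Exports.

Local Open Scope classical_set_scope.
Local Open Scope ring_scope.

(** * Functions of one real variable *)

Section one_variable.
Context {R : realType}.
Implicit Types (f g : R -> R) (t : R).

Definition isD f t (d : R) : Prop := is_derive (t : R) (1 : R) f d.

Lemma isD_eq f t d d' : isD f t d -> d = d' -> isD f t d'.
Proof. by move=> ? <-. Qed.

Lemma isD_derive1 f t d : isD f t d -> (derive1 f) t = d.
Proof. by move=> h; rewrite derive1E; exact: (@derive_val _ _ _ _ _ _ _ h). Qed.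

Lemma derivable_isD f t : derivable f t 1 -> isD f t ((derive1 f) t).
Proof. by move=> h; rewrite derive1E; exact: derivableP. Qed.

Lemma isD_derivable f t d : isD f t d -> derivable f t 1.
Proof. by move=> h; exact: (@ex_derive _ _ _ _ _ _ _ h). Qed.

Lemma isD_cst (c : R) t : isD (fun=> c) t 0.
Proof. exact: is_derive_cst. Qed.

Lemma isD_id t : isD (fun u => u) t 1.
Proof. exact: is_derive_id. Qed.

Lemma isDD f g t a b : isD f t a -> isD g t b -> isD (fun u => f u + g u) t (a + b).
Proof. exact: is_deriveD. Qed.

Lemma isDB f g t a b : isD f t a -> isD g t b -> isD (fun u => f u - g u) t (a - b).
Proof. exact: is_deriveB. Qed.

Lemma isDN f t a : isD f t a -> isD (fun u => - f u) t (- a).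
Proof. exact: is_deriveN. Qed.

Lemma isDM f g t a b :
  isD f t a -> isD g t b -> isD (fun u => f u * g u) t (f t * b + g t * a).
Proof. exact: is_deriveM. Qed.

Lemma isDV f t a : f t != 0 -> isD f t a -> isD (fun u => (f u)^-1) t (- a / f t ^+ 2).
Proof.
move=> f0 fa; apply: isD_eq; first exact: (is_deriveV f0 fa).
by rewrite /GRing.scale /=; field.
Qed.

Lemma isD_comp f g t a b :
  isD f (g t) a -> isD g t b -> isD (fun u => f (g u)) t (a * b).
Proof. exact: is_derive1_comp. Qed.

Lemma isD_near f g t d : (\forall u \near t, f u = g u) -> isD f t d -> isD g t d.
Proof. exact: near_eq_is_derive. Qed.

Lemma isD_continuous f t d : isD f t d -> {for t, continuous f}.
Proof.
move=> /isD_derivable/derivable1_diffP; exact: differentiable_continuous.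
Qed.

Lemma isD_ext f g t d : (forall u, f u = g u) -> isD f t d -> isD g t d.
Proof. by move=> fg; apply: isD_near; near=> u; rewrite fg. Unshelve. all: by end_near. Qed.

Lemma isD_homo (a b : R) f (f' : R -> R) :
  (forall u, a < u < b -> isD f u (f' u)) ->
  (forall u, a < u < b -> 0 <= f' u) ->
  (forall u, a <= u <= b -> {for u, continuous f}) ->
  forall s t, a <= s -> s <= t -> t <= b -> f s <= f t.
Proof.
move=> df f'0 cf s t a_s st tb; apply: (@ger0_derive1_le_cc _ f a b) => //.
- by move=> u; rewrite in_itv /= => /df /isD_derivable.
- move=> u; rewrite in_itv /= => uab; rewrite (isD_derive1 (df _ uab)); exact: f'0.
- apply: continuous_in_subspaceT => u; rewrite inE /= in_itv /=; exact: cf.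
- by rewrite in_itv /= a_s (le_trans st).
- by rewrite in_itv /= tb (le_trans a_s).
Qed.

Lemma isD_le (s t : R) f (f' : R -> R) : s <= t ->
  (forall u, s < u < t -> isD f u (f' u)) -> (forall u, s < u < t -> 0 <= f' u) ->
  (forall u, s <= u <= t -> {for u, continuous f}) -> f s <= f t.
Proof. by move=> st df f'0 cf; apply: (isD_homo df f'0 cf). Qed.

Lemma isD_cst_eq (a b : R) f :
  (forall u, a < u < b -> isD f u 0) ->
  (forall u, a <= u <= b -> {for u, continuous f}) ->
  forall s t, a <= s <= b -> a <= t <= b -> f s = f t.
Proof.
move=> df cf.
suff W s t : a <= s -> s <= t -> t <= b -> f s = f t.
  move=> s t /andP[s1 s2] /andP[t1 t2].
  by case: (leP s t) => [|/ltW] ?; [|symmetry]; apply: W.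
move=> a_s st tb; apply/eqP; rewrite eq_le; apply/andP; split.
  by apply: (isD_homo (f' := fun=> 0)) df _ cf _ _ a_s st tb.
rewrite -lerN2.
apply: (isD_homo (f := fun u => - f u) (f' := fun=> 0)) _ _ _ _ _ a_s st tb => //.
- by move=> u /df /isDN; rewrite oppr0.
- by move=> u /cf cu; exact: cvgN.
Qed.

Fixpoint smoothn n f : Prop :=
  (forall t, derivable f t 1) /\ if n is m.+1 then smoothn m (derive1 f) else True.

Lemma smoothnW n f : smoothn n.+1 f -> smoothn n f.
Proof.
elim: n f => [|n IH] f [df sf]; split => //.
exact: IH.
Qed.

Lemma smoothP f : smooth f <-> forall n, smoothn n f.
Proof.
split=> [sf n|sf n t].
  elim: n f sf => [|n IH] f sf; split=> //; try exact: (sf 0%N).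
  by apply: IH => m t; have := sf m.+1 t; rewrite derive1Sn.
elim: n f sf => [|n IH] f sf; first by have [df _] := sf 0%N; exact: df.
by rewrite derive1Sn; apply: IH => m; have [] := sf m.+1.
Qed.

Lemma smoothnD n f g : smoothn n f -> smoothn n g -> smoothn n (fun t => f t + g t).
Proof.
elim: n f g => [|n IH] f g [df sf] [dg sg]; split=> //.
- by move=> t; exact: derivableD.
- by move=> t; exact: derivableD.
rewrite (_ : derive1 _ = fun t => (derive1 f) t + (derive1 g) t); first exact: IH.
by apply/funext => t; apply: isD_derive1; apply: isDD; exact: derivable_isD.
Qed.

Lemma smoothnM n f g : smoothn n f -> smoothn n g -> smoothn n (fun t => f t * g t).
Proof.
elim: n f g => [|n IH] f g [df sf] [dg sg]; split=> //.
- by move=> t; exact: derivableM.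
- by move=> t; exact: derivableM.
rewrite (_ : derive1 _ = fun t => f t * (derive1 g) t + g t * (derive1 f) t).
  by apply: smoothnD; apply: IH => //; apply: smoothnW.
by apply/funext => t; apply: isD_derive1; apply: isDM; exact: derivable_isD.
Qed.

Lemma smooth_cst (c : R) : smooth (fun=> c).
Proof.
apply/smoothP => n; elim: n c => [|n IH] c; split=> //.
by rewrite (_ : derive1 _ = fun=> 0) //; apply/funext => t; exact: derive1_cst.
Qed.

Lemma smoothD f g : smooth f -> smooth g -> smooth (fun t => f t + g t).
Proof. by move=> /smoothP sf /smoothP sg; apply/smoothP => n; exact: smoothnD. Qed.

Lemma smoothM f g : smooth f -> smooth g -> smooth (fun t => f t * g t).
Proof. by move=> /smoothP sf /smoothP sg; apply/smoothP => n; exact: smoothnM. Qed.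

Lemma smoothN f : smooth f -> smooth (fun t => - f t).
Proof.
move=> sf; rewrite (_ : (fun t => _) = (fun t => -1 * f t)).
  by apply: smoothM => //; exact: smooth_cst.
by apply/funext => t; rewrite mulN1r.
Qed.

Lemma smoothB f g : smooth f -> smooth g -> smooth (fun t => f t - g t).
Proof. by move=> sf sg; apply: smoothD => //; exact: smoothN. Qed.

Lemma smooth_derive1 f : smooth f -> smooth (derive1 f).
Proof. by move=> sf n t; rewrite -derive1Sn; exact: sf. Qed.

Lemma smooth_isD f t : smooth f -> isD f t ((derive1 f) t).
Proof. by move=> sf; apply: derivable_isD; exact: (sf 0%N). Qed.

Lemma smooth_continuous f : smooth f -> continuous f.
Proof. by move=> sf t; apply: isD_continuous; exact: smooth_isD. Qed.

Lemma smooth_primitive f g : (forall t, isD f t (g t)) -> smooth g -> smooth f.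
Proof.
move=> fg sg [|n] t; first exact: (isD_derivable (fg t)).
rewrite derive1Sn (_ : (derive1 f) = g); first exact: sg.
by apply/funext => u; exact: isD_derive1.
Qed.

Lemma smooth_id : smooth (@idfun R).
Proof. by apply: (smooth_primitive (g := fun=> 1)) => [t|]; [exact: isD_id|exact: smooth_cst]. Qed.

Lemma smooth_affine f (a b : R) : smooth f -> smooth (fun t => f (a * t + b)).
Proof.
move=> /smoothP sf; apply/smoothP => n; elim: n f {sf}(sf n) => [|n IH] f [df sf].
  split=> // t; apply: isD_derivable; apply: (isD_comp (f := f)).
    exact: derivable_isD.
  by apply: isDD; [apply: isDM; [exact: isD_cst|exact: isD_id]|exact: isD_cst].
have D t : isD (fun t => f (a * t + b)) t ((derive1 f) (a * t + b) * a).
  apply: isD_eq; first apply: (isD_comp (f := f)).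
  - exact: derivable_isD.
  - by apply: isDD; [apply: isDM; [exact: isD_cst|exact: isD_id]|exact: isD_cst].
  by rewrite mulr1 mulr0 !addr0.
split=> [t|]; first exact: isD_derivable (D t).
rewrite (_ : derive1 _ = fun t => (derive1 f) (a * t + b) * a).
  by apply: smoothnM; [exact: IH|have /smoothP := @smooth_cst a].
by apply/funext => t; exact: isD_derive1.
Qed.

Lemma smoothn_sin_cos n (a : R) :
  smoothn n (fun t => sin (a * t)) /\ smoothn n (fun t => cos (a * t)).
Proof.
have L t : isD (fun t => a * t) t a.
  by apply: isD_eq; [apply: isDM; [exact: isD_cst|exact: isD_id]|rewrite /=; ring].
have S t : isD (fun t => sin (a * t)) t (cos (a * t) * a).
  by apply: (isD_comp (f := sin)) => //; exact: is_derive_sin.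
have C t : isD (fun t => cos (a * t)) t (- sin (a * t) * a).
  by apply: (isD_comp (f := cos)) => //; exact: is_derive_cos.
elim: n => [|n [IHs IHc]].
  by split; split.
split; split=> //.
- rewrite (_ : derive1 _ = fun t => cos (a * t) * a).
    by apply: smoothnM => //; have /smoothP := @smooth_cst a.
  by apply/funext => t; exact: isD_derive1.
rewrite (_ : derive1 _ = fun t => sin (a * t) * - a).
  by apply: smoothnM => //; have /smoothP := @smooth_cst (- a).
by apply/funext => t; rewrite mulrN -mulNr; exact: isD_derive1.
Qed.

End one_variable.

Section bump.
Context {R : realType}.
Implicit Types (t : R).

Definition expinv (m : nat) t : R := if 0 < t then t ^- m * expR (- t^-1) else 0.

Lemma expinv_ge0 m t : 0 <= expinv m t.
Proof.
rewrite /expinv; case: ifPn => // t0.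
by rewrite mulr_ge0 ?expR_ge0// invr_ge0 exprn_ge0// ltW.
Qed.

(* e^{1/t} = (e^{1/((m+1)t)})^{m+1} >= (1/((m+1)t))^{m+1}. *)
Lemma expinv_le m t : 0 < t -> expinv m t <= m.+1%:R ^+ m.+1 * t.
Proof.
move=> t0; rewrite /expinv t0.
have m0 : (0 : R) < m.+1%:R by rewrite ltr0n.
have p0 : 0 < (m.+1%:R * t)^-1 by rewrite invr_gt0 mulr_gt0.
have H : (m.+1%:R * t)^-1 ^+ m.+1 <= expR t^-1.
  rewrite (_ : t^-1 = m.+1%:R * (m.+1%:R * t)^-1); last first.
    by rewrite invfM mulrA divff ?mul1r// gt_eqF.
  rewrite expRM_natl lerXn2r// ?nnegrE ?expR_ge0// ?ltW//.
  by apply: lt_le_trans (expR_ge1Dx _); rewrite ltrDr.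
have e : expR (- t^-1) <= (m.+1%:R * t) ^+ m.+1.
  by rewrite expRN -[leRHS]invrK lef_pV2 ?posrE ?expR_gt0 ?invr_gt0 ?exprn_gt0 ?mulr_gt0// -exprVn.
apply: le_trans (ler_wpM2l _ e) _; first by rewrite invr_ge0 exprn_ge0// ltW.
by rewrite exprMn [t ^+ m.+1]exprS mulrC -!mulrA divff ?mulr1// gt_eqF// exprn_gt0.
Qed.

Lemma expinv_isD m t :
  isD (expinv m) t (expinv m.+2 t - m%:R * expinv m.+1 t).
Proof.
have [t0|t0|->] := ltgtP t 0.
- rewrite /expinv !ltNge (ltW t0) /= mulr0 subr0.
  apply: (isD_near (f := fun=> 0)); last exact: isD_cst.
  near=> u; rewrite ifF//; apply/negbTE; rewrite -leNgt.
  by apply: ltW; near: u; exact: lt_nbhsl.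
- apply: (isD_near (f := fun u => u ^- m * expR (- u^-1))).
    by near=> u; rewrite /expinv ifT//; near: u; exact: lt_nbhsr.
  rewrite /expinv t0.
  have tn0 : t != 0 by rewrite gt_eqF.
  have V : isD (fun u => u^-1) t (- 1 / t ^+ 2) by apply: isDV (isD_id t).
  have X n : isD (fun u => u ^+ n) t (n%:R * t ^+ n.-1).
    by apply: isD_eq; [exact/derivable_isD/exprn_derivable|rewrite exp_derive1].
  have E : isD (fun u => expR (- u^-1)) t (expR (- t^-1) * - (- 1 / t ^+ 2)).
    by apply: (isD_comp (f := expR)); [exact: is_derive_expR|exact: isDN].
  apply: isD_eq; first by apply: isDM E; apply: isDV (X m); rewrite expf_neq0.
  case: m => [|m] /=; first by rewrite !expr0 /=; field.
  by rewrite !exprS; field; rewrite expf_neq0 ?tn0.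
have -> : expinv m.+2 0 - m%:R * expinv m.+1 0 = 0 :> R by rewrite /expinv ltxx mulr0 subr0.
suff H : (fun h : R => h^-1 *: (expinv m (h *: 1 + 0) - expinv m 0)) @ 0^' --> (0 : R).
  by split; [apply: (cvgP _ H)|apply: cvg_lim => //; exact: H].
have -> : (fun h : R => h^-1 *: (expinv m (h *: 1 + 0) - expinv m 0)) = expinv m.+1.
  apply/funext => h; rewrite addr0 /expinv ltxx subr0 /GRing.scale /= mulr1.
  by case: ifPn => h0; rewrite ?mulr0// exprS invfM mulrA.
apply: (@squeeze_cvgr _ _ _ _ (fun=> 0) (fun t => m.+2%:R ^+ m.+2 * `|t|)).
- near=> h; rewrite expinv_ge0 /=.
  have [h0|h0] := ltP 0 h; first by rewrite gtr0_norm ?expinv_le.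
  by rewrite /expinv ltNge h0 /= mulr_ge0// exprn_ge0.
- exact: cvg_cst.
- rewrite -[X in _ --> X](mulr0 (m.+2%:R ^+ m.+2)); apply: cvgMl_tmp.
  rewrite -[X in _ --> X](@normr0 R R); apply: cvg_norm.
  exact: cvg_within.
Unshelve. all: by end_near. Qed.

Lemma expinv_smooth m : smooth (expinv m).
Proof.
apply/smoothP => n; elim: n m => [|n IH] m; split=> //; try by move=> t; exact: isD_derivable (expinv_isD m t).
rewrite (_ : derive1 _ = fun t => expinv m.+2 t + - m%:R * expinv m.+1 t).
  by apply: smoothnD => //; apply: smoothnM => //; have /smoothP := @smooth_cst R (- m%:R).
by apply/funext => u; rewrite mulNr; apply: isD_derive1; exact: expinv_isD.
Qed.

End bump.

(** * Angles along loops *)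

Section winding.
Context {R : realType}.

Lemma locally_constant_forall (P : R -> Prop) :
  (forall a, \forall b \near a, P a <-> P b) -> forall a b, P a -> P b.
Proof.
move=> PP a b Pa.
have op (Q : R -> Prop) : (forall a : R, \forall b \near a, Q a <-> Q b) ->
    open [set u : R | Q u].
  move=> QQ; rewrite openE => u Qu.
  by apply: filterS (QQ u) => v [+ _]; exact.
have /connected_intervalP cT : is_interval [set: R] by [].
have /seteqP[_ /(_ b)] : [set u : R | P u] = setT; last by move=> /(_ I).
apply: cT.
- by exists a.
- by exists [set u | P u]; [exact: op|rewrite setTI].
- exists [set u | P u]; last by rewrite setTI.
  rewrite -openC; apply: (op (fun u => ~ P u)) => u.
  by apply: filterS (PP u) => v [PQ QP]; split=> h /[dup]; [move=> /QP|move=> /PQ].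
Qed.

Lemma continuous_pairing (T U V : topologicalType) (f : T -> U) (g : T -> V) :
  continuous f -> continuous g -> continuous (fun t => (f t, g t)).
Proof. by move=> cf cg t; apply: cvg_pair; [exact: cf|exact: cg]. Qed.

Lemma continuous_fst (U V : topologicalType) : continuous (fun w : U * V => w.1).
Proof. by case=> a b; exact: cvg_fst. Qed.

Lemma continuous_snd (U V : topologicalType) : continuous (fun w : U * V => w.2).
Proof. by case=> a b; exact: cvg_snd. Qed.

Lemma continuous_comp_fun (T U V : topologicalType) (f : U -> V) (g : T -> U) :
  continuous f -> continuous g -> continuous (fun t => f (g t)).
Proof. by move=> cf cg t; apply: cvg_comp; [exact: cg|exact: cf]. Qed.

Lemma continuousD_fun (T : topologicalType) (f g : T -> R) :
  continuous f -> continuous g -> continuous (fun t => f t + g t).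
Proof. by move=> cf cg t; apply: cvgD; [exact: cf|exact: cg]. Qed.

Lemma continuousN_fun (T : topologicalType) (f : T -> R) :
  continuous f -> continuous (fun t => - f t).
Proof. by move=> cf t; apply: cvgN; exact: cf. Qed.

Lemma continuousB_fun (T : topologicalType) (f g : T -> R) :
  continuous f -> continuous g -> continuous (fun t => f t - g t).
Proof. by move=> cf cg t; apply: cvgB; [exact: cf|exact: cg]. Qed.

Lemma continuousM_fun (T : topologicalType) (f g : T -> R) :
  continuous f -> continuous g -> continuous (fun t => f t * g t).
Proof. by move=> cf cg t; apply: cvgM; [exact: cf|exact: cg]. Qed.

Definition clamp (t : R) : R := Num.max 0 (Num.min 1 t).

Lemma clamp_itv t : clamp t \in `[0, 1].
Proof. by rewrite in_itv /= /clamp le_max lexx /= ge_max ler01 ge_min lexx. Qed.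

Lemma clampE t : t \in `[0, 1] -> clamp t = t.
Proof. by rewrite in_itv /= => /andP[t0 t1]; rewrite /clamp min_r// max_r. Qed.

Lemma clamp_continuous : continuous clamp.
Proof.
move=> t; apply: continuous_max; first exact: cvg_cst.
by apply: continuous_min; [exact: cvg_cst|exact: cvg_id].
Qed.

Lemma within_continuous_comp (T U V : topologicalType) (S : set U) (f : U -> V) (c : T -> U) :
  {within S, continuous f} -> continuous c -> (forall t, S (c t)) ->
  continuous (fun t => f (c t)).
Proof.
move=> /subspace_continuousP cf cc Sc t.
apply: (cvg_comp _ _ _ (cf _ (Sc t))).
move=> A; rewrite /= nbhs_simpl /= => wA.
have H : nbhs t (fun u => S (c u) -> A (c u)) := cc t _ wA.
by change (nbhs t (fun u => A (c u))); apply: filterS H => u; apply.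
Qed.

Definition angle_of (z : R * R) (A : R) : Prop := z.1 * sin A = z.2 * cos A.

Lemma angle_of_exists (z : R * R) : exists A, angle_of z A.
Proof.
have [z0|z0] := eqVneq z.1 0.
  by exists (pi / 2); rewrite /angle_of z0 cos_pihalf mul0r mulr0.
exists (atan (z.2 / z.1)); rewrite /angle_of.
have /andP[a1 a2] : - (pi / 2) < atan (z.2 / z.1) < pi / 2.
  by rewrite atan_gtNpi2 atan_ltpi2.
have c0 : cos (atan (z.2 / z.1)) != 0 by rewrite gt_eqF// cos_gt0_pihalf// a1.
have := @atanK R (z.2 / z.1); rewrite /tan => /eqP.
by rewrite eqr_div// => /eqP e; rewrite mulrC e mulrC.
Qed.

(* Multiplying z by a number of positive real part, here z' / z, turns it by the
   principal argument of that number. *)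
Lemma angle_of_rot (z z' : R * R) A :
  0 < z.1 * z'.1 + z.2 * z'.2 -> angle_of z A ->
  angle_of z' (A + atan ((z.1 * z'.2 - z.2 * z'.1) / (z.1 * z'.1 + z.2 * z'.2))).
Proof.
set re := z.1 * _ + _; set im := _ - z.2 * _ => re0; rewrite /angle_of => zA.
set b := atan (im / re).
have /andP[b1 b2] : - (pi / 2) < b < pi / 2 by rewrite atan_gtNpi2 atan_ltpi2.
have c0 : 0 < cos b by rewrite cos_gt0_pihalf// b1.
have e : sin b * re = im * cos b.
  have /eqP := @atanK R (im / re).
  by rewrite /tan eqr_div ?(lt0r_neq0 c0) ?(lt0r_neq0 re0)// => /eqP.
rewrite sinD cosD.
apply: (mulIf (lt0r_neq0 re0)).
have -> : z'.1 * (sin A * cos b + cos A * sin b) * re =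
  z'.1 * (sin A * cos b * re + cos A * (sin b * re)) by ring.
have -> : z'.2 * (cos A * cos b - sin A * sin b) * re =
  z'.2 * (cos A * cos b * re - sin A * (sin b * re)) by ring.
rewrite e; apply/eqP; rewrite -subr_eq0; apply/eqP.
have -> : z'.1 * (sin A * cos b * re + cos A * (im * cos b)) -
  z'.2 * (cos A * cos b * re - sin A * (im * cos b)) =
  cos b * (z'.1 ^+ 2 + z'.2 ^+ 2) * (z.1 * sin A - z.2 * cos A).
  by rewrite /re /im; ring.
by rewrite zA subrr mulr0.
Qed.

Lemma sin_eq0_small (z : R) : - pi < z -> z < pi -> sin z = 0 -> z = 0.
Proof.
move=> z1 z2 s0; have [z0|z0|//] := ltgtP z 0.
  have := @sin_gt0_pi R (- z); rewrite sinN s0 oppr0 ltxx oppr_gt0 z0 ltrNl z1.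
  by move=> /(_ isT).
by have := @sin_gt0_pi R z; rewrite s0 ltxx z0 z2 => /(_ isT).
Qed.

Lemma angle_of_sin (z : R * R) A B :
  z != 0 -> angle_of z A -> angle_of z B -> sin (A - B) = 0.
Proof.
rewrite /angle_of => z0 zA zB; rewrite sinB.
have e1 : z.1 * (sin A * cos B - cos A * sin B) = 0.
  have -> : z.1 * (sin A * cos B - cos A * sin B) =
    (z.1 * sin A) * cos B - cos A * (z.1 * sin B) by ring.
  by rewrite zA zB; ring.
have e2 : z.2 * (sin A * cos B - cos A * sin B) = 0.
  have -> : z.2 * (sin A * cos B - cos A * sin B) =
    sin A * (z.2 * cos B) - (z.2 * cos A) * sin B by ring.
  by rewrite -zA -zB; ring.
apply/eqP; move: z0; apply: contraNT => s0.
case: z e1 e2 {zA zB} => u v /= /eqP; rewrite mulf_eq0 (negbTE s0) orbF => /eqP ->.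
by move=> /eqP; rewrite mulf_eq0 (negbTE s0) orbF => /eqP ->.
Qed.

Lemma simply_connected_angle (D : set (R * R)) (p0 : R * R) (c : R -> R * R) (A : R -> R) :
  simply_connected D -> ~ D p0 -> continuous c -> c 0 = c 1 ->
  (forall t, t \in `[0, 1] -> D (c t)) -> continuous A ->
  (forall t, t \in `[0, 1] -> angle_of (c t - p0) (A t)) -> A 0 = A 1.
Proof.
move=> [_ sc] Dp0 cc c01 Dc cA cAe.
have [H [cH HD H01 H0 [p H1]]] := sc c (continuous_subspaceT cc) c01 Dc.
pose z (w : R * R) := H (clamp w.1, clamp w.2) - p0.
have cz : continuous z.
  move=> w; apply: continuousB; last exact: cvg_cst.
  apply: (within_continuous_comp cH (c := fun w : R * R => (clamp w.1, clamp w.2))).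
    by apply: continuous_pairing; apply: (continuous_comp_fun clamp_continuous);
      [exact: continuous_fst|exact: continuous_snd].
  by move=> v; split; exact: clamp_itv.
have z0 w : z w != 0.
  rewrite subr_eq0; apply/eqP => e; apply: Dp0; rewrite -e.
  by apply: HD; exact: clamp_itv.
pose S a := exists psi : R -> R, [/\ continuous psi, psi 0 = psi 1 &
  forall t, angle_of (z (t, a)) (psi t)].
have S1 : S 1.
  have [B zB] := angle_of_exists (p - p0).
  exists (fun=> B); split=> // [t|t]; first exact: cvg_cst.
  by rewrite /z /= [clamp 1]clampE ?in_itv /= ?ler01 ?lexx// H1// clamp_itv.
have zc t b : z (clamp t, b) = z (t, b) by rewrite /z /= (clampE (clamp_itv t)).
have z01 b : z (0, b) = z (1, b).
  by rewrite /z /= (@clampE 0) ?(@clampE 1) ?in_itv /= ?ler01 ?lexx// H01 ?clamp_itv.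
have zc0 t : z (clamp t, 0) = c (clamp t) - p0.
  by rewrite /z /= (clampE (clamp_itv t)) (@clampE 0) ?H0 ?clamp_itv// in_itv /= lexx ler01.
clearbody z.
pose q (w : R * (R * R)) := (z (w.1, w.2.1)).1 * (z (w.1, w.2.2)).1 +
  (z (w.1, w.2.1)).2 * (z (w.1, w.2.2)).2.
have cz1 : continuous (fun w : R * (R * R) => z (w.1, w.2.1)).
  apply: (continuous_comp_fun cz); apply: continuous_pairing.
    exact: continuous_fst.
  by apply: (continuous_comp_fun (@continuous_fst _ _)); exact: continuous_snd.
have cz2 : continuous (fun w : R * (R * R) => z (w.1, w.2.2)).
  apply: (continuous_comp_fun cz); apply: continuous_pairing.
    exact: continuous_fst.
  by apply: (continuous_comp_fun (@continuous_snd _ _)); exact: continuous_snd.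
have cq : continuous q.
  apply: continuousD_fun; apply: continuousM_fun.
  - exact: (continuous_comp_fun (@continuous_fst _ _) cz1).
  - exact: (continuous_comp_fun (@continuous_fst _ _) cz2).
  - exact: (continuous_comp_fun (@continuous_snd _ _) cz1).
  - exact: (continuous_comp_fun (@continuous_snd _ _) cz2).
have q0 t a : 0 < q (t, (a, a)).
  rewrite /q /=; case: (z (t, a)) (z0 (t, a)) => u v /= h.
  rewrite lt_def addr_ge0 -?expr2 ?sqr_ge0// andbT.
  apply: contraNneq h => /eqP; rewrite paddr_eq0 ?sqr_ge0// !expf_eq0 /=.
  by move=> /andP[/eqP -> /eqP ->].
have [psi [cpsi psi01 psiP]] : S 0.
  apply: (@locally_constant_forall S _ 1 0 S1) => a.
  have : \forall b \near (a, a), `[0, 1]%classic `<=` (fun t => 0 < q (t, b)).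
    have /compact_near_coveringP := @segment_compact R 0 1.
    move=> /(_ _ (nbhs (a, a)) (fun b t => 0 < q (t, b)) _); apply => t _.
    have qt := cvgr_gt _ (cq (t, (a, a))) _ (q0 t a).
    have [[U V] /= UVt UV] := qt.
    by exists (U, V) => //= -[u v] /= uv; exact: (UV (u, v)).
  move=> [[U V] /= [Ua Va] UV].
  have Uab : nbhs a (U `&` V) by apply: filterI.
  near=> b.
  have St b1 b2 : U b1 -> V b2 -> S b1 -> S b2.
    move=> Ub Vb [psi [cpsi psi01 psiP]].
    pose w t := psi (clamp t) + atan (((z (clamp t, b1)).1 * (z (clamp t, b2)).2 -
       (z (clamp t, b1)).2 * (z (clamp t, b2)).1) / q (clamp t, (b1, b2))).
    exists w; split.
    - apply: continuousD_fun; first exact: (continuous_comp_fun cpsi clamp_continuous).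
      apply: (continuous_comp_fun (@continuous_atan R)) => t.
      have q1 : q (clamp t, (b1, b2)) != 0.
        by rewrite gt_eqF// (UV (b1, b2))//=; exact: clamp_itv.
      have cb e : continuous (fun t => z (clamp t, e)).
        apply: (continuous_comp_fun cz); apply: continuous_pairing.
          exact: clamp_continuous.
        by move=> ?; exact: cvg_cst.
      apply: cvgM; last first.
        apply: cvgV => //; apply: (continuous_comp_fun cq).
        apply: continuous_pairing; first exact: clamp_continuous.
        by move=> ?; exact: cvg_cst.
      move: t {q1}; apply: continuousB_fun; apply: continuousM_fun.
      - exact: (continuous_comp_fun (@continuous_fst _ _) (cb _)).
      - exact: (continuous_comp_fun (@continuous_snd _ _) (cb _)).
      - exact: (continuous_comp_fun (@continuous_snd _ _) (cb _)).
      - exact: (continuous_comp_fun (@continuous_fst _ _) (cb _)).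
    - by rewrite /w /q /= !zc !z01 (@clampE 0) ?(@clampE 1) ?in_itv /= ?ler01 ?lexx// psi01.
    - move=> t.
      rewrite -zc; apply: angle_of_rot.
        by apply: (UV (b1, b2)) => //; exact: clamp_itv.
      exact: psiP.
  have [Ub Vb] : (U `&` V) b by near: b; exact: Uab.
  by split; [apply: (St a b)|apply: (St b a)] => //; [exact: nbhs_singleton Ua|exact: nbhs_singleton Va].
have cd : continuous (fun t => A (clamp t) - psi (clamp t)).
  apply: continuousB_fun; first exact: (continuous_comp_fun cA clamp_continuous).
  exact: (continuous_comp_fun cpsi clamp_continuous).
have ds t : sin (A (clamp t) - psi (clamp t)) = 0.
  apply: (angle_of_sin (z0 (clamp t, 0))); last exact: psiP.
  by rewrite zc0; apply: cAe; exact: clamp_itv.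
set d := fun t => _ in cd.
suff : d 1 = d 0.
  by rewrite /d (@clampE 0) ?(@clampE 1) ?in_itv /= ?ler01 ?lexx// psi01 => /addIr ->.
apply: (@locally_constant_forall (fun t => d t = d 0) _ 0 1 (erefl _)) => t.
have p0' : (0 : R) < pi by exact: pi_gt0.
near=> u.
have du : d u = d t.
  apply/eqP; rewrite -subr_eq0; apply/eqP.
  have : `|d t - d u| < pi by near: u; exact: ((cvgrPdist_lt _ _).1 (cd t) _ p0').
  rewrite distrC ltr_norml => /andP[? ?]; apply: sin_eq0_small => //.
  by rewrite sinB {1}/d ds {2}/d ds; ring.
by rewrite du.
Unshelve. all: by end_near. Qed.

End winding.

Section one_variable_more.
Context {R : realType}.

Lemma continuous_primitive (f : R -> R) (a : R) : continuous f ->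
  exists F : R -> R, (forall t, a < t -> isD F t (f t)) /\
    ((forall t : R, t <= 0 -> f t = 0) -> forall t : R, t <= 0 -> F t = 0).
Proof.
move=> cf; pose F t := (\int[@lebesgue_measure R]_(u in `[a, t]) f u).
exists F; split=> [t at_|f0 t t0].
  have int : (@lebesgue_measure R).-integrable `[a, t + 1] (EFin \o f).
    apply: continuous_compact_integrable; first exact: segment_compact.
    exact: continuous_subspaceT.
  have [] := @continuous_FTC1_closed R f a t (t + 1) _ int at_ (cf t).
    by rewrite ltrDl.
  move=> dF e; apply: isD_eq; first exact: derivable_isD dF.
  exact: e.
rewrite /F (@eq_Rintegral _ _ _ _ _ (cst 0)); first by rewrite Rintegral_cst//= mul0r.
by move=> u; rewrite inE /= in_itv /= => /andP[_ ut]; rewrite f0// (le_trans ut).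
Qed.

Lemma isD_le0 (f : R -> R) (a b d : R) (t : R) :
  (forall u v, a < u -> u <= v -> v < b -> f v <= f u) ->
  (forall u, a < u < b -> derivable f u 1) ->
  a < t < b -> isD f t d -> d <= 0.
Proof.
move=> fle df tab ft; apply/ler_addgt0Pr => e e0; rewrite add0r.
pose g u := f u - e * u.
have dg u c : isD f u c -> isD g u (c - e).
  move=> fc; apply: isD_eq.
    by apply: isDB fc _; apply: isDM; [exact: isD_cst|exact: isD_id].
  by rewrite /= mulr1 mulr0 addr0.
rewrite -subr_le0 -(isD_derive1 (dg _ _ ft)).
apply: (@decr_derive1_le0_itv R g false true a b).
- by move=> u; rewrite inE /= => /itvP uab; apply: isD_derivable; apply: dg; apply: derivable_isD; apply: df; rewrite !uab.
- move=> u v /itvP uab /itvP vab uv; rewrite /g.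
  by apply: ler_ltB; [apply: fle; rewrite ?uab ?vab// ltW|rewrite ltr_pM2l].
- by rewrite in_itv.
Qed.

Lemma continuous_eq_cc (a b : R) (f g : R -> R) : a < b ->
  continuous f -> continuous g -> (forall t, a < t < b -> f t = g t) ->
  forall t, a <= t <= b -> f t = g t.
Proof.
move=> ab cf cg fg t tab; apply/eqP; rewrite -subr_eq0; apply/eqP.
pose h u := f u - g u.
have ch u : {for u, continuous h} by exact: (continuousB_fun cf cg).
have hD u : a < u < b -> isD h u 0.
  move=> /andP[au ub]; apply: (isD_near (f := fun=> 0)); last exact: isD_cst.
  near=> v; rewrite /h fg ?subrr//; apply/andP; split.
    by near: v; exact: lt_nbhsr.
  by near: v; exact: lt_nbhsl.
have m : a <= (a + b) / 2 <= b by rewrite !midf_le// ltW.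
rewrite -/(h t) (isD_cst_eq hD (fun u _ => ch u) tab m) /h fg ?subrr//.
by rewrite !midf_lt.
Unshelve. all: by end_near. Qed.

End one_variable_more.

(** * The curve *)

Record curve_strip {R : realType} (L delta : R) (x y x1 y1 x2 y2 k k1 : R -> R) : Prop :=
  CurveStrip {
    L_gt0 : 0 < L;
    delta_gt0 : 0 < delta;
    x_isD : forall s, isD x s (x1 s);
    y_isD : forall s, isD y s (y1 s);
    x1_isD : forall s, isD x1 s (x2 s);
    y1_isD : forall s, isD y1 s (y2 s);
    k_isD : forall s, isD k s (k1 s);
    x1_smooth : smooth x1;
    y1_smooth : smooth y1;
    k_smooth : smooth k;
    curvatureE : forall s, k s = x1 s * y2 s - y1 s * x2 s;
    curve_inj : forall s t : R, s \in `[0, L] -> t \in `[0, L] ->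
      x s = x t -> y s = y t -> s = t;
    curve_arclength : forall s : R, s \in `[0, L] -> x1 s ^+ 2 + y1 s ^+ 2 = 1;
    curve_sym : forall s : R, s \in `[0, L / 2] -> x (L - s) = - x s /\ y (L - s) = y s;
    curvature_concave : concave_on `[0, L] k;
    jacobian_end : forall s : R, s \in `[0, L] -> 0 < 1 + delta * k s }.

Definition strip_map {R : realType} (x y x1 y1 : R -> R) (s r : R) : R * R :=
  (x s + r * y1 s, y s - r * x1 s).

Lemma continuous_isD {R : realType} (f f' : R -> R) :
  (forall s, isD f s (f' s)) -> continuous f.
Proof. by move=> h s; exact: isD_continuous (h s). Qed.

Lemma near_itv {R : realType} (a b t : R) : a < t < b -> \forall u \near t, a <= u <= b.
Proof.
case/andP=> at_ tb; near=> u.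
by apply/andP; split; apply: ltW; near: u; [exact: lt_nbhsr|exact: lt_nbhsl].
Unshelve. all: by end_near. Qed.

Section curve.
Context {R : realType} (L delta : R) (x y x1 y1 x2 y2 k k1 : R -> R).
Context (S : curve_strip L delta x y x1 y1 x2 y2 k k1).

Lemma half_itv : 0 < L / 2 < L.
Proof. by have L0 := L_gt0 S; rewrite divr_gt0//= ltr_pdivrMr// ltr_pMr// ltr1n. Qed.

Lemma arclength s : 0 <= s <= L -> x1 s ^+ 2 + y1 s ^+ 2 = 1.
Proof. by move=> sL; apply: (curve_arclength S); rewrite in_itv. Qed.

Lemma frenet s : 0 < s < L -> isD x1 s (- (k s * y1 s)) /\ isD y1 s (k s * x1 s).
Proof.
move=> sL.
have dx := x1_isD S s; have dy := y1_isD S s.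
have a : x1 s ^+ 2 + y1 s ^+ 2 = 1.
  by apply: arclength; case/andP: sL => s0 sL; rewrite !ltW.
have o : x1 s * x2 s + y1 s * y2 s = 0.
  have d : isD (fun u => x1 u * x1 u + y1 u * y1 u) s
      (2 * (x1 s * x2 s + y1 s * y2 s)).
    by apply: isD_eq (isDD (isDM dx dx) (isDM dy dy)) _; ring.
  have c : isD (fun u => x1 u * x1 u + y1 u * y1 u) s 0.
    apply: (isD_near (f := fun=> 1)); last exact: isD_cst.
    by apply: filterS (near_itv sL) => u uL; rewrite -!expr2 arclength.
  have := isD_derive1 d; rewrite (isD_derive1 c) => /esym/eqP.
  by rewrite mulf_eq0 pnatr_eq0 /= => /eqP.
rewrite (curvatureE S); split.
  apply: isD_eq dx _.
  rewrite -[LHS]mul1r -a; apply/eqP; rewrite -subr_eq0; apply/eqP.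
  transitivity (x1 s * (x1 s * x2 s + y1 s * y2 s)); first by ring.
  by rewrite o mulr0.
apply: isD_eq dy _.
rewrite -[LHS]mul1r -a; apply/eqP; rewrite -subr_eq0; apply/eqP.
transitivity (y1 s * (x1 s * x2 s + y1 s * y2 s)); first by ring.
by rewrite o mulr0.
Qed.

Lemma sym_all s : 0 <= s <= L -> x (L - s) = - x s /\ y (L - s) = y s.
Proof.
move=> /andP[s0 sL]; have [h|h] := leP s (L / 2); first by apply: (curve_sym S); rewrite in_itv /= s0.
have [|] := curve_sym S (s := L - s).
  by rewrite in_itv /= subr_ge0 sL /=; move: h; lra.
by rewrite opprB addrC subrK => -> ->; rewrite opprK.
Qed.

Lemma sym_derive s : 0 <= s <= L -> x1 (L - s) = x1 s /\ y1 (L - s) = - y1 s.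
Proof.
have cr (f : R -> R) : continuous f -> continuous (fun s : R => f (L - s)).
  move=> cf; apply: (continuous_comp_fun cf).
  by apply: continuousB_fun => t; [exact: cvg_cst|exact: cvg_id].
have dr (f f' : R -> R) t : (forall s, isD f s (f' s)) ->
    isD (fun s => f (L - s)) t (- f' (L - t)).
  move=> df; apply: isD_eq; first apply: (isD_comp (f := f)); first exact: df.
    by apply: isDB; [exact: isD_cst|exact: isD_id].
  by rewrite /=; ring.
have cx1 := continuous_isD (x1_isD S); have cy1 := continuous_isD (y1_isD S).
move=> sL; split; move: s sL; apply: continuous_eq_cc (L_gt0 S) _ _ _.
- exact: cr.
- exact: cx1.
- move=> t tL; apply: oppr_inj; rewrite -(isD_derive1 (dr _ _ t (x_isD S))).
  apply: isD_derive1; apply: (isD_near (f := fun s => - x s)); last exact: isDN (x_isD S _).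
  by apply: filterS (near_itv tL) => u /sym_all[].
- exact: cr.
- exact: continuousN_fun.
- move=> t tL; apply: oppr_inj; rewrite opprK -(isD_derive1 (dr _ _ t (y_isD S))).
  apply: isD_derive1; apply: (isD_near (f := y)); last exact: y_isD S _.
  by apply: filterS (near_itv tL) => u /sym_all[].
Qed.

Lemma curvature_sym s : 0 <= s <= L -> k (L - s) = k s.
Proof.
have ck := continuous_isD (k_isD S).
move: s; apply: (continuous_eq_cc (L_gt0 S) _ ck).
  apply: (continuous_comp_fun ck).
  by apply: continuousB_fun => t; [exact: cvg_cst|exact: cvg_id].
move=> t tL.
have tL' : 0 <= t <= L by case/andP: tL => ? ?; rewrite !ltW.
have Lt : 0 < L - t < L by case/andP: tL => ? ?; apply/andP; split; lra.
have [ex ey] := sym_derive tL'.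
have [dx dy] := frenet tL; have [dx' dy'] := frenet Lt.
have ry : isD (fun s => - y1 (L - s)) t (k (L - t) * x1 (L - t)).
  apply: isD_eq; first apply: isDN; first apply: (isD_comp (f := y1)); first exact: dy'.
    by apply: isDB; [exact: isD_cst|exact: isD_id].
  by rewrite /=; ring.
have rx : isD (fun s => x1 (L - s)) t (k (L - t) * y1 (L - t)).
  apply: isD_eq; first apply: (isD_comp (f := x1)); first exact: dx'.
    by apply: isDB; [exact: isD_cst|exact: isD_id].
  by rewrite /=; ring.
have e1 : k (L - t) * x1 t = k t * x1 t.
  rewrite -{1}ex -(isD_derive1 ry) -(isD_derive1 dy).
  apply: isD_derive1; apply: (isD_near (f := y1)); last exact: derivable_isD (isD_derivable dy).
  by apply: filterS (near_itv tL) => u uL; rewrite (sym_derive uL).2 opprK.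
have e2 : k (L - t) * y1 t = k t * y1 t.
  apply: oppr_inj; rewrite -mulrN -{1}ey -(isD_derive1 rx) -(isD_derive1 dx).
  apply: isD_derive1; apply: (isD_near (f := x1)); last exact: derivable_isD (isD_derivable dx).
  by apply: filterS (near_itv tL) => u uL; rewrite (sym_derive uL).1.
rewrite -[LHS]mulr1 -[RHS]mulr1 -(arclength tL') !mulrDr !expr2 !mulrA e1 e2//.
Qed.

Lemma curvature_nincr s t : L / 2 <= s -> s <= t -> t <= L -> k t <= k s.
Proof.
move=> hs st tL; have /andP[h0 hL] := half_itv.
have [tE|ht] := eqVneq t (L / 2); first by rewrite (_ : s = t)//; lra.
have d0 : 0 < 2 * t - L by move: ht => /eqP ht; lra.
have t0 : 0 <= t by lra.
pose u := (s + t - L) / (2 * t - L).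
have := curvature_concave S (a := L - t) (b := t) (t := u).
rewrite /= !in_itv /= (_ : (1 - u) * (L - t) + u * t = s); last by rewrite /u; field; rewrite gt_eqF.
rewrite curvature_sym; last by rewrite t0.
rewrite -mulrDl subrK mul1r; apply.
- by apply/andP; split; lra.
- by rewrite t0.
- apply/andP; split; first by apply: divr_ge0; lra.
  by rewrite ler_pdivrMr//; lra.
Qed.

Lemma curvature_le_mid s : 0 <= s <= L -> k s <= k (L / 2).
Proof.
move=> /andP[s0 sL]; have /andP[h0 hL] := half_itv.
have [h|/ltW h] := leP (L / 2) s; first exact: curvature_nincr.
by rewrite -curvature_sym ?s0//; apply: curvature_nincr; lra.
Qed.

Lemma jacobian_gt0 s r : 0 <= s <= L -> 0 <= r <= delta -> 0 < 1 + r * k s.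
Proof.
move=> sL /andP[r0 rd]; have := jacobian_end S (s := s); rewrite in_itv /= => /(_ sL) dk.
have [k0|k0] := leP 0 (k s); first by rewrite ltr_pwDl// mulr_ge0.
by apply: lt_le_trans dk _; rewrite lerD2l ler_nM2r.
Qed.

Lemma curvature_derive_le0 s : L / 2 < s < L -> k1 s <= 0.
Proof.
move=> sL; apply: (isD_le0 (f := k) (a := L / 2) (b := L)) sL _.
- by move=> u v hu uv vL; apply: curvature_nincr => //; exact: ltW.
- by move=> u _; exact: isD_derivable (k_isD S u).
- exact: k_isD S _.
Qed.

End curve.

(** * Injectivity of the strip map *)

Lemma ler_cos_pi {R : realType} (a b : R) : 0 <= a -> a <= b -> b <= pi -> cos b <= cos a.
Proof.
move=> a0 ab bpi.
have aI : a \in `[0, pi] by rewrite in_itv /= a0 (le_trans ab).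
have bI : b \in `[0, pi] by rewrite in_itv /= bpi (le_trans a0).
by rewrite leNgt ltr_cos// -leNgt.
Qed.

Section injectivity.
Context {R : realType} (L delta : R) (x y x1 y1 x2 y2 k k1 : R -> R).
Context (S : curve_strip L delta x y x1 y1 x2 y2 k k1).

Definition mid_sign := x1 (L / 2).
Local Notation e := mid_sign.

Lemma mid_frame : e ^+ 2 = 1 /\ y1 (L / 2) = 0.
Proof.
have /andP[h0 hl] := half_itv S.
have h : 0 <= L / 2 <= L by rewrite !ltW.
have [_] := sym_derive S h.
rewrite (_ : L - L / 2 = L / 2); last by lra.
move=> e0; have y0 : y1 (L / 2) = 0 by lra.
by split=> //; have := arclength S h; rewrite y0 expr0n addr0.
Qed.

Context (th : R -> R).
Context (th_isD : forall s, 0 < s -> isD th s (k s)).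
Context (th_cont : continuous th).
Context (th_mid : th (L / 2) = 0).

Lemma cos_angle_isD s (b : R) : 0 < s -> isD (fun s => cos (th s - b)) s (- (k s * sin (th s - b))).
Proof.
move=> s1; apply: isD_eq; first apply: (isD_comp (f := cos)).
- exact: is_derive_cos.
- by apply: isDB; [exact: th_isD|exact: isD_cst].
by rewrite /= subr0; ring.
Qed.

Lemma sin_angle_isD s (b : R) : 0 < s -> isD (fun s => sin (th s - b)) s (k s * cos (th s - b)).
Proof.
move=> s1; apply: isD_eq; first apply: (isD_comp (f := sin)).
- exact: is_derive_sin.
- by apply: isDB; [exact: th_isD|exact: isD_cst].
by rewrite /= subr0; ring.
Qed.

Lemma tangent_angle s : 0 <= s <= L -> x1 s = e * cos (th s) /\ y1 s = e * sin (th s).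
Proof.
move=> sL.
have cx1 := continuous_isD (x1_isD S).
have cy1 := continuous_isD (y1_isD S).
have /andP[h0 hl] := half_itv S; have h : 0 <= L / 2 <= L by rewrite !ltW.
have ct u : {for u, continuous (fun u => cos (th u - 0))} /\
    {for u, continuous (fun u => sin (th u - 0))}.
  by split; apply: (continuous_comp_fun (f := _));
    rewrite -/(continuous _); [exact: continuous_cos| |exact: continuous_sin|];
    apply: continuousB_fun => // ?; exact: cvg_cst.
have D0 : x1 s * cos (th s - 0) + y1 s * sin (th s - 0) = e.
  transitivity (x1 (L / 2) * cos (th (L / 2) - 0) + y1 (L / 2) * sin (th (L / 2) - 0)).
    apply: (isD_cst_eq (a := 0) (b := L)
      (f := fun s => x1 s * cos (th s - 0) + y1 s * sin (th s - 0))) => //.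
    - move=> u uL; have u1 : 0 < u by case/andP: uL.
      have [dx dy] := frenet S uL.
      apply: isD_eq; first apply: isDD; first apply: (isDM dx (cos_angle_isD 0 u1)).
        exact: (isDM dy (sin_angle_isD 0 u1)).
      by rewrite /=; ring.
    - by move=> u _; have [c1 c2] := ct u; apply: cvgD; apply: cvgM => //; [exact: cx1|exact: cy1].
  by rewrite th_mid subr0 cos0 sin0 mulr1 mulr0 addr0.
have D1 : y1 s * cos (th s - 0) - x1 s * sin (th s - 0) = 0.
  transitivity (y1 (L / 2) * cos (th (L / 2) - 0) - x1 (L / 2) * sin (th (L / 2) - 0)).
    apply: (isD_cst_eq (a := 0) (b := L)
      (f := fun s => y1 s * cos (th s - 0) - x1 s * sin (th s - 0))) => //.
    - move=> u uL; have u1 : 0 < u by case/andP: uL.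
      have [dx dy] := frenet S uL.
      apply: isD_eq; first apply: isDB; first apply: (isDM dy (cos_angle_isD 0 u1)).
        exact: (isDM dx (sin_angle_isD 0 u1)).
      by rewrite /=; ring.
    - by move=> u _; have [c1 c2] := ct u; apply: cvgB; apply: cvgM => //; [exact: cy1|exact: cx1].
  by rewrite th_mid subr0 cos0 sin0 mid_frame.2 mulr0 mul0r subr0.
rewrite !subr0 in D0 D1.
have cs := cos2Dsin2 (th s).
split.
- rewrite -[LHS]mulr1 -cs -D0; apply/eqP; rewrite -subr_eq0; apply/eqP.
  transitivity (- sin (th s) * (y1 s * cos (th s) - x1 s * sin (th s))); first by ring.
  by rewrite D1 mulr0.
- rewrite -[LHS]mulr1 -cs -D0; apply/eqP; rewrite -subr_eq0; apply/eqP.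
  transitivity (cos (th s) * (y1 s * cos (th s) - x1 s * sin (th s))); first by ring.
  by rewrite D1 mulr0.
Qed.

Lemma mid_sign_sqr : e * e = 1. Proof. by rewrite -expr2 mid_frame.1. Qed.

(* Coordinates of gamma along the direction of angle b (relative to the tangent at the
   midpoint of gamma) and along the normal to the right of that direction. *)
Definition tangent_coord b s := e * (x s * cos b + y s * sin b).
Definition normal_coord b s := e * (x s * sin b - y s * cos b).
Local Notation P := tangent_coord.
Local Notation N := normal_coord.

Lemma tangent_coord_isD b s : 0 < s < L -> isD (P b) s (cos (th s - b)).
Proof.
move=> sL; have dx := x_isD S s; have dy := y_isD S s.
have [ex ey] : x1 s = e * cos (th s) /\ y1 s = e * sin (th s).
  by apply: tangent_angle; case/andP: sL => ? ?; rewrite !ltW.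
apply: isD_eq; first (rewrite /tangent_coord; apply: isDM; first exact: isD_cst).
  by apply: isDD; apply: isDM; first [eassumption|exact: isD_cst].
rewrite /= ex ey cosB; transitivity (e * e * (cos (th s) * cos b + sin (th s) * sin b)); first by ring.
by rewrite mid_sign_sqr mul1r.
Qed.

Lemma normal_coord_isD b s : 0 < s < L -> isD (N b) s (sin (b - th s)).
Proof.
move=> sL; have dx := x_isD S s; have dy := y_isD S s.
have [ex ey] : x1 s = e * cos (th s) /\ y1 s = e * sin (th s).
  by apply: tangent_angle; case/andP: sL => ? ?; rewrite !ltW.
apply: isD_eq; first (rewrite /normal_coord; apply: isDM; first exact: isD_cst).
  by apply: isDB; apply: isDM; first [eassumption|exact: isD_cst].
rewrite /= ex ey sinB; transitivity (e * e * (sin b * cos (th s) - cos b * sin (th s))); first by ring.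
by rewrite mid_sign_sqr mul1r.
Qed.

Lemma tangent_coord_continuous b : continuous (P b).
Proof.
have cx := continuous_isD (x_isD S); have cy := continuous_isD (y_isD S).
apply: continuousM_fun; first by move=> ?; exact: cvg_cst.
by apply: continuousD_fun; apply: continuousM_fun => //; move=> ?; exact: cvg_cst.
Qed.

Lemma normal_coord_continuous b : continuous (N b).
Proof.
have cx := continuous_isD (x_isD S); have cy := continuous_isD (y_isD S).
apply: continuousM_fun; first by move=> ?; exact: cvg_cst.
by apply: continuousB_fun; apply: continuousM_fun => //; move=> ?; exact: cvg_cst.
Qed.

Lemma tangent_coord_le b s t : 0 <= s -> s <= t -> t <= L ->
  (forall u, s < u < t -> 0 <= cos (th u - b)) -> P b s <= P b t.
Proof.
move=> s0 st tL c0; apply: (isD_le (f' := fun u => cos (th u - b)) st _ c0).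
- by move=> u /andP[su ut]; apply: tangent_coord_isD; apply/andP; split; lra.
- by move=> u _; exact: tangent_coord_continuous.
Qed.

Lemma normal_coord_le b s t : 0 <= s -> s <= t -> t <= L ->
  (forall u, s < u < t -> 0 <= sin (b - th u)) -> N b s <= N b t.
Proof.
move=> s0 st tL c0; apply: (isD_le (f' := fun u => sin (b - th u)) st _ c0).
- by move=> u /andP[su ut]; apply: normal_coord_isD; apply/andP; split; lra.
- by move=> u _; exact: normal_coord_continuous.
Qed.

Lemma angle_le s t : 0 <= s -> s <= t -> t <= L -> (forall u, s < u < t -> 0 <= k u) ->
  th s <= th t.
Proof.
move=> s0 st tL k0; apply: (isD_le (f' := k) st _ k0).
- by move=> u /andP[su ut]; apply: th_isD; lra.
- by move=> u _; exact: th_cont.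
Qed.

Lemma angle_ge s t : 0 <= s -> s <= t -> t <= L -> (forall u, s < u < t -> k u <= 0) ->
  th t <= th s.
Proof.
move=> s0 st tL k0; rewrite -lerN2.
apply: (isD_le (f := fun u => - th u) (f' := fun u => - k u) st).
- by move=> u /andP[su ut]; apply: isDN; apply: th_isD; lra.
- by move=> u /k0; rewrite oppr_ge0.
- by move=> u _; apply: cvgN; exact: th_cont.
Qed.

Lemma tangent_coord0 s : P 0 s = e * x s.
Proof. by rewrite /tangent_coord cos0 sin0 mulr1 mulr0 addr0. Qed.

Lemma x_mid : x (L / 2) = 0.
Proof.
have /andP[h0 hl] := half_itv S.
have [] := @sym_all _ _ _ _ _ _ _ _ _ _ _ S (L / 2); first by rewrite !ltW.
by rewrite (_ : L - L / 2 = L / 2); [move=> h _; lra|lra].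
Qed.

Lemma right_x_neq0 s : L / 2 < s -> s <= L -> e * x s != 0.
Proof.
move=> hs sL; have /andP[h0 hl] := half_itv S.
have sL' : 0 <= s <= L by lra.
have e0 : e != 0 by apply/eqP => e0; have := mid_sign_sqr; rewrite e0 mul0r => /eqP; rewrite eq_sym oner_eq0.
rewrite mulf_neq0//; apply/eqP => xs0.
have [ex ey] := sym_all S sL'.
have := @curve_inj _ _ _ _ _ _ _ _ _ _ _ S s (L - s).
rewrite !in_itv /= ex ey xs0 oppr0 => H.
suff : s = L - s by lra.
by apply: H => //; lra.
Qed.

Lemma right_x_gt0 s : L / 2 < s -> s <= L -> 0 < e * x s.
Proof.
move=> hs sL; have /andP[h0 hl] := half_itv S.
have ccos : continuous (fun u => cos (th u - 0)).
  apply: (continuous_comp_fun (@continuous_cos R)).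
  by apply: continuousB_fun => // ?; exact: cvg_cst.
have : \forall u \near L / 2, 0 < cos (th u - 0).
  by apply: (cvgr_gt _ (ccos (L / 2))); rewrite th_mid subr0 cos0.
move=> /nbhs_ballP[d /= d0 dP0].
pose t := Num.min s (L / 2 + d / 2).
have ht : L / 2 < t by rewrite lt_min hs ltrDl divr_gt0.
have ts : t <= s by rewrite ge_min lexx.
have td : t <= L / 2 + d / 2 by rewrite ge_min lexx orbT.
have Pt : 0 < e * x t.
  rewrite lt_neqAle eq_sym right_x_neq0 ?(le_trans ts)//=.
  have : P 0 (L / 2) <= P 0 t.
    apply: tangent_coord_le; [exact: ltW|exact: ltW|exact: le_trans sL|].
    move=> u /andP[hu ut]; apply: ltW; apply: dP0.
    by rewrite /ball /= distrC gtr0_norm ?subr_gt0//; lra.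
  by rewrite !tangent_coord0 x_mid mulr0.
have [//|xs0] := ltP 0 (e * x s).
have [u /itvP us ux] : exists2 u, u \in `[t, s] & P 0 u = 0.
  apply: IVT => //; first exact/continuous_subspaceT/tangent_coord_continuous.
  by rewrite !tangent_coord0 ge_min xs0 orbT le_max (ltW Pt).
have := @right_x_neq0 u; rewrite -tangent_coord0 ux eqxx => /(_ _ _)/negP[]//.
  by apply: lt_le_trans ht _; rewrite us.
by apply: le_trans sL; rewrite us.
Qed.

(* The derivative of [k x - y'] is [k' x]. *)
Lemma sin_angle_ge s : L / 2 <= s -> s <= L -> k s * (e * x s) <= sin (th s).
Proof.
move=> hs sL; have /andP[h0 hl] := half_itv S.
pose f u := e * y1 u - k u * (e * x u).
have : f (L / 2) <= f s.
  apply: (isD_le (f' := fun u => - k1 u * (e * x u)) hs).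
  - move=> u /andP[hu us].
    have [_ dy] : isD x1 u (- (k u * y1 u)) /\ isD y1 u (k u * x1 u).
      by apply: (frenet S); lra.
    apply: isD_eq; first apply: isDB.
    - by apply: isDM dy; exact: isD_cst.
    - by apply: isDM; [exact: k_isD S _|apply: isDM; [exact: isD_cst|exact: x_isD S _]].
    - by rewrite /=; ring.
  - move=> u /andP[hu us]; rewrite mulNr oppr_ge0 mulr_le0_ge0//.
      by apply: (curvature_derive_le0 S); rewrite hu (lt_le_trans us).
    by apply: ltW; apply: right_x_gt0 => //; rewrite ltW// (lt_le_trans us).
  - have cx := continuous_isD (x_isD S); have cy1 := continuous_isD (y1_isD S).
    have ck := continuous_isD (k_isD S).
    move=> u _; move: u; rewrite -/(continuous _).
    apply: continuousB_fun; apply: continuousM_fun => //; try by move=> ?; exact: cvg_cst.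
    by apply: continuousM_fun => // ?; exact: cvg_cst.
rewrite /f x_mid mid_frame.2 !mulr0 subrr subr_ge0.
rewrite (tangent_angle _).2 ?mulrA ?mid_sign_sqr ?mul1r//; lra.
Qed.

Lemma right_strip_ge s r : L / 2 <= s -> s <= L -> 0 <= r ->
  (e * x s) * (1 + r * k s) <= e * (x s + r * y1 s).
Proof.
move=> hs sL r0; have /andP[h0 hl] := half_itv S.
rewrite (tangent_angle _).2; last by lra.
rewrite [leRHS](_ : _ = e * x s + (e * e) * (r * sin (th s))); last by ring.
by rewrite mid_sign_sqr mul1r mulrDr mulr1 lerD2l mulrCA ler_wpM2l// mulrC sin_angle_ge.
Qed.

Lemma right_strip_gt0 s r : L / 2 < s -> s <= L -> 0 <= r <= delta ->
  0 < e * (x s + r * y1 s).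
Proof.
move=> hs sL rd; have /andP[h0 hl] := half_itv S; case/andP: (rd) => r0 _.
apply: lt_le_trans (right_strip_ge (ltW hs) sL r0).
by rewrite mulr_gt0 ?right_x_gt0// (jacobian_gt0 S)//; lra.
Qed.

Lemma angle_itv s : L / 2 <= s -> s <= L -> 0 <= k s -> 0 <= th s <= pi.
Proof.
move=> hs sL ks; have /andP[h0 hl] := half_itv S.
have k0 u : L / 2 < u < s -> 0 <= k u.
  move=> /andP[hu us]; apply: le_trans ks _.
  by apply: (curvature_nincr S) => //; exact: ltW.
rewrite -{1}th_mid angle_le ?(ltW h0)//= leNgt; apply/negP => ths.
have pi0 := pi_gt0 R.
pose v := pi + Num.min (th s - pi) pi / 2.
have m0 : 0 < Num.min (th s - pi) pi by rewrite lt_min pi0 subr_gt0 ths.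
have m1 : Num.min (th s - pi) pi <= th s - pi by rewrite ge_min lexx.
have m2 : Num.min (th s - pi) pi <= pi by rewrite ge_min lexx orbT.
have [u /itvP us uv] : exists2 u, u \in `[L / 2, s] & th u = v.
  apply: IVT => //; first exact/continuous_subspaceT.
  rewrite th_mid min_l ?max_r; [|by rewrite ltW// (lt_trans pi0)..].
  by rewrite /v; apply/andP; split; lra.
have uL : u <= L by apply: le_trans sL; rewrite us.
have ku : 0 <= k u by apply: le_trans ks _; apply: (curvature_nincr S); rewrite ?us.
have xu : 0 <= e * x u.
  have [->|uh] := eqVneq u (L / 2); first by rewrite x_mid mulr0.
  by apply: ltW; apply: right_x_gt0 => //; rewrite lt_neqAle eq_sym uh us.
have : 0 <= sin (th u).
  by apply: le_trans (sin_angle_ge _ uL); [exact: mulr_ge0|rewrite us].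
rewrite uv leNgt => /negP[].
rewrite -oppr_gt0 -[v](subrK pi) sinDpi opprK; apply: sin_gt0_pi.
by rewrite /v; apply/andP; split; lra.
Qed.

Lemma turning_point : k L < 0 -> exists i, [/\ L / 2 <= i, i < L,
  forall s, i < s -> s <= L -> k s < 0 &
  forall s, L / 2 <= s -> s <= i -> 0 <= th s <= pi /\ (L / 2 < s -> 0 <= k s)].
Proof.
move=> kL; have /andP[h0 hl] := half_itv S.
have [k0|k0] := ltP (k (L / 2)) 0.
  exists (L / 2); split=> // [s hs sL|s hs sh].
    by apply: le_lt_trans k0; apply: (curvature_nincr S) => //; exact: ltW.
  have -> : s = L / 2 by lra.
  by rewrite th_mid lexx pi_ge0 ltxx.
pose A := [set s | L / 2 <= s <= L /\ 0 <= k s].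
have Ah : A (L / 2) by split=> //; lra.
have hA : has_sup A by split; [exists (L / 2)|exists L => s [/andP[]]].
pose i := sup A.
have ih : L / 2 <= i by apply: ub_le_sup => //; exact: hA.2.
have iL : i <= L by apply: ge_sup; [exists (L / 2)|move=> s [/andP[]]].
have ck := continuous_isD (k_isD S).
have ki : 0 <= k i.
  rewrite leNgt; apply/negP => ki.
  have : \forall u \near i, k u < 0 by apply: (cvgr_lt _ (ck i)).
  move=> /nbhs_ballP[d /= d0 dP0].
  have [s [/andP[hs sL] ks] si] := sup_adherent d0 hA.
  have sA : s <= i by apply: ub_le_sup; [exact: hA.2|split=> //; rewrite hs].
  suff : k s < 0 by rewrite ltNge ks.
  by apply: dP0; rewrite /ball /= ger0_norm ?subr_ge0//; rewrite -/i in si; lra.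
exists i; split=> //.
- rewrite lt_neqAle iL andbT; apply/eqP => iE; move: ki; rewrite iE leNgt kL//.
- move=> s si sL; rewrite ltNge; apply/negP => ks.
  have : s <= i by apply: ub_le_sup; [exact: hA.2|split=> //; lra].
  by rewrite leNgt si.
- move=> s hs si; have ks : 0 <= k s by apply: le_trans ki _; apply: (curvature_nincr S).
  by split=> //; apply: angle_itv => //; exact: le_trans si iL.
Qed.

Local Notation Phi := (strip_map x y x1 y1).

Lemma strip_normal_coord b s r : 0 <= s <= L ->
  N b s + r * cos (th s - b) = e * ((Phi s r).1 * sin b - (Phi s r).2 * cos b).
Proof.
move=> sL; rewrite /normal_coord /strip_map /= (tangent_angle sL).1 (tangent_angle sL).2 cosB.
rewrite [RHS](_ : _ = e * (x s * sin b - y s * cos b) +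
  (e * e) * (r * (cos (th s) * cos b + sin (th s) * sin b))); last by ring.
by rewrite mid_sign_sqr mul1r.
Qed.

Lemma strip_tangent_coord b s r : 0 <= s <= L ->
  P b s + r * sin (th s - b) = e * ((Phi s r).1 * cos b + (Phi s r).2 * sin b).
Proof.
move=> sL; rewrite /tangent_coord /strip_map /= (tangent_angle sL).1 (tangent_angle sL).2 sinB.
rewrite [RHS](_ : _ = e * (x s * cos b + y s * sin b) +
  (e * e) * (r * (sin (th s) * cos b - cos (th s) * sin b))); last by ring.
by rewrite mid_sign_sqr mul1r.
Qed.

Lemma strip_coords_eq s1 r1 s2 r2 b : 0 <= s1 <= L -> 0 <= s2 <= L -> Phi s1 r1 = Phi s2 r2 ->
  N b s1 + r1 * cos (th s1 - b) = N b s2 + r2 * cos (th s2 - b) /\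
  P b s1 + r1 * sin (th s1 - b) = P b s2 + r2 * sin (th s2 - b).
Proof. by move=> s1L s2L e12; rewrite !strip_normal_coord// !strip_tangent_coord// e12. Qed.

Lemma no_overlap_convex s1 r1 s2 r2 : L / 2 <= s1 -> s1 < s2 -> s2 <= L ->
  0 <= k s2 -> 0 < r1 -> 0 < r2 -> Phi s1 r1 <> Phi s2 r2.
Proof.
move=> hs1 s12 s2L k2 r10 r20 e12; have /andP[h0 hl] := half_itv S.
have k0 u : L / 2 <= u -> u <= s2 -> 0 <= k u.
  by move=> hu us; apply: le_trans k2 _; apply: (curvature_nincr S).
have th0 u : L / 2 <= u -> u <= s2 -> 0 <= th u <= pi.
  by move=> hu us; apply: angle_itv => //; [exact: le_trans us s2L|exact: k0].
have thm u v : s1 <= u -> u <= v -> v <= s2 -> th u <= th v.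
  move=> su uv vs; apply: angle_le => //; [by lra|by lra|].
  by move=> w /andP[uw wv]; apply: k0; lra.
have /andP[a1 a2] := th0 s1 hs1 (ltW s12).
have /andP[b1 b2] := th0 s2 (ltW (le_lt_trans hs1 s12)) (lexx _).
have s1L : 0 <= s1 <= L by lra.
have s2L' : 0 <= s2 <= L by lra.
have [E1 E1'] := strip_coords_eq (th s1) s1L s2L' e12.
have [E2 _] := strip_coords_eq (th s2) s1L s2L' e12.
have N1 : N (th s1) s2 <= N (th s1) s1.
  rewrite -lerN2; apply: (isD_le (f := fun u => - N (th s1) u)
    (f' := fun u => - sin (th s1 - th u)) (ltW s12)).
  - by move=> u /andP[su us]; apply: isDN; apply: normal_coord_isD; lra.
  - move=> u /andP[su us]; rewrite -sinN opprB; apply: sin_ge0_pi.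
    have /andP[c1 c2] := th0 u (ltW (le_lt_trans hs1 su)) (ltW us).
    by rewrite subr_ge0 (thm s1 u)//=; [lra|exact: ltW|exact: ltW].
  - by move=> u _; apply: cvgN; exact: normal_coord_continuous.
have N2 : N (th s2) s1 <= N (th s2) s2.
  apply: normal_coord_le => //; [by lra|exact: ltW|move=> u /andP[su us]; apply: sin_ge0_pi].
  have /andP[c1 c2] := th0 u (ltW (le_lt_trans hs1 su)) (ltW us).
  by rewrite subr_ge0 (thm u s2)//=; [lra|exact: ltW|exact: ltW].
rewrite !subrr !cos0 in E1 E2; rewrite -cosN opprB in E1.
set C := cos (th s1 - th s2) in E1 E2.
have C1 : C <= 1 by exact: cos_le1.
have I1 : r1 <= r2 * C by lra.
have I2 : r2 <= r1 * C by lra.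
have C0 : C = 1 by nra.
have th12 : th s2 - th s1 = 0.
  apply: (@cos_inj R); rewrite ?in_itv /= ?lexx ?pi_ge0//.
    by rewrite subr_ge0 thm//=; [lra|exact: ltW].
  by rewrite cos0 -C0 /C -cosN opprB.
have P1 : P (th s1) s2 = P (th s1) s1 + (s2 - s1).
  suff : P (th s1) s2 - s2 = P (th s1) s1 - s1 by lra.
  apply: (isD_cst_eq (a := s1) (b := s2) (f := fun u => P (th s1) u - u)).
  - move=> u /andP[su us]; apply: isD_eq; first apply: isDB.
    + by apply: tangent_coord_isD; lra.
    + exact: isD_id.
    have -> : th u - th s1 = 0.
      by apply/eqP; rewrite eq_le -{1}th12 lerD2r thm ?subr_ge0 ?thm// ?ltW.
    by rewrite cos0 subrr.
  - by move=> u _; apply: cvgB; [exact: tangent_coord_continuous|exact: cvg_id].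
  - by rewrite (ltW s12) lexx.
  - by rewrite (ltW s12) lexx.
by move: E1'; rewrite th12 subrr sin0 P1; lra.
Qed.

Section volute.
Context (i : R) (kL : k L < 0) (ih : L / 2 <= i) (iL : i < L).
Context (k_neg : forall s, i < s -> s <= L -> k s < 0).
Context (th_pi : forall s, L / 2 <= s -> s <= i -> 0 <= th s <= pi /\ (L / 2 < s -> 0 <= k s)).

Definition end_radius := - (k L)^-1.
Local Notation rho := end_radius.

Lemma end_radius_gt : delta < rho.
Proof.
have L0 := L_gt0 S; have := jacobian_end S (s := L).
rewrite in_itv /= lexx (ltW L0) => /(_ isT) J.
have kn : 0 < - k L by rewrite oppr_gt0.
by rewrite /end_radius -invrN -(ltr_pM2r kn) mulVf ?gt_eqF//; lra.
Qed.

Lemma end_radius_gt0 : 0 < rho.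
Proof. exact: lt_trans (delta_gt0 S) end_radius_gt. Qed.

Lemma end_jacobian_ge0 s : L / 2 <= s -> s <= L -> 0 <= 1 + rho * k s.
Proof.
move=> hs sL; have kk : k L <= k s by exact: (curvature_nincr S).
have : rho * k L <= rho * k s by rewrite ler_pM2l// end_radius_gt0.
by rewrite {1}/end_radius mulNr mulVf ?lt_eqF//; lra.
Qed.

(* The center of curvature at the endpoint is at distance at least [rho] beyond the
   tangent at [s]: the osculating disks are nested. *)
Lemma osculating_nested s : i <= s -> s <= L ->
  N (th s) s + rho <= N (th s) L + rho * cos (th L - th s).
Proof.
move=> is_ sL; have /andP[h0 hl] := half_itv S.
wlog lis : s is_ sL / i < s.
  move=> W; have [->|si] := eqVneq s i; last by apply: W => //; rewrite lt_neqAle eq_sym si.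
  rewrite leNgt; apply/negP => H.
  pose g s := N (th s) L + rho * cos (th L - th s) - (N (th s) s + rho).
  have cg : continuous g.
    have cx := continuous_isD (x_isD S); have cy := continuous_isD (y_isD S).
    have csin : continuous (fun s => sin (th s)) by exact: continuous_comp_fun (@continuous_sin R) th_cont.
    have ccos : continuous (fun s => cos (th s)) by exact: continuous_comp_fun (@continuous_cos R) th_cont.
    have cc (c : R) : continuous (fun _ : R => c) by move=> ?; exact: cvg_cst.
    have cB (c : R) : continuous (fun s => cos (c - th s)).
      by apply: (continuous_comp_fun (@continuous_cos R)); exact: continuousB_fun.
    have cN1 (c d : R) : continuous (fun s => e * (c * sin (th s) - d * cos (th s))).
      by apply: (continuousM_fun (cc _)); apply: continuousB_fun; exact: (continuousM_fun (cc _)).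
    have cN2 : continuous (fun s => e * (x s * sin (th s) - y s * cos (th s))).
      by apply: (continuousM_fun (cc _)); apply: continuousB_fun; exact: continuousM_fun.
    apply: continuousB_fun.
      by apply: continuousD_fun; [exact: cN1|exact: (continuousM_fun (cc _) (cB _))].
    exact: (continuousD_fun cN2 (cc _)).
  have gi : g i < 0 by rewrite /g; lra.
  have : \forall u \near i, g u < 0 by apply: (cvgr_lt _ (cg i)).
  move=> /nbhs_ballP[d /= d0 dP0].
  pose t := Num.min L (i + d / 2).
  have ti : i < t by rewrite lt_min iL ltrDl divr_gt0.
  have td : t <= i + d / 2 by rewrite ge_min lexx orbT.
  have tL : t <= L by rewrite ge_min lexx.
  have : g t < 0 by apply: dP0; rewrite /ball /= distrC gtr0_norm ?subr_gt0//; lra.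
  by have := W t (ltW ti) tL ti; rewrite /g; lra.
set b := th s.
pose f t := N b t + (- (k t)^-1) * (cos (th t - b) - 1).
have kt t : s <= t <= L -> k t < 0.
  by move=> /andP[st tL]; apply: k_neg => //; exact: lt_le_trans st.
have : f s <= f L.
  apply: (isD_le (f' := fun t => k1 t / k t ^+ 2 * (cos (th t - b) - 1)) sL).
  - move=> t /andP[st tL]; have kt0 : k t != 0 by rewrite lt_eqF ?kt// !ltW.
    apply: isD_eq; first apply: isDD.
    + apply: normal_coord_isD; have t0 : 0 < t by move: st ih lis h0; lra.
      by rewrite t0.
    + apply: isDM; first by apply: isDN; apply: isDV => //; exact: k_isD S _.
      by apply: isDB; [apply: cos_angle_isD; move: st ih lis h0; lra|exact: isD_cst].
    by rewrite /= -[b - th t]opprB sinN; field.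
  - move=> t /andP[st tL]; rewrite mulr_le0// ?subr_le0 ?cos_le1//.
    rewrite pmulr_lle0 ?invr_gt0 ?exprn_even_gt0//= ?lt_eqF ?kt ?(ltW st) ?(ltW tL)//.
    by apply: (curvature_derive_le0 S); rewrite tL andbT; move: st ih lis; lra.
  - move=> t /andP[st tL]; apply: cvgD; first exact: normal_coord_continuous.
    apply: cvgM.
      apply: cvgN; apply: cvgV; first by rewrite lt_eqF ?kt// st.
      exact: continuous_isD (k_isD S) t.
    apply: cvgB; last exact: cvg_cst.
    move: t {st tL}; apply: (continuous_comp_fun (@continuous_cos R)).
    by apply: continuousB_fun => // ?; exact: cvg_cst.
by rewrite /f subrr cos0 subrr mulr0 addr0 -/end_radius; lra.
Qed.

Lemma center_beyond s r : L / 2 <= s -> s <= L -> 0 <= r < rho ->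
  let b := th (Num.max s i) in
  N b s + r * cos (th s - b) < N b L + rho * cos (th L - b).
Proof.
move=> hs sL /andP[r0 rrho] /=; set b := th _; have /andP[h0 hl] := half_itv S.
have c1 : r * cos (th s - b) <= r by rewrite ler_piMr// cos_le1.
have [si|si] := leP i s.
  have bE : b = th s by rewrite /b max_l.
  have := osculating_nested si sL; rewrite -bE.
  by rewrite bE in c1 *; lra.
have bE : b = th i by rewrite /b max_r// ltW.
have := osculating_nested (lexx i) (ltW iL); rewrite -bE => H.
suff : N b s <= N b i by lra.
have [/andP[t1 t2] _] := th_pi ih (lexx i).
apply: normal_coord_le => //; [by lra|exact: ltW|exact: ltW|].
move=> u /andP[su ui]; apply: sin_ge0_pi; rewrite bE.
have [/andP[u1 u2] _] := th_pi (ltW (le_lt_trans hs su)) (ltW ui).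
have : th u <= th i.
  apply: angle_le; [by lra|exact: ltW|exact: ltW|].
  by move=> v /andP[uv vi]; apply: (th_pi _ (ltW vi)).2; lra.
by move=> ?; lra.
Qed.

Lemma not_in_strip s r : 0 < s < L -> 0 < r < delta -> Phi s r <> Phi L rho.
Proof.
move=> /andP[s0 sL] /andP[r0 rd] E; have /andP[h0 hl] := half_itv S.
have rr : 0 <= r < rho by rewrite ltW//= (lt_trans rd end_radius_gt).
have LL : 0 <= L <= L by rewrite lexx ltW// (L_gt0 S).
have [hs|hs] := leP (L / 2) s.
  have := center_beyond hs (ltW sL) rr; rewrite /= strip_normal_coord ?strip_normal_coord ?E ?ltxx//.
  by rewrite !ltW.
have := @right_strip_ge L rho (ltW hl) (lexx L) (ltW end_radius_gt0).
rewrite {1}/end_radius mulNr mulVf ?lt_eqF// subrr mulr0.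
have -> : x L + rho * y1 L = (Phi L rho).1 by [].
rewrite -E /=; have sL' : 0 <= s <= L by lra.
have [ex _] := sym_all S sL'; have [_ ey] := sym_derive S sL'.
rewrite -[x s]opprK -[y1 s]opprK -ex -ey mulrN -opprD mulrN oppr_ge0 leNgt => /negP[].
by apply: right_strip_gt0; lra.
Qed.

Lemma winding_bound (D : set (R * R)) s1 r1 s2 r2 : simply_connected D ->
  D = [set p | exists s r, [/\ 0 < s < L, 0 < r < delta & p = Phi s r]] ->
  L / 2 <= s1 -> s1 < s2 -> s2 < L -> 0 < r1 < delta -> 0 < r2 < delta ->
  Phi s1 r1 = Phi s2 r2 -> `|th (Num.max s1 i) - th (Num.max s2 i)| < pi.
Proof.
move=> sc DE hs1 s12 s2L r1d r2d E; have /andP[h0 hl] := half_itv S.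
have Dc : ~ D (Phi L rho).
  by rewrite DE => -[s [r [sL rd /esym]]]; exact: not_in_strip.
pose sg (t : R) := s1 + clamp t * (s2 - s1).
pose rr (t : R) := r1 + clamp t * (r2 - r1).
have sgP t : L / 2 <= sg t /\ sg t < L.
  have /itvP tc := clamp_itv t.
  have c0 : 0 <= clamp t * (s2 - s1) by rewrite mulr_ge0 ?tc ?subr_ge0 ?(ltW s12).
  have c1 : clamp t * (s2 - s1) <= s2 - s1 by rewrite ler_piMl ?tc ?subr_ge0 ?(ltW s12).
  by rewrite /sg; split; lra.
have rrP t : 0 < rr t < delta.
  have /itvP tc := clamp_itv t.
  have -> : rr t = (1 - clamp t) * r1 + clamp t * r2 by rewrite /rr; ring.
  move: tc; set u := clamp t => tc.
  have [/andP[a1 a2] /andP[b1 b2]] := (r1d, r2d).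
  have u1 : u <= 1 by rewrite tc.
  have [->|u0] := eqVneq u 0; first by rewrite subr0 !mul1r mul0r addr0 a1.
  have {}u0 : 0 < u by rewrite lt_neqAle eq_sym u0 tc.
  have v1 : 0 <= (1 - u) * r1 by rewrite mulr_ge0 ?subr_ge0// ltW.
  have v2 : 0 < u * r2 by rewrite mulr_gt0.
  have v3 : 0 <= (1 - u) * (delta - r1) by rewrite mulr_ge0 ?subr_ge0// ltW.
  have v4 : 0 < u * (delta - r2) by rewrite mulr_gt0 ?subr_gt0.
  by apply/andP; split; nra.
have cc (c : R) : continuous (fun _ : R => c) by move=> ?; exact: cvg_cst.
have csg : continuous sg.
  by apply: (continuousD_fun (cc _)); exact: (continuousM_fun clamp_continuous (cc _)).
have crr : continuous rr.
  by apply: (continuousD_fun (cc _)); exact: (continuousM_fun clamp_continuous (cc _)).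
pose z1 t := (Phi (sg t) (rr t)).1 - (Phi L rho).1.
pose z2 t := (Phi (sg t) (rr t)).2 - (Phi L rho).2.
have cx := continuous_isD (x_isD S); have cy := continuous_isD (y_isD S).
have cx1 := continuous_isD (x1_isD S); have cy1 := continuous_isD (y1_isD S).
have cP1 : continuous (fun t => (Phi (sg t) (rr t)).1).
  apply: continuousD_fun; first exact: (continuous_comp_fun cx csg).
  exact: (continuousM_fun crr (continuous_comp_fun cy1 csg)).
have cP2 : continuous (fun t => (Phi (sg t) (rr t)).2).
  apply: continuousB_fun; first exact: (continuous_comp_fun cy csg).
  exact: (continuousM_fun crr (continuous_comp_fun cx1 csg)).
have cz1 : continuous z1 by exact: (continuousB_fun cP1 (cc _)).
have cz2 : continuous z2 by exact: (continuousB_fun cP2 (cc _)).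
pose b t := th (Num.max (sg t) i).
have cb : continuous b.
  apply: (continuous_comp_fun th_cont) => t.
  by apply: continuous_max; [exact: csg|exact: cvg_cst].
have csb : continuous (fun t => sin (b t)) by exact: continuous_comp_fun (@continuous_sin R) cb.
have ccb : continuous (fun t => cos (b t)) by exact: continuous_comp_fun (@continuous_cos R) cb.
pose X t := e * (z1 t * cos (b t) + z2 t * sin (b t)).
pose Y t := e * (z2 t * cos (b t) - z1 t * sin (b t)).
have cX : continuous X.
  apply: (continuousM_fun (cc _)).
  by apply: continuousD_fun; exact: continuousM_fun.
have cY : continuous Y.
  apply: (continuousM_fun (cc _)).
  by apply: continuousB_fun; exact: continuousM_fun.
have Y0 t : 0 < Y t.
  have [a1 a2] := sgP t; have /andP[b1 b2] := rrP t.
  have sgL : 0 <= sg t <= L by lra.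
  have LL : 0 <= L <= L by rewrite lexx ltW// (L_gt0 S).
  have rro : 0 <= rr t < rho by rewrite ltW//= (lt_trans b2 end_radius_gt).
  have := center_beyond a1 (ltW a2) rro; rewrite /= -/(b t) !strip_normal_coord// -subr_gt0.
  rewrite -mulrBr /Y /z1 /z2; congr (0 < e * _); ring.
pose A t := b t + (pi / 2 - atan (X t / Y t)).
have cA : continuous A.
  apply: (continuousD_fun cb); apply: (continuousB_fun (cc _)).
  apply: (continuous_comp_fun (@continuous_atan R)) => t.
  by apply: cvgM; [exact: cX|apply: cvgV; [rewrite gt_eqF|exact: cY]].
have : A 0 = A 1.
  apply: (simply_connected_angle (c := fun t => Phi (sg t) (rr t)) sc Dc) cA _.
  - exact: continuous_pairing.
  - rewrite /sg /rr (@clampE _ 0) ?(@clampE _ 1) ?in_itv /= ?lexx ?ler01//.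
    by rewrite !mul0r !addr0 !mul1r !subrKC.
  - move=> t _; rewrite DE; exists (sg t), (rr t); split=> //.
    by have [a1 a2] := sgP t; rewrite a2 (lt_le_trans h0).
  - move=> t _; rewrite /angle_of /= -/(z1 t) -/(z2 t) /A.
    set al := pi / 2 - _.
    have XY : X t * sin al = Y t * cos al.
      rewrite /al -[pi / 2 - _]opprB sinN cosN sinBpihalf cosBpihalf opprK.
      set a := atan _.
      have /andP[d1 d2] : - (pi / 2) < a < pi / 2 by rewrite atan_gtNpi2 atan_ltpi2.
      have ca : cos a != 0 by rewrite gt_eqF// cos_gt0_pihalf// d1.
      have := @atanK R (X t / Y t); rewrite -/a /tan => /eqP.
      by rewrite eqr_div ?ca ?(lt0r_neq0 (Y0 t))// => /eqP h; rewrite -h mulrC.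
    have Z1 : z1 t = e * (X t * cos (b t) - Y t * sin (b t)).
      rewrite /X /Y; transitivity ((e * e) * (z1 t * (cos (b t) ^+ 2 + sin (b t) ^+ 2))); last by ring.
      by rewrite mid_sign_sqr cos2Dsin2 mul1r mulr1.
    have Z2 : z2 t = e * (X t * sin (b t) + Y t * cos (b t)).
      rewrite /X /Y; transitivity ((e * e) * (z2 t * (cos (b t) ^+ 2 + sin (b t) ^+ 2))); last by ring.
      by rewrite mid_sign_sqr cos2Dsin2 mul1r mulr1.
    rewrite Z1 Z2 sinD cosD; apply/eqP; rewrite -subr_eq0; apply/eqP.
    transitivity (e * ((cos (b t) ^+ 2 + sin (b t) ^+ 2) * (X t * sin al - Y t * cos al))); first by ring.
    by rewrite XY subrr !mulr0.
rewrite /A /b /sg (@clampE _ 0) ?(@clampE _ 1) ?in_itv /= ?lexx ?ler01//.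
rewrite mul0r addr0 mul1r subrKC => HA.
set a0 := atan _ in HA; set a1 := atan (X 1 / Y 1) in HA.
have [q1 q2] : - (pi / 2) < a0 /\ a0 < pi / 2 by rewrite atan_gtNpi2 atan_ltpi2.
have [q3 q4] : - (pi / 2) < a1 /\ a1 < pi / 2 by rewrite atan_gtNpi2 atan_ltpi2.
by rewrite ltr_norml; apply/andP; split; lra.
Qed.

Lemma no_overlap_volute (D : set (R * R)) s1 r1 s2 r2 : simply_connected D ->
  D = [set p | exists s r, [/\ 0 < s < L, 0 < r < delta & p = Phi s r]] ->
  L / 2 <= s1 -> s1 < s2 -> s2 < L -> i < s2 -> 0 < r1 < delta -> 0 < r2 < delta ->
  Phi s1 r1 <> Phi s2 r2.
Proof.
move=> sc DE hs1 s12 s2L is2 r1d r2d E; have /andP[h0 hl] := half_itv S.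
have := winding_bound sc DE hs1 s12 s2L r1d r2d E.
rewrite [Num.max s2 i]max_l ?(ltW is2)//; set j := Num.max s1 i; set b := th j => W.
have js2 : j < s2 by rewrite gt_max s12.
have s1j : s1 <= j by rewrite le_max lexx.
have ij : i <= j by rewrite le_max lexx orbT.
have kneg u : j < u -> u <= L -> k u < 0.
  by move=> ju uL; apply: k_neg => //; exact: le_lt_trans ju.
have thn u v : j <= u -> u <= v -> v <= s2 -> th v <= th u.
  move=> ju uv vs; apply: angle_ge => //; [by lra|by lra|].
  by move=> w /andP[uw wv]; apply/ltW/kneg; lra.
have psi0 : th s2 < b.
  pose m := (j + s2) / 2.
  have [jm ms] : j < m /\ m < s2 by rewrite /m; split; rewrite midf_lt.
  have km : k m < 0 by apply: kneg => //; lra.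
  have : - th m + k m * m <= - th s2 + k m * s2.
    apply: (isD_le (f := fun u => - th u + k m * u) (f' := fun u => k m - k u) (ltW ms)).
    - move=> u /andP[mu us]; apply: isD_eq.
        apply: isDD; first by apply: isDN; apply: th_isD; lra.
        by apply: isDM; [exact: isD_cst|exact: isD_id].
      by rewrite /= mulr1 mulr0 addr0 addrC.
    - by move=> u /andP[mu us]; rewrite subr_ge0; apply: (curvature_nincr S); lra.
    - move=> u _; apply: cvgD; first by apply: cvgN; exact: th_cont.
      by apply: cvgM; [exact: cvg_cst|exact: cvg_id].
  have := thn j m (lexx j) (ltW jm) (ltW ms); rewrite -/b; nra.
have psipi : b - th s2 < pi by move: W; rewrite gtr0_norm ?subr_gt0.
have phi0 u : s1 <= u -> u <= j -> 0 <= b - th u /\ b - th u <= b - th s1 <= pi.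
  move=> su uj; have [is1|si] := leP i s1.
    have jE : j = s1 by rewrite /j max_l.
    have uE : u = s1 by lra.
    by rewrite uE /b jE subrr lexx pi_ge0.
  have jE : j = i by rewrite /j max_r// ltW.
  have ui : u <= i by rewrite -jE.
  have [/andP[a1 a2] _] := th_pi ih (lexx i).
  have [/andP[b1 b2] _] := th_pi hs1 (ltW si).
  have A1 : th s1 <= th u.
    apply: angle_le; [by lra|by []|by lra|].
    by move=> v /andP[sv vu]; apply: (th_pi _ _).2; lra.
  have A2 : th u <= th i.
    apply: angle_le; [by lra|by []|exact: ltW|].
    by move=> v /andP[uv vi]; apply: (th_pi _ _).2; lra.
  by rewrite /b jE; split; [lra|apply/andP; split; lra].
have s1L : 0 <= s1 <= L by lra.
have s2L' : 0 <= s2 <= L by lra.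
have [EN EP] := strip_coords_eq b s1L s2L' E.
clear D sc DE E W.
have jL : j < L by lra.
have j0 : 0 <= j by lra.
have H1 : N b s1 <= N b j.
  apply: normal_coord_le => //; [by lra|exact: ltW|move=> u /andP[su uj]].
  have [c1 /andP[c2 c3]] := phi0 u (ltW su) (ltW uj).
  by apply: sin_ge0_pi; rewrite c1 (le_trans c2).
have cths (f : R -> R) : continuous f -> continuous (fun u => f (th u - b)).
  move=> cf; apply: (continuous_comp_fun cf); apply: continuousB_fun => // ?; exact: cvg_cst.
have psiu u : j < u -> u < s2 -> 0 <= b - th u <= b - th s2.
  by move=> ju us; rewrite subr_ge0 thn ?lerD2l ?lerN2 ?thn// ltW.
have H2 : N b j - rho * (1 - cos (th j - b)) <= N b s2 - rho * (1 - cos (th s2 - b)).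
  apply: (isD_le (f := fun t => N b t - rho * (1 - cos (th t - b)))
    (f' := fun t => sin (b - th t) * (1 + rho * k t)) (ltW js2)).
  - move=> u /andP[ju us]; have u0 : 0 < u by lra.
    apply: isD_eq; first apply: isDB.
    + by apply: normal_coord_isD; rewrite u0; lra.
    + by apply: isDM; [exact: isD_cst|apply: isDB; [exact: isD_cst|exact: cos_angle_isD]].
    + by rewrite /= -[b - th u]opprB sinN; ring.
  - move=> u /andP[ju us]; apply: mulr_ge0; last by apply: end_jacobian_ge0; lra.
    have /andP[c1 c2] := psiu u ju us.
    by apply: sin_ge0_pi; rewrite c1 (le_trans c2)// ltW.
  - move=> u _; apply: cvgB; first exact: normal_coord_continuous.
    apply: cvgM; first exact: cvg_cst.
    by apply: cvgB; [exact: cvg_cst|exact: (cths _ (@continuous_cos R))].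
have H3 : P b j + rho * sin (th j - b) <= P b s2 + rho * sin (th s2 - b) \/ cos (b - th s2) <= 0.
  have [?|c0] := leP (cos (b - th s2)) 0; [by right|left].
  apply: (isD_le (f := fun t => P b t + rho * sin (th t - b))
    (f' := fun t => cos (th t - b) * (1 + rho * k t)) (ltW js2)).
  - move=> u /andP[ju us]; have u0 : 0 < u by lra.
    apply: isD_eq; first apply: isDD.
    + by apply: tangent_coord_isD; rewrite u0; lra.
    + by apply: isDM; [exact: isD_cst|exact: sin_angle_isD].
    + by rewrite /=; ring.
  - move=> u /andP[ju us]; apply: mulr_ge0; last by apply: end_jacobian_ge0; lra.
    have /andP[c1 c2] := psiu u ju us.
    by rewrite -cosN opprB (le_trans (ltW c0))// ler_cos_pi// ltW.
  - move=> u _; apply: cvgD; first exact: tangent_coord_continuous.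
    by apply: cvgM; [exact: cvg_cst|exact: (cths _ (@continuous_sin R))].
have bj : th j - b = 0 by rewrite /b subrr.
rewrite bj cos0 sin0 in H2 H3.
have [/andP[r10 r1de] /andP[r20 r2de]] := (r1d, r2d).
have rd := end_radius_gt.
rewrite -![cos (_ - b)]cosN !opprB in EN H2.
have C1 : cos (b - th s1) <= 1 by exact: cos_le1.
have C2 : cos (b - th s2) <= 1 by exact: cos_le1.
have M1 : 0 <= r1 * (1 - cos (b - th s1)) by apply: mulr_ge0; lra.
have c2pos : 0 < cos (b - th s2).
  rewrite ltNge; apply/negP => c.
  have : 0 <= (rho - r2) * - cos (b - th s2) by apply: mulr_ge0; lra.
  by lra.
have c1pos : 0 < cos (b - th s1).
  rewrite ltNge; apply/negP => c.
  have : 0 <= r1 * - cos (b - th s1) by apply: mulr_ge0; lra.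
  have : 0 <= (rho - r2) * (1 - cos (b - th s2)) by apply: mulr_ge0; lra.
  by lra.
have {H3} : P b j + rho * 0 <= P b s2 + rho * sin (th s2 - b).
  by case: H3 => // c; lra.
have H4 : P b s1 <= P b j.
  apply: tangent_coord_le => //; [by lra|exact: ltW|move=> u /andP[su uj]].
  have [d1 /andP[d2 d3]] := phi0 u (ltW su) (ltW uj).
  by rewrite -cosN opprB (le_trans (ltW c1pos))// ler_cos_pi.
have S2 : 0 < sin (b - th s2) by rewrite sin_gt0_pi// subr_gt0 psi0.
have S1 : 0 <= sin (b - th s1).
  have [d1 /andP[d2 d3]] := phi0 s1 (lexx _) s1j.
  by rewrite sin_ge0_pi// d1.
rewrite -[th s1 - b]opprB -[th s2 - b]opprB !sinN in EP * => H3.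
have : 0 <= r1 * sin (b - th s1) by apply: mulr_ge0; lra.
have : 0 < (rho - r2) * sin (b - th s2) by apply: mulr_gt0; lra.
by lra.
Qed.

End volute.

Lemma no_overlap_right (D : set (R * R)) s1 r1 s2 r2 : simply_connected D ->
  D = [set p | exists s r, [/\ 0 < s < L, 0 < r < delta & p = Phi s r]] ->
  L / 2 <= s1 -> s1 < s2 -> s2 < L -> 0 < r1 < delta -> 0 < r2 < delta ->
  Phi s1 r1 <> Phi s2 r2.
Proof.
move=> sc DE hs1 s12 s2L r1d r2d.
have [[r10 _] [r20 _]] := (andP r1d, andP r2d).
have [k2|k2] := leP 0 (k s2).
  by apply: no_overlap_convex => //; exact: ltW.
have kL : k L < 0.
  by apply: le_lt_trans k2; apply: (curvature_nincr S); lra.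
have [i [ih iL k_neg th_pi]] := turning_point kL.
have [s2i|is2] := leP s2 i; last exact: (no_overlap_volute kL ih iL k_neg th_pi sc DE).
have hs2 := le_lt_trans hs1 s12.
by have := (th_pi s2 (ltW hs2) s2i).2 hs2; rewrite leNgt k2.
Qed.

End injectivity.

Section strip_injective.
Context {R : realType} (L delta : R) (x y x1 y1 x2 y2 k k1 : R -> R).
Context (S : curve_strip L delta x y x1 y1 x2 y2 k k1).
Local Notation Phi := (strip_map x y x1 y1).
Context (D : set (R * R)) (D_sc : simply_connected D).
Context (DE : D = [set p | exists s r, [/\ 0 < s < L, 0 < r < delta & p = Phi s r]]).

Lemma turning_angle_exists : exists th : R -> R,
  [/\ forall s, 0 < s -> isD th s (k s), continuous th & th (L / 2) = 0].
Proof.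
have [F [dF _]] := @continuous_primitive R k (-1) (continuous_isD (k_isD S)).
exists (fun t => F (Num.max 0 t) - F (L / 2)); split.
- move=> s s0; apply: isD_eq; last exact: subr0.
  apply: isDB; last exact: isD_cst.
  apply: (isD_near (f := F)); last by apply: dF; lra.
  near=> u; rewrite max_r// ltW//; near: u; exact: lt_nbhsr.
- apply: continuousB_fun => t; last exact: cvg_cst.
  have cm : continuous (fun t : R => Num.max 0 t).
    by move=> u; apply: continuous_max; [exact: cvg_cst|exact: cvg_id].
  have m1 : -1 < Num.max 0 t by rewrite lt_max; apply/orP; left; lra.
  exact: (cvg_comp _ _ (cm t) (isD_continuous (dF _ m1))).
- by have /andP[h0 _] := half_itv S; rewrite max_r ?subrr// ltW.
Unshelve. all: by end_near. Qed.

Lemma strip_map_inj_r s r1 r2 : 0 <= s <= L -> Phi s r1 = Phi s r2 -> r1 = r2.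
Proof.
move=> sL [/addrI e1 /addrI /oppr_inj e2].
rewrite -[LHS]mulr1 -[RHS]mulr1 -(arclength S sL) !mulrDr !expr2 !mulrA e1 e2//.
Qed.

Lemma strip_map_sym s r : 0 <= s <= L -> Phi (L - s) r = (- (Phi s r).1, (Phi s r).2).
Proof.
move=> sL; rewrite /strip_map /=.
have [-> ->] := sym_all S sL; have [-> ->] := sym_derive S sL.
by rewrite mulrN -opprD.
Qed.

Lemma strip_map_inj s1 r1 s2 r2 : 0 < s1 < L -> 0 < r1 < delta ->
  0 < s2 < L -> 0 < r2 < delta -> Phi s1 r1 = Phi s2 r2 -> s1 = s2 /\ r1 = r2.
Proof.
have [th [th_isD th_cont th_mid]] := turning_angle_exists.
have NR := no_overlap_right S th_isD th_cont th_mid D_sc DE.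
suff W s1' r1' s2' r2' : 0 < s1' < L -> 0 < r1' < delta -> 0 < s2' < L -> 0 < r2' < delta ->
    s1' < s2' -> Phi s1' r1' <> Phi s2' r2'.
  move=> s1L r1d s2L r2d E; have [s12|s21|s12] := ltgtP s1 s2.
  - by have := W _ _ _ _ s1L r1d s2L r2d s12.
  - by have := W _ _ _ _ s2L r2d s1L r1d s21; rewrite E.
  - split=> //; move: E; rewrite s12; apply: strip_map_inj_r.
    by case/andP: s2L => ? ?; rewrite !ltW.
move: s1' r1' s2' r2' => s1' r1' s2' r2' s1L r1d s2L r2d s12 E.
have /andP[h0 hl] := half_itv S.
have [/andP[s10 s1l] /andP[s20 s2l]] := (s1L, s2L).
have [h1|h1] := leP (L / 2) s1'; first exact: (NR _ _ _ _ h1 s12 s2l r1d r2d E).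
have s1L' : 0 <= s1' <= L by rewrite !ltW.
have s2L' : 0 <= s2' <= L by rewrite !ltW.
have [h2|h2] := ltP (L / 2) s2'; last first.
  have [] := NR (L - s2') r2' (L - s1') r1' => //; [lra|lra|lra|].
  by rewrite !strip_map_sym// E.
have R0 := right_strip_gt0 S th_isD th_cont th_mid.
have rd r : 0 < r < delta -> 0 <= r <= delta by move=> /andP[? ?]; rewrite !ltW.
have A := R0 s2' r2' h2 (ltW s2l) (rd _ r2d).
have B : 0 < x1 (L / 2) * (Phi (L - s1') r1').1.
  by apply: R0; [lra|lra|exact: rd].
move: B; rewrite strip_map_sym// E /= mulrN oppr_gt0 ltNge => /negP[].
exact: ltW A.
Qed.

End strip_injective.

(** * Functions in strip coordinates *)

Lemma norm_le1_sqrD {R : realType} (a b : R) : a ^+ 2 + b ^+ 2 = 1 -> `|a| <= 1.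
Proof. by move=> ab; rewrite ler_norml; apply/andP; split; nra. Qed.

Section strip_coordinates.
Context {R : realType} (L delta : R) (x y x1 y1 x2 y2 k k1 : R -> R).
Context (S : curve_strip L delta x y x1 y1 x2 y2 k k1).
Local Notation Phi := (strip_map x y x1 y1).
Context (Phi_inj : forall s1 r1 s2 r2, 0 < s1 < L -> 0 < r1 < delta ->
  0 < s2 < L -> 0 < r2 < delta -> Phi s1 r1 = Phi s2 r2 -> s1 = s2 /\ r1 = r2).

Definition in_rect (L delta : R) (s r : R) : Prop := 0 < s < L /\ 0 < r < delta.
Local Notation Q := (in_rect L delta).

Definition strip_set (L delta : R) (x y x1 y1 : R -> R) : set (R * R) :=
  [set p | exists s r, in_rect L delta s r /\ p = strip_map x y x1 y1 s r].
Local Notation D := (strip_set L delta x y x1 y1).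

Definition strip_coord (L delta : R) (x y x1 y1 : R -> R) (p : R * R) : R * R :=
  xget (0, 0) [set q | in_rect L delta q.1 q.2 /\ p = strip_map x y x1 y1 q.1 q.2].
Local Notation Psi := (strip_coord L delta x y x1 y1).

Lemma strip_coordP p : D p -> Q (Psi p).1 (Psi p).2 /\ p = Phi (Psi p).1 (Psi p).2.
Proof.
move=> [s [r [q e]]]; rewrite /strip_coord; case: xgetP => [[u v] -> //|H].
by have := H (s, r); case.
Qed.

Lemma strip_coordK s r : Q s r -> Psi (Phi s r) = (s, r).
Proof.
move=> q; have DP : D (Phi s r) by exists s, r.
have [[q1 q2] e] := strip_coordP DP; case: (q) => s0 r0.
have [e1 e2] := Phi_inj s0 r0 q1 q2 e.
by rewrite [LHS]surjective_pairing -e1 -e2.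
Qed.

Local Lemma rect_closed s r : Q s r -> 0 <= s <= L /\ 0 <= r <= delta.
Proof. by move=> [/andP[? ?] /andP[? ?]]; rewrite !ltW. Qed.

Lemma rect_jacobian_gt0 s r : Q s r -> 0 < 1 + r * k s.
Proof. by move=> /rect_closed[? ?]; apply: (jacobian_gt0 S). Qed.

Lemma isD_neg_sign (f : R -> R) (t d : R) : isD f t d -> d < 0 -> f t = 0 ->
  \forall u \near t, (u < t -> 0 < f u) /\ (t < u -> f u < 0).
Proof.
move=> /is_derive1_caratheodory[g [fg cg gt]] d0 ft.
have : \forall u \near t, g u < 0 by apply: (cvgr_lt _ cg); rewrite gt.
apply: filterS => u gu; have := fg u; rewrite ft subr0 => ->.
by split=> h; [rewrite nmulr_rgt0// subr_lt0|rewrite pmulr_llt0// subr_gt0].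
Qed.

Lemma strip_map_foot s (q : R * R) : 0 <= s <= L ->
  (q.1 - x s) * x1 s + (q.2 - y s) * y1 s = 0 ->
  q = Phi s ((q.1 - x s) * y1 s - (q.2 - y s) * x1 s).
Proof.
move=> sL; have a1 := arclength S sL; case: q => u v; rewrite /strip_map /= => F.
congr (_, _); apply/eqP; rewrite -subr_eq0; apply/eqP.
  transitivity ((u - x s) * (1 - (x1 s ^+ 2 + y1 s ^+ 2)) + x1 s * ((u - x s) * x1 s + (v - y s) * y1 s)).
    by ring.
  by rewrite a1 F subrr !mulr0 addr0.
transitivity ((v - y s) * (1 - (x1 s ^+ 2 + y1 s ^+ 2)) + y1 s * ((u - x s) * x1 s + (v - y s) * y1 s)).
  by ring.
by rewrite a1 F subrr !mulr0 addr0.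
Qed.

Lemma strip_map_open s0 r0 (eps : R) : Q s0 r0 -> 0 < eps ->
  \forall q \near Phi s0 r0, exists s r, [/\ `|s - s0| < eps, `|r - r0| < eps & q = Phi s r].
Proof.
move=> q0 e0; have [s0L r0d] := rect_closed q0; have J0 := rect_jacobian_gt0 q0.
have [/andP[s00 s0l] _] := q0.
pose f (q : R * R) s := (q.1 - x s) * x1 s + (q.2 - y s) * y1 s.
pose g (q : R * R) s := (q.1 - x s) * y1 s - (q.2 - y s) * x1 s.
set p := Phi s0 r0.
have a0 := arclength S s0L.
have fp0 : f p s0 = 0 by rewrite /f /p /=; ring.
have gp0 : g p s0 = r0.
  by rewrite -[RHS]mulr1 -a0 /g /p /=; ring.
have df : isD (f p) s0 (- (1 + r0 * k s0)).
  have [dx dy] := (x_isD S s0, y_isD S s0).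
  have s0o : 0 < s0 < L by rewrite s00.
  have [dx1 dy1] := frenet S s0o.
  apply: isD_eq; first apply: isDD; first apply: isDM dx1.
  - by apply: isDB dx; exact: isD_cst.
  - by apply: isDM dy1; apply: isDB dy; exact: isD_cst.
  rewrite /=; apply/eqP; rewrite -subr_eq0; apply/eqP.
  transitivity ((1 + r0 * k s0) * (1 - (x1 s0 ^+ 2 + y1 s0 ^+ 2))); first by ring.
  by rewrite a0 subrr mulr0.
have cx := continuous_isD (x_isD S); have cy := continuous_isD (y_isD S).
have cx1 := continuous_isD (x1_isD S); have cy1 := continuous_isD (y1_isD S).
have cc (c : R) : continuous (fun _ : R => c) by move=> ?; exact: cvg_cst.
have cf q : continuous (f q).
  by apply: continuousD_fun; apply: continuousM_fun => //; exact: continuousB_fun.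
have cg q : continuous (g q).
  by apply: continuousB_fun; apply: continuousM_fun => //; exact: continuousB_fun.
have e20 : 0 < eps / 2 by rewrite divr_gt0.
have J0' : - (1 + r0 * k s0) < 0 by rewrite oppr_lt0.
have n1 := isD_neg_sign df J0' fp0.
have n2 : \forall u \near s0, `|g p u - r0| < eps / 2.
  have : \forall u \near s0, `|g p s0 - g p u| < eps / 2.
    exact: ((cvgrPdist_lt _ _).1 (cg p s0) _ e20).
  by apply: filterS => u; rewrite gp0 distrC.
have : \forall u \near s0, ((u < s0 -> 0 < f p u) /\ (s0 < u -> f p u < 0)) /\
    `|g p u - r0| < eps / 2.
  by apply: filterS2 n1 n2 => u.
move=> /nbhs_ballP[d /= d0 dP].
pose m := Num.min (Num.min (d / 2) (eps / 2)) (Num.min (s0 / 2) ((L - s0) / 2)).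
have m0 : 0 < m by rewrite !lt_min; apply/andP; split; apply/andP; split; lra.
have [md [me [ms mL]]] : m <= d / 2 /\ (m <= eps / 2 /\ (m <= s0 / 2 /\ m <= (L - s0) / 2)).
  by rewrite /m !ge_min !lexx !orbT.
have Bd u : `|u - s0| <= m -> ball s0 d u.
  by rewrite /ball /= distrC => h; apply: le_lt_trans h _; lra.
have [[fl _] _] : ((s0 - m < s0 -> 0 < f p (s0 - m)) /\ (s0 < s0 - m -> f p (s0 - m) < 0)) /\
    `|g p (s0 - m) - r0| < eps / 2.
  by apply: dP; apply: Bd; rewrite addrC addKr normrN gtr0_norm.
have [[_ fr] _] : ((s0 + m < s0 -> 0 < f p (s0 + m)) /\ (s0 < s0 + m -> f p (s0 + m) < 0)) /\
    `|g p (s0 + m) - r0| < eps / 2.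
  by apply: dP; apply: Bd; rewrite addrC addKr gtr0_norm.
have cfs s : continuous (fun q => f q s).
  apply: continuousD_fun; (apply: continuousM_fun; last by move=> ?; exact: cvg_cst);
    (apply: continuousB_fun; last by move=> ?; exact: cvg_cst).
    exact: continuous_fst.
  exact: continuous_snd.
have N1 : \forall q \near p, 0 < f q (s0 - m).
  by apply: (cvgr_gt _ (cfs (s0 - m) p)); apply: fl; lra.
have N2 : \forall q \near p, f q (s0 + m) < 0.
  by apply: (cvgr_lt _ (cfs (s0 + m) p)); apply: fr; lra.
have e4 : 0 < eps / 4 by rewrite divr_gt0.
have N3 : \forall q \near p, `|p.1 - q.1| < eps / 4.
  exact: ((cvgrPdist_lt _ _).1 (@continuous_fst _ _ p) _ e4).
have N4 : \forall q \near p, `|p.2 - q.2| < eps / 4.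
  exact: ((cvgrPdist_lt _ _).1 (@continuous_snd _ _ p) _ e4).
near=> q.
have Q1 : 0 < f q (s0 - m) by near: q.
have Q2 : f q (s0 + m) < 0 by near: q.
have Q3 : `|p.1 - q.1| < eps / 4 by near: q.
have Q4 : `|p.2 - q.2| < eps / 4 by near: q.
have [s /itvP sm fs] : exists2 s, s \in `[s0 - m, s0 + m] & f q s = 0.
  apply: IVT; [by lra|exact: continuous_subspaceT|].
  by rewrite ge_min le_max (ltW Q1) (ltW Q2) orbT.
have [h1 h2] : s0 - m <= s /\ s <= s0 + m by rewrite !sm.
have ss0 : `|s - s0| <= m by rewrite ler_distl h1.
have sL : 0 <= s <= L by apply/andP; split; lra.
exists s, (g q s); split.
- by apply: le_lt_trans ss0 _; lra.
- have [_ gs] := dP s (Bd _ ss0).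
  have a1 := arclength S sL.
  have X1 := norm_le1_sqrD a1; rewrite addrC in a1; have Y1 := norm_le1_sqrD a1.
  have -> : g q s - r0 = (g p s - r0) + ((q.1 - p.1) * y1 s - (q.2 - p.2) * x1 s).
    by rewrite /g; ring.
  have B1 : `|(q.1 - p.1) * y1 s| <= eps / 4.
    rewrite normrM distrC -[leRHS]mulr1; apply: ler_pM => //; exact: ltW.
  have B2 : `|(q.2 - p.2) * x1 s| <= eps / 4.
    rewrite normrM distrC -[leRHS]mulr1; apply: ler_pM => //; exact: ltW.
  apply: le_lt_trans (ler_normD _ _) _.
  have := ler_normB ((q.1 - p.1) * y1 s) ((q.2 - p.2) * x1 s).
  by move: gs B1 B2; lra.
- exact: strip_map_foot.
Unshelve. all: by end_near. Qed.

Lemma strip_map_open_rect s0 r0 (eps : R) : Q s0 r0 -> 0 < eps ->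
  \forall q \near Phi s0 r0,
    exists s r, [/\ Q s r, `|s - s0| < eps, `|r - r0| < eps & q = Phi s r].
Proof.
move=> q0 eps0; have [/andP[s00 s0L] /andP[r00 r0d]] := q0.
pose m := Num.min eps (Num.min (Num.min s0 (L - s0)) (Num.min r0 (delta - r0))).
have m0 : 0 < m by rewrite !lt_min s00 r00 !subr_gt0 s0L r0d eps0.
have [m1 [m2 [m3 [m4 m5]]]] : m <= eps /\ (m <= s0 /\ (m <= L - s0 /\ (m <= r0 /\ m <= delta - r0))).
  by rewrite /m !ge_min !lexx !orbT.
apply: filterS (strip_map_open q0 m0) => q [s [r [ss rr qE]]].
exists s, r; split=> //; [|exact: lt_le_trans m1|exact: lt_le_trans m1].
move: ss rr; rewrite !ltr_distl => /andP[? ?] /andP[? ?].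
by split; apply/andP; split; lra.
Qed.

Lemma strip_set_open : open D.
Proof.
rewrite openE => p [s0 [r0 [q0 ->]]].
apply: filterS (strip_map_open_rect q0 ltr01) => q [s [r [ss _ _ ->]]].
by exists s, r.
Qed.

Lemma strip_coord_continuous p : D p -> {for p, continuous Psi}.
Proof.
move=> [s0 [r0 [q0 ->]]]; apply/cvgrPdist_lt => eps e0; rewrite strip_coordK//.
apply: filterS (strip_map_open_rect q0 e0) => q [s [r [qsr ss rr ->]]].
rewrite strip_coordK//; change (Num.max `|s0 - s| `|r0 - r| < eps).
by rewrite gt_max (distrC s0) (distrC r0) ss.
Qed.

Lemma near_strip_line p (t0 a b : R) : D p ->
  \forall t \near t0, D (p.1 + (t - t0) * a, p.2 + (t - t0) * b).
Proof.
move=> Dp.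
have cl : continuous (fun t => (p.1 + (t - t0) * a, p.2 + (t - t0) * b)).
  have cc (c : R) : continuous (fun _ : R => c) by move=> ?; exact: cvg_cst.
  have ct : continuous (fun t => t - t0) by apply: continuousB_fun => // ?; exact: cvg_id.
  by apply: continuous_pairing; apply: (continuousD_fun (cc _)); exact: (continuousM_fun ct (cc _)).
have : nbhs (p.1 + (t0 - t0) * a, p.2 + (t0 - t0) * b) D.
  rewrite subrr !mul0r !addr0; apply: open_nbhs_nbhs; split; first exact: strip_set_open.
  by case: p Dp {cl}.
by move=> /cl.
Qed.

Lemma strip_coord_isD p (t0 a b : R) : D p ->
  let s := (Psi p).1 in let r := (Psi p).2 in
  isD (fun t => (Psi (p.1 + (t - t0) * a, p.2 + (t - t0) * b)).1) t0
    ((a * x1 s + b * y1 s) / (1 + r * k s)) /\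
  isD (fun t => (Psi (p.1 + (t - t0) * a, p.2 + (t - t0) * b)).2) t0
    (a * y1 s - b * x1 s).
Proof.
move=> Dp /=; have [q0 pE] := strip_coordP Dp.
set s0 := (Psi p).1 in q0 pE *; set r0 := (Psi p).2 in q0 pE *.
have J0 := rect_jacobian_gt0 q0.
have [s0L _] := rect_closed q0; have a0 := arclength S s0L.
have s0o : 0 < s0 < L by case: q0.
have [dx1 dy1] := frenet S s0o.
pose l t := (p.1 + (t - t0) * a, p.2 + (t - t0) * b).
have lt0 : l t0 = p by rewrite /l subrr !mul0r !addr0; case: (p).
have cl : continuous l.
  have cc (c : R) : continuous (fun _ : R => c) by move=> ?; exact: cvg_cst.
  have ct : continuous (fun t => t - t0) by apply: continuousB_fun => // ?; exact: cvg_id.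
  by apply: continuous_pairing; apply: (continuousD_fun (cc _)); exact: (continuousM_fun ct (cc _)).
pose sg t := (Psi (l t)).1; pose rr t := (Psi (l t)).2.
have sg0 : sg t0 = s0 by rewrite /sg lt0.
have rr0 : rr t0 = r0 by rewrite /rr lt0.
have cPsi : {for t0, continuous (fun t => Psi (l t))}.
  by apply: cvg_comp; [exact: cl|rewrite lt0; exact: strip_coord_continuous].
have csg : {for t0, continuous sg}.
  by apply: cvg_comp; [exact: cPsi|exact: continuous_fst].
have crr : {for t0, continuous rr}.
  by apply: cvg_comp; [exact: cPsi|exact: continuous_snd].
have [gx [gxE cgx gx0]] := (is_derive1_caratheodory _ _ _).1 (x_isD S s0).
have [gy [gyE cgy gy0]] := (is_derive1_caratheodory _ _ _).1 (y_isD S s0).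
have [hx [hxE chx hx0]] := (is_derive1_caratheodory _ _ _).1 dx1.
have [hy [hyE chy hy0]] := (is_derive1_caratheodory _ _ _).1 dy1.
have cat (g : R -> R) : {for s0, continuous g} -> {for t0, continuous (fun t => g (sg t))}.
  by move=> cg; apply: cvg_comp; [exact: csg|rewrite sg0; exact: cg].
have cc (c : R) : {for t0, continuous (fun _ : R => c)} by exact: cvg_cst.
pose K t := gx (sg t) * x1 s0 + gy (sg t) * y1 s0 + rr t * (hy (sg t) * x1 s0 - hx (sg t) * y1 s0).
have cK : {for t0, continuous K}.
  apply: cvgD; first by apply: cvgD; apply: cvgM; [exact: cat|exact: cc|exact: cat|exact: cc].
  apply: cvgM crr _; apply: cvgB; apply: cvgM; [exact: cat|exact: cc|exact: cat|exact: cc].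
have K0 : K t0 = 1 + r0 * k s0.
  rewrite /K sg0 rr0 gx0 gy0 hx0 hy0; apply/eqP; rewrite -subr_eq0; apply/eqP.
  transitivity ((1 + r0 * k s0) * ((x1 s0 ^+ 2 + y1 s0 ^+ 2) - 1)); first by ring.
  by rewrite a0 subrr mulr0.
pose M t := gx (sg t) * y1 s0 - gy (sg t) * x1 s0 + rr t * (hy (sg t) * y1 s0 + hx (sg t) * x1 s0).
have cM : {for t0, continuous M}.
  apply: cvgD; first by apply: cvgB; apply: cvgM; [exact: cat|exact: cc|exact: cat|exact: cc].
  apply: cvgM crr _; apply: cvgD; apply: cvgM; [exact: cat|exact: cc|exact: cat|exact: cc].
have M0 : M t0 = 0 by rewrite /M sg0 rr0 gx0 gy0 hx0 hy0; ring.
have LE t : D (l t) -> (t - t0) * a = (sg t - s0) * gx (sg t) + rr t * ((sg t - s0) * hy (sg t) + y1 s0) - r0 * y1 s0 /\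
    (t - t0) * b = (sg t - s0) * gy (sg t) - rr t * ((sg t - s0) * hx (sg t) + x1 s0) + r0 * x1 s0.
  move=> /strip_coordP[_]; rewrite -/(sg t) -/(rr t) /l {1 2}pE /strip_map /= => -[e1 e2].
  have E1 : x (sg t) = gx (sg t) * (sg t - s0) + x s0 by rewrite -gxE subrK.
  have E2 : y (sg t) = gy (sg t) * (sg t - s0) + y s0 by rewrite -gyE subrK.
  have E3 : x1 (sg t) = hx (sg t) * (sg t - s0) + x1 s0 by rewrite -hxE subrK.
  have E4 : y1 (sg t) = hy (sg t) * (sg t - s0) + y1 s0 by rewrite -hyE subrK.
  move: e1 e2; rewrite E1 E2 E3 E4 => e1 e2; split.
    by apply: (addrI (x s0 + r0 * y1 s0)); rewrite e1; ring.
  by apply: (addrI (y s0 - r0 * x1 s0)); rewrite e2; ring.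
have sE t : D (l t) -> (t - t0) * (a * x1 s0 + b * y1 s0) = (sg t - s0) * K t.
  move=> /LE[e1 e2]; rewrite mulrDr !mulrA e1 e2 /K; ring.
have rE t : D (l t) -> (t - t0) * (a * y1 s0 - b * x1 s0) = (sg t - s0) * M t + (rr t - r0).
  move=> /LE[e1 e2]; rewrite mulrBr !mulrA e1 e2 /M.
  apply/eqP; rewrite -subr_eq0; apply/eqP.
  transitivity ((rr t - r0) * ((x1 s0 ^+ 2 + y1 s0 ^+ 2) - 1)); first by ring.
  by rewrite a0 subrr mulr0.
have nD : \forall t \near t0, D (l t) by exact: near_strip_line.
have nK : \forall t \near t0, 0 < K t by apply: (cvgr_gt _ cK); rewrite K0.
have ds : isD sg t0 ((a * x1 s0 + b * y1 s0) / (1 + r0 * k s0)).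
  apply: (isD_near (f := fun t => s0 + (t - t0) * ((a * x1 s0 + b * y1 s0) / K t))).
    apply: filterS2 nD nK => t Dt Kt.
    by rewrite mulrA sE// mulfK ?gt_eqF// addrC subrK.
  apply/is_derive1_caratheodory; exists (fun t => (a * x1 s0 + b * y1 s0) / K t); split.
  - by move=> t; rewrite subrr mul0r addr0; ring.
  - by apply: cvgM; [exact: cc|apply: cvgV; [rewrite K0 gt_eqF|exact: cK]].
  - by rewrite K0.
split; first exact: ds.
have [h [hE ch h0]] := (is_derive1_caratheodory _ _ _).1 ds.
apply: (isD_near (f := fun t => r0 + (t - t0) * ((a * y1 s0 - b * x1 s0) - h t * M t))).
  apply: filterS nD => t Dt; have := hE t; rewrite sg0 => e1.
  rewrite mulrBr rE// e1 -/(rr t); ring.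
apply/is_derive1_caratheodory; exists (fun t => a * y1 s0 - b * x1 s0 - h t * M t); split.
- by move=> t; rewrite subrr mul0r addr0; ring.
- by apply: cvgB; [exact: cc|apply: cvgM; [exact: ch|exact: cM]].
- by rewrite M0 mulr0 subr0.
Qed.

End strip_coordinates.

Section lift.
Context {R : realType} (L delta : R) (x y x1 y1 x2 y2 k k1 : R -> R).
Context (S : curve_strip L delta x y x1 y1 x2 y2 k k1).
Local Notation Phi := (strip_map x y x1 y1).
Local Notation Q := (in_rect L delta).
Local Notation D := (strip_set L delta x y x1 y1).
Local Notation Psi := (strip_coord L delta x y x1 y1).
Context (Phi_inj : forall s1 r1 s2 r2, 0 < s1 < L -> 0 < r1 < delta ->
  0 < s2 < L -> 0 < r2 < delta -> Phi s1 r1 = Phi s2 r2 -> s1 = s2 /\ r1 = r2).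

(* Syntax for functions of the coordinates (s, r); being closed under both partial
   derivatives, it yields C^oo functions of the plane by induction on the order. *)
Inductive expr : Type :=
| ES (f : R -> R) (_ : smooth f)
| ER (f : R -> R) (_ : smooth f)
| EJinv
| Ecot
| EAdd (_ _ : expr)
| EMul (_ _ : expr).

Definition scaled_cot (s : R) : R :=
  pi / L * (cos (pi / L * s) / sin (pi / L * s)).

Fixpoint expr_eval (u : expr) (s r : R) : R :=
  match u with
  | ES f _ => f s
  | ER f _ => f r
  | EJinv => (1 + r * k s)^-1
  | Ecot => scaled_cot s
  | EAdd u v => expr_eval u s r + expr_eval v s r
  | EMul u v => expr_eval u s r * expr_eval v s r
  end.

Definition ECst (c : R) : expr := ES (@smooth_cst R c).

Fixpoint expr_ds (u : expr) : expr :=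
  match u with
  | ES f sf => ES (@smooth_derive1 R _ sf)
  | ER _ _ => ECst 0
  | EJinv => EMul (EMul (ECst (-1)) (EMul (ES (@smooth_derive1 R _ (k_smooth S))) (ER (@smooth_id R))))
               (EMul EJinv EJinv)
  | Ecot => EMul (ECst (-1)) (EAdd (ECst ((pi / L) ^+ 2)) (EMul Ecot Ecot))
  | EAdd u v => EAdd (expr_ds u) (expr_ds v)
  | EMul u v => EAdd (EMul u (expr_ds v)) (EMul v (expr_ds u))
  end.

Fixpoint expr_dr (u : expr) : expr :=
  match u with
  | ES _ _ => ECst 0
  | ER f sf => ER (@smooth_derive1 R _ sf)
  | EJinv => EMul (EMul (ECst (-1)) (ES (k_smooth S))) (EMul EJinv EJinv)
  | Ecot => ECst 0
  | EAdd u v => EAdd (expr_dr u) (expr_dr v)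
  | EMul u v => EAdd (EMul u (expr_dr v)) (EMul v (expr_dr u))
  end.

Lemma sin_scaled_gt0 s : 0 < s < L -> 0 < sin (pi / L * s).
Proof.
move=> /andP[s0 sL]; have L0 := L_gt0 S; apply: sin_gt0_pi.
rewrite !mulr_gt0 ?divr_gt0 ?pi_gt0 ?invr_gt0//=.
by rewrite -mulrA gtr_pMr ?pi_gt0// mulrC ltr_pdivrMr// mul1r.
Qed.

Lemma scaled_cot_isD s : 0 < s < L ->
  isD scaled_cot s (-1 * ((pi / L) ^+ 2 + scaled_cot s * scaled_cot s)).
Proof.
move=> sL; have s0 := lt0r_neq0 (sin_scaled_gt0 sL).
have dl : isD (fun s => pi / L * s) s (pi / L).
  by apply: isD_eq; [apply: isDM; [exact: isD_cst|exact: isD_id]|rewrite /= mulr1 mulr0 addr0].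
have dsn : isD (fun s => sin (pi / L * s)) s (cos (pi / L * s) * (pi / L)).
  by apply: (isD_comp (f := sin)) => //; exact: is_derive_sin.
have dcs : isD (fun s => cos (pi / L * s)) s (- sin (pi / L * s) * (pi / L)).
  by apply: (isD_comp (f := cos)) => //; exact: is_derive_cos.
apply: isD_eq; first apply: isDM; first exact: isD_cst.
  by apply: isDM dcs _; exact: isDV dsn.
by rewrite /= /scaled_cot; field; rewrite s0 gt_eqF// (L_gt0 S).
Qed.

Lemma eval_isD u (sg rr : R -> R) (t a b : R) : Q (sg t) (rr t) ->
  isD sg t a -> isD rr t b ->
  isD (fun t => expr_eval u (sg t) (rr t)) t
    (expr_eval (expr_ds u) (sg t) (rr t) * a + expr_eval (expr_dr u) (sg t) (rr t) * b).
Proof.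
move=> q0 dsg drr; have [s0L r0d] := q0.
elim: u => [f sf|f sf| | |u IHu v IHv|u IHu v IHv] /=.
- by apply: isD_eq; [exact: isD_comp (smooth_isD _ sf) dsg|rewrite mul0r addr0].
- by apply: isD_eq; [exact: isD_comp (smooth_isD _ sf) drr|rewrite mul0r add0r].
- have J0 : 1 + rr t * k (sg t) != 0 by rewrite gt_eqF// (rect_jacobian_gt0 S q0).
  apply: isD_eq; first apply: isDV => //.
    apply: isDD; first exact: isD_cst.
    by apply: isDM drr _; exact: isD_comp (smooth_isD _ (k_smooth S)) dsg.
  by rewrite /=; field.
- by apply: isD_eq; [exact: isD_comp (scaled_cot_isD s0L) dsg|rewrite /= mul0r addr0].
- by apply: isD_eq; [exact: isDD IHu IHv|ring].
- by apply: isD_eq; [exact: isDM IHu IHv|rewrite /=; ring].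
Qed.

Lemma eval_continuous u s r : Q s r -> {for (s, r), continuous (fun q => expr_eval u q.1 q.2)}.
Proof.
move=> q0; have [s0L r0d] := q0.
have c1 : {for (s, r), continuous (fun q : R * R => q.1)} by exact: continuous_fst.
have c2 : {for (s, r), continuous (fun q : R * R => q.2)} by exact: continuous_snd.
elim: u => [f sf|f sf| | |u IHu v IHv|u IHu v IHv] /=.
- by apply: cvg_comp c1 _; exact: smooth_continuous.
- by apply: cvg_comp c2 _; exact: smooth_continuous.
- apply: (@continuousV _ _ (fun q : R * R => 1 + q.2 * k q.1)).
    by rewrite gt_eqF// (rect_jacobian_gt0 S q0).
  apply: cvgD; first exact: cvg_cst.
  by apply: cvgM c2 _; apply: cvg_comp c1 _; exact: smooth_continuous (k_smooth S) _.
- by apply: (cvg_comp (fun q : R * R => q.1) scaled_cot c1); exact: isD_continuous (scaled_cot_isD s0L).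
- exact: (@continuousD _ _ _ (fun q => expr_eval u q.1 q.2) (fun q => expr_eval v q.1 q.2) _ IHu IHv).
- exact: (@continuousM _ _ (fun q => expr_eval u q.1 q.2) (fun q => expr_eval v q.1 q.2) _ IHu IHv).
Qed.

Definition supp_in (u : expr) (a b c d : R) : Prop :=
  forall s r, Q s r -> ~~ ((a <= s <= b) && (c <= r <= d)) -> expr_eval u s r = 0.

Definition csupp (u : expr) : Prop :=
  exists a b c d, [/\ 0 < a, b < L, 0 < c, d < delta & supp_in u a b c d].

Lemma nitv_near (a b s : R) : ~~ (a <= s <= b) -> \forall u \near s, ~~ (a <= u <= b).
Proof.
rewrite negb_and -!ltNge => /orP[h|h].
  by near=> u; rewrite negb_and -!ltNge; apply/orP; left; near: u; exact: lt_nbhsl.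
by near=> u; rewrite negb_and -!ltNge; apply/orP; right; near: u; exact: lt_nbhsr.
Unshelve. all: by end_near. Qed.

Lemma rect_near s r : Q s r -> (\forall u \near s, Q u r) /\ (\forall v \near r, Q s v).
Proof.
move=> [sL rd]; have [/andP[? ?] /andP[? ?]] := (sL, rd); split; near=> u; split=> //;
  by apply/andP; split; near: u; (exact: lt_nbhsl || exact: lt_nbhsr).
Unshelve. all: by end_near. Qed.

Lemma supp_in_ds u a b c d : supp_in u a b c d -> supp_in (expr_ds u) a b c d.
Proof.
move=> su s r q0 nb; have D1 := eval_isD u q0 (isD_id s) (isD_cst r s).
rewrite mulr1 mulr0 addr0 in D1.
rewrite -(isD_derive1 D1); apply: isD_derive1.
apply: (isD_near (f := fun=> 0)); last exact: isD_cst.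
have nb' : \forall v \near s, ~~ ((a <= v <= b) && (c <= r <= d)).
  move: nb; rewrite negb_and => /orP[/nitv_near|h].
    by apply: filterS => v h; rewrite negb_and h.
  by near=> v; rewrite negb_and h orbT.
by apply: filterS2 (rect_near q0).1 nb' => v qv nv; rewrite su.
Unshelve. all: by end_near. Qed.

Lemma supp_in_dr u a b c d : supp_in u a b c d -> supp_in (expr_dr u) a b c d.
Proof.
move=> su s r q0 nb; have D1 := eval_isD (sg := fun=> s) u q0 (isD_cst s r) (isD_id r).
rewrite mulr1 mulr0 add0r in D1.
rewrite -(isD_derive1 D1); apply: isD_derive1.
apply: (isD_near (f := fun=> 0)); last exact: isD_cst.
have nb' : \forall v \near r, ~~ ((a <= s <= b) && (c <= v <= d)).
  move: nb; rewrite negb_and => /orP[h|/nitv_near].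
    by near=> v; rewrite negb_and h.
  by apply: filterS => v h; rewrite negb_and h orbT.
by apply: filterS2 (rect_near q0).2 nb' => v qv nv; rewrite su.
Unshelve. all: by end_near. Qed.

Lemma csupp_mul u v : csupp u -> csupp (EMul u v) /\ csupp (EMul v u).
Proof.
move=> [a [b [c [d [a0 bL c0 dd su]]]]].
by split; exists a, b, c, d; split=> // s r q0 nb /=; rewrite su// ?mul0r ?mulr0.
Qed.

Lemma csupp_add u v : csupp u -> csupp v -> csupp (EAdd u v).
Proof.
move=> [a [b [c [d [a0 bL c0 dd su]]]]] [a' [b' [c' [d' [a0' bL' c0' dd' sv]]]]].
exists (Num.min a a'), (Num.max b b'), (Num.min c c'), (Num.max d d').
split; rewrite ?lt_min ?gt_max ?a0 ?a0' ?bL ?bL' ?c0 ?c0' ?dd ?dd'// => s r q0 nb /=.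
rewrite su ?sv ?addr0//; apply: contra nb.
  by move=> /andP[/andP[h1 h2] /andP[h3 h4]]; rewrite !ge_min !le_max h1 h2 h3 h4 !orbT.
by move=> /andP[/andP[h1 h2] /andP[h3 h4]]; rewrite !ge_min !le_max h1 h2 h3 h4.
Qed.

Definition expr_d1 u := EAdd (EMul (expr_ds u) (EMul (ES (x1_smooth S)) EJinv)) (EMul (expr_dr u) (ES (y1_smooth S))).

Definition expr_d2 u := EAdd (EMul (expr_ds u) (EMul (ES (y1_smooth S)) EJinv))
  (EMul (expr_dr u) (ES (@smoothN R _ (x1_smooth S)))).

Lemma csupp_d u : csupp u -> csupp (expr_ds u) /\ csupp (expr_dr u).
Proof.
move=> [a [b [c [d [a0 bL c0 dd su]]]]]; split; exists a, b, c, d; split=> //.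
  exact: supp_in_ds.
exact: supp_in_dr.
Qed.

Lemma csupp_d12 u : csupp u -> csupp (expr_d1 u) /\ csupp (expr_d2 u).
Proof.
move=> /csupp_d[su ru]; split; apply: csupp_add.
- exact: (csupp_mul _ su).1.
- exact: (csupp_mul _ ru).1.
- exact: (csupp_mul _ su).1.
- exact: (csupp_mul _ ru).1.
Qed.

Definition expr_lift (u : expr) (p : R * R) : R :=
  if pselect (D p) then expr_eval u (Psi p).1 (Psi p).2 else 0.

Lemma liftE u p : D p -> expr_lift u p = expr_eval u (Psi p).1 (Psi p).2.
Proof. by rewrite /expr_lift; case: pselect. Qed.

Lemma lift_out u p : ~ D p -> expr_lift u p = 0.
Proof. by rewrite /expr_lift; case: pselect. Qed.

Lemma csupp_compact u : csupp u ->
  exists K, [/\ compact K, K `<=` D & forall p, ~ K p -> expr_lift u p = 0].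
Proof.
move=> [a [b [c [d [a0 bL c0 dd su]]]]].
have cx := continuous_isD (x_isD S); have cy := continuous_isD (y_isD S).
have cx1 := continuous_isD (x1_isD S); have cy1 := continuous_isD (y1_isD S).
exists ((fun q => Phi q.1 q.2) @` (`[a, b] `*` `[c, d])); split.
- apply: continuous_compact; last by apply: compact_setX; exact: segment_compact.
  apply: continuous_subspaceT.
  have c1 := @continuous_fst R R; have c2 := @continuous_snd R R.
  apply: continuous_pairing; [apply: continuousD_fun|apply: continuousB_fun].
  + exact: continuous_comp_fun cx c1.
  + exact: (continuousM_fun c2 (continuous_comp_fun cy1 c1)).
  + exact: continuous_comp_fun cy c1.
  + exact: (continuousM_fun c2 (continuous_comp_fun cx1 c1)).
- move=> _ [[s r] [/= + +] <-]; rewrite !in_itv /= => /andP[as_ sb] /andP[cr rd].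
  by exists s, r; split=> //; split; apply/andP; split;
    [exact: lt_le_trans as_|exact: le_lt_trans sb _|exact: lt_le_trans cr|exact: le_lt_trans rd _].
- move=> p Kp; have [Dp|Dp] := pselect (D p); last exact: lift_out.
  rewrite liftE//; have [q0 pE] := strip_coordP Dp; apply: su => //.
  apply/negP => /andP[h1 h2]; by apply: Kp; exists (Psi p).
Qed.

Lemma csupp_near0 u p : csupp u -> ~ D p -> \forall q \near p, expr_lift u q = 0.
Proof.
move=> /csupp_compact[K [cK KD K0]] Dp.
have oK : open (~` K) by rewrite openC; apply: compact_closed.
have : nbhs p (~` K) by apply: open_nbhs_nbhs; split=> // /KD.
by apply: filterS => q; exact: K0.
Qed.

Lemma lift_continuous u : csupp u -> continuous (expr_lift u).
Proof.
move=> cu p; have [Dp|Dp] := pselect (D p); last first.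
  rewrite /continuous_at lift_out//; apply: cvg_near_cst.
  exact: csupp_near0.
have nD : \forall q \near p, D q by apply: open_nbhs_nbhs; split=> //; exact: strip_set_open S.
have [q0 _] := strip_coordP Dp.
have c0 : {for p, continuous (fun q => expr_eval u (Psi q).1 (Psi q).2)}.
  apply: (@cvg_comp _ _ _ Psi (fun q => expr_eval u q.1 q.2)).
    exact: strip_coord_continuous S Phi_inj _ Dp.
  by move: q0; case: (Psi p) => s r; exact: eval_continuous.
rewrite /continuous_at liftE//; apply: cvg_trans c0.
by apply: near_eq_cvg; apply: filterS nD => q Dq; rewrite liftE.
Qed.

Lemma near_line1 (p : R * R) (U : set (R * R)) : nbhs p U -> \forall t \near p.1, U (t, p.2).
Proof.
have cl : continuous (fun t : R => (t, p.2)).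
  by apply: continuous_pairing => ?; [exact: cvg_id|exact: cvg_cst].
by move=> pU; have /= := cl p.1 U; rewrite -surjective_pairing; apply.
Qed.

Lemma near_line2 (p : R * R) (U : set (R * R)) : nbhs p U -> \forall t \near p.2, U (p.1, t).
Proof.
have cl : continuous (fun t : R => (p.1, t)).
  by apply: continuous_pairing => ?; [exact: cvg_cst|exact: cvg_id].
by move=> pU; have /= := cl p.2 U; rewrite -surjective_pairing; apply.
Qed.

Lemma lift_isD1 u p : csupp u -> isD (fun t => expr_lift u (t, p.2)) p.1 (expr_lift (expr_d1 u) p).
Proof.
move=> cu; have [Dp|Dp] := pselect (D p); last first.
  rewrite lift_out//; apply: (isD_near (f := fun=> 0)); last exact: isD_cst.
  by apply: filterS (near_line1 (csupp_near0 cu Dp)) => t ->.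
have nD : \forall q \near p, D q by apply: open_nbhs_nbhs; split=> //; exact: strip_set_open S.
apply: (isD_near (f := fun t => expr_eval u (Psi (t, p.2)).1 (Psi (t, p.2)).2)).
  by apply: filterS (near_line1 nD) => t Dt; rewrite liftE.
have [q0 pE] := strip_coordP Dp.
have [ds_ dr_] := strip_coord_isD S Phi_inj p.1 1 0 Dp.
have lE t : (p.1 + (t - p.1) * 1, p.2 + (t - p.1) * 0) = (t, p.2).
  by rewrite mulr1 mulr0 addr0 addrC subrK.
have {}ds_ := isD_ext (g := fun t => (Psi (t, p.2)).1) (fun t => congr1 (fun q => (Psi q).1) (lE t)) ds_.
have {}dr_ := isD_ext (g := fun t => (Psi (t, p.2)).2) (fun t => congr1 (fun q => (Psi q).2) (lE t)) dr_.
have PE : Psi (p.1, p.2) = Psi p by rewrite -surjective_pairing.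
apply: isD_eq; first by apply: (eval_isD u _ ds_ dr_); rewrite /= PE.
rewrite /= PE; by rewrite liftE//=; field; rewrite gt_eqF// (rect_jacobian_gt0 S q0).
Qed.

Lemma lift_isD2 u p : csupp u -> isD (fun t => expr_lift u (p.1, t)) p.2 (expr_lift (expr_d2 u) p).
Proof.
move=> cu; have [Dp|Dp] := pselect (D p); last first.
  rewrite lift_out//; apply: (isD_near (f := fun=> 0)); last exact: isD_cst.
  by apply: filterS (near_line2 (csupp_near0 cu Dp)) => t ->.
have nD : \forall q \near p, D q by apply: open_nbhs_nbhs; split=> //; exact: strip_set_open S.
apply: (isD_near (f := fun t => expr_eval u (Psi (p.1, t)).1 (Psi (p.1, t)).2)).
  by apply: filterS (near_line2 nD) => t Dt; rewrite liftE.
have [q0 pE] := strip_coordP Dp.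
have [ds_ dr_] := strip_coord_isD S Phi_inj p.2 0 1 Dp.
have lE t : (p.1 + (t - p.2) * 0, p.2 + (t - p.2) * 1) = (p.1, t).
  by rewrite mulr1 mulr0 addr0 [_ + (t - _)]addrC subrK.
have {}ds_ := isD_ext (g := fun t => (Psi (p.1, t)).1) (fun t => congr1 (fun q => (Psi q).1) (lE t)) ds_.
have {}dr_ := isD_ext (g := fun t => (Psi (p.1, t)).2) (fun t => congr1 (fun q => (Psi q).2) (lE t)) dr_.
have PE : Psi (p.1, p.2) = Psi p by rewrite -surjective_pairing.
apply: isD_eq; first by apply: (eval_isD u _ ds_ dr_); rewrite /= PE.
rewrite /= PE; by rewrite liftE//=; field; rewrite gt_eqF// (rect_jacobian_gt0 S q0).
Qed.

Lemma partial1_lift u : csupp u -> partial1 (expr_lift u) = expr_lift (expr_d1 u).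
Proof. by move=> cu; apply/funext => p; apply: isD_derive1; exact: lift_isD1. Qed.

Lemma partial2_lift u : csupp u -> partial2 (expr_lift u) = expr_lift (expr_d2 u).
Proof. by move=> cu; apply/funext => p; apply: isD_derive1; exact: lift_isD2. Qed.

Lemma lift_Ck n u : csupp u -> Ck n (expr_lift u).
Proof.
elim: n u => [|n IH] u cu; split; try exact: lift_continuous; first by [].
have [c1 c2] := csupp_d12 cu; split.
- by move=> p; exact: isD_derivable (lift_isD1 p cu).
- by move=> p; exact: isD_derivable (lift_isD2 p cu).
- by rewrite partial1_lift//; exact: IH.
- by rewrite partial2_lift//; exact: IH.
Qed.

Lemma lift_test_function u : csupp u -> test_function D (expr_lift u).
Proof.
by move=> cu; split; [move=> n; exact: lift_Ck|exact: csupp_compact].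
Qed.

End lift.

(** * Integration in the plane *)

Section plane_integrals.
Context {R : realType}.
Local Notation plane := (measurableTypeR R * measurableTypeR R)%type.
Local Notation mu := (@leb2 R).

Lemma open_measurable2 (U : set (R * R)) : open U -> measurable (U : set plane).
Proof.
move=> oU.
pose box (q1 q2 : rat) (n : nat) : set (R * R) :=
  [set p | `|p.1 - ratr q1| < n.+1%:R^-1 /\ `|p.2 - ratr q2| < n.+1%:R^-1].
have mbox q1 q2 n : measurable (box q1 q2 n : set plane).
  have -> : box q1 q2 n = `]ratr q1 - n.+1%:R^-1, ratr q1 + n.+1%:R^-1[%classic `*`
      `]ratr q2 - n.+1%:R^-1, ratr q2 + n.+1%:R^-1[%classic.
    by apply/seteqP; split=> -[a b]; rewrite /box /= !in_itv /= -!ltr_distl.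
  by apply: measurableX; exact: measurable_itv.
have -> : U = \bigcup_q1 \bigcup_q2 \bigcup_n
    (if pselect (box q1 q2 n `<=` U) then box q1 q2 n else set0).
  apply/seteqP; split=> [[a b] Uab|p [q1 _ [q2 _ [n _]]]]; last first.
    by case: pselect => // h /h.
  have /nbhs_ballP[e /= e0 eU] : nbhs (a, b) U by apply: open_nbhs_nbhs.
  have [n /= ne] : exists n, n.+1%:R^-1 < e / 2.
    have e2 : 0 < (e / 2)^-1 by rewrite invr_gt0 divr_gt0.
    exists (Num.truncn (e / 2)^-1); rewrite invf_plt ?posrE ?ltr0n ?divr_gt0//.
    exact: truncnS_gt.
  have n0 : (0 : R) < n.+1%:R^-1 by rewrite invr_gt0 ltr0n.
  have [q1] : exists q1 : rat, ratr q1 \in `]a - n.+1%:R^-1, a + n.+1%:R^-1[.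
    by apply: rat_in_itvoo; rewrite ltrBlDr -addrA ltrDl addr_gt0.
  have [q2] : exists q2 : rat, ratr q2 \in `]b - n.+1%:R^-1, b + n.+1%:R^-1[.
    by apply: rat_in_itvoo; rewrite ltrBlDr -addrA ltrDl addr_gt0.
  rewrite !in_itv /= -!ltr_distl => h2 h1.
  exists q1 => //; exists q2 => //; exists n => //.
  case: (pselect (box q1 q2 n `<=` U)) => nU /=.
    by rewrite /box /= distrC h1 distrC h2.
  exfalso; apply: nU => p [u1 v1]; apply: eU; split; rewrite /ball /=.
    have := ler_distD (ratr q1) a p.1; rewrite (distrC a (ratr q1)) (distrC (ratr q1) p.1) => H.
    by apply: le_lt_trans H _; rewrite [e]splitr ltrD ?(lt_trans h1)// (lt_trans u1).
  have := ler_distD (ratr q2) b p.2; rewrite (distrC b (ratr q2)) (distrC (ratr q2) p.2) => H.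
  by apply: le_lt_trans H _; rewrite [e]splitr ltrD ?(lt_trans h2)// (lt_trans v1).
apply: bigcupT_measurable_rat => q1; apply: bigcupT_measurable_rat => q2.
apply: bigcupT_measurable => n; case: (pselect (box q1 q2 n `<=` U)) => _ /=; first exact: mbox.
exact: measurable0.
Qed.

Lemma continuous_measurable2 (G : R * R -> R) : continuous G ->
  measurable_fun setT (G : plane -> R).
Proof.
move=> /continuousP cG; apply: (measurability _ (measurable_realfun.RGenOpens.measurableE R)).
move=> _ [_ [a [b ->] <-]]; rewrite setTI; apply: open_measurable2.
exact/cG/interval_open.
Qed.

Lemma compact_box (K : set (R * R)) : compact K ->
  exists A : R, 0 < A /\ K `<=` [set p | `|p.1| < A /\ `|p.2| < A].
Proof.
move=> /compact_bounded[A [_ AK]].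
exists (Num.max 1 (A + 2)); split; first by rewrite lt_max ltr01.
move=> p Kp; have /= := AK (A + 1) _ p Kp.
rewrite ltrDl ltr01 => /(_ isT); rewrite /Num.norm /= /Num.norm /= => pA.
have m : A + 1 < Num.max 1 (A + 2) by rewrite lt_max; apply/orP; right; lra.
by split; apply: le_lt_trans m; apply: le_trans pA; rewrite le_max lexx ?orbT.
Qed.

Definition box (A : R) : set plane := `[- A, A]%classic `*` `[- A, A]%classic.

Lemma box_measure (A : R) : 0 <= A -> measurable (box A) /\ (mu (box A) < +oo)%E.
Proof.
move=> A0; split; first by apply: measurableX; exact: measurable_itv.
rewrite /leb2 /box product_measure1E//; try exact: measurable_itv.
rewrite [X in (X * _)%E]lebesgue_measure_itv.
by rewrite [X in (_ * X)%E]lebesgue_measure_itv /=; case: ifP => _; rewrite ?mul0e// -EFinM ltry.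
Qed.

Lemma compact_support_integrable (G : R * R -> R) (K : set (R * R)) :
  continuous G -> compact K -> (forall p, ~ K p -> G p = 0) ->
  mu.-integrable setT (EFin \o G).
Proof.
move=> cG cK G0; have [A [A0 KA]] := compact_box cK.
have [mB Bfin] := box_measure (ltW A0).
set B := box A in mB Bfin.
have GB p : ~ B p -> G p = 0.
  move=> nB; apply: G0 => /KA[h1 h2]; apply: nB.
  by split; rewrite /= in_itv /= -ler_norml ltW.
have -> : EFin \o G = (EFin \o G) \_ B.
  apply/funext => p; rewrite /patch; case: ifPn => //= /negP pB; congr EFin.
  by apply: GB => Bp; apply: pB; rewrite inE.
apply/(integrable_mkcond _ mB).
apply: measurable_bounded_integrable => //.
  by apply: measurable_funS (continuous_measurable2 cG).
have cGK : compact (G @` K).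
  by apply: continuous_compact => //; exact: continuous_subspaceT.
have [M [_ MG]] := compact_bounded cGK.
exists (Num.max 0 M); split; first exact: num_real.
move=> N; rewrite gt_max => /andP[N0 MN] p _ /=.
have [Kp|Kp] := pselect (K p); first by apply: (MG N MN); exists p.
by rewrite G0// normr0 ltW.
Qed.

Lemma FTC_line (f g : R -> R) (a b : R) : a < b -> (forall t, isD f t (g t)) ->
  continuous g -> (forall t, ~ (a < t < b) -> g t = 0) -> f a = 0 -> f b = 0 ->
  (\int[@lebesgue_measure R]_t (g t)%:E = 0)%E.
Proof.
move=> ab fg cg g0 fa fb.
have cf : continuous f by move=> t; exact: isD_continuous (fg t).
have -> : (\int[@lebesgue_measure R]_t (g t)%:E =
    \int[@lebesgue_measure R]_(t in `[a, b]) (g t)%:E)%E.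
  rewrite [RHS]integral_mkcond; apply: eq_integral => t _; rewrite /patch.
  case: ifPn => // /negP; rewrite inE /= in_itv /= => h; rewrite g0// => /andP[h1 h2].
  by apply: h; rewrite !ltW.
rewrite (continuous_FTC2 (F := f) ab).
- by rewrite fa fb subee.
- exact: continuous_subspaceT.
- split.
  + by move=> t _; exact: isD_derivable (fg t).
  + by apply: cvg_at_right_filter; exact: cf.
  + by apply: cvg_at_left_filter; exact: cf.
- by move=> t _; rewrite (isD_derive1 (fg t)).
Qed.

Lemma integral_partial1_eq0 (F G : R * R -> R) (K : set (R * R)) :
  (forall p, isD (fun t => F (t, p.2)) p.1 (G p)) -> continuous G -> compact K ->
  (forall p, ~ K p -> F p = 0) -> (forall p, ~ K p -> G p = 0) ->
  \int[mu]_p G p = 0.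
Proof.
move=> FG cG cK F0 G0; have [A [A0 KA]] := compact_box cK.
have iG := compact_support_integrable cG cK G0.
rewrite /Rintegral -integral21_prod_meas1//.
rewrite integral0_eq// => v _; rewrite /fubini_G /=.
have out t : ~ (- A < t < A) -> ~ K (t, v).
  by move=> h /KA[/= h1 _]; apply: h; rewrite -ltr_norml.
apply: (FTC_line (f := fun t => F (t, v)) (g := fun t => G (t, v)) (a := - A) (b := A)).
- by lra.
- by move=> t; exact: FG (t, v).
- apply: (continuous_comp_fun cG); apply: continuous_pairing => ?; [exact: cvg_id|exact: cvg_cst].
- by move=> t /out; exact: G0.
- by apply: F0; apply: out; lra.
- by apply: F0; apply: out; lra.
Qed.

Lemma integral_partial2_eq0 (F G : R * R -> R) (K : set (R * R)) :
  (forall p, isD (fun t => F (p.1, t)) p.2 (G p)) -> continuous G -> compact K ->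
  (forall p, ~ K p -> F p = 0) -> (forall p, ~ K p -> G p = 0) ->
  \int[mu]_p G p = 0.
Proof.
move=> FG cG cK F0 G0; have [A [A0 KA]] := compact_box cK.
have iG := compact_support_integrable cG cK G0.
rewrite /Rintegral -integral12_prod_meas1//.
rewrite integral0_eq// => v _; rewrite /fubini_F /=.
have out t : ~ (- A < t < A) -> ~ K (v, t).
  by move=> h /KA[/= _ h1]; apply: h; rewrite -ltr_norml.
apply: (FTC_line (f := fun t => F (v, t)) (g := fun t => G (v, t)) (a := - A) (b := A)).
- by lra.
- by move=> t; exact: FG (v, t).
- apply: (continuous_comp_fun cG); apply: continuous_pairing => ?; [exact: cvg_cst|exact: cvg_id].
- by move=> t /out; exact: G0.
- by apply: F0; apply: out; lra.
- by apply: F0; apply: out; lra.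
Qed.

End plane_integrals.

Section square_approximation.
Context d (T : measurableType d) (R : realType) (mu : {measure set T -> \bar R}).
Context (D : set T) (mD : measurable D).
Implicit Types f g h w : T -> R.

Definition sqdist f g : \bar R := (\int[mu]_(p in D) ((f p - g p) ^+ 2)%:E)%E.

Lemma measurable_sqdist f g : measurable_fun D f -> measurable_fun D g ->
  measurable_fun D (EFin \o (fun p => (f p - g p) ^+ 2)).
Proof.
move=> mf mg; apply/measurable_EFinP; apply: measurable_funX.
exact: measurable_funB.
Qed.

Lemma sqdist_triangle f g h : measurable_fun D f -> measurable_fun D g -> measurable_fun D h ->
  (sqdist f h <= 2%:E * sqdist f g + 2%:E * sqdist g h)%E.
Proof.
move=> mf mg mh; have m1 := measurable_sqdist mf mg; have m2 := measurable_sqdist mg mh.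
have z1 p : D p -> (0 <= ((f p - g p) ^+ 2)%:E)%E by move=> _; rewrite lee_fin sqr_ge0.
have z2 p : D p -> (0 <= ((g p - h p) ^+ 2)%:E)%E by move=> _; rewrite lee_fin sqr_ge0.
rewrite /sqdist -!ge0_integralZl// -ge0_integralD//; last 4 first.
- by move=> p Dp; rewrite mule_ge0// z1.
- exact: measurable_funeM.
- by move=> p Dp; rewrite mule_ge0// z2.
- exact: measurable_funeM.
apply: ge0_le_integral => //.
- by move=> p _; rewrite lee_fin sqr_ge0.
- exact: measurable_sqdist.
- by apply: emeasurable_funD; exact: measurable_funeM.
move=> p _; rewrite -!EFinM -EFinD lee_fin.
have := sqr_ge0 ((f p - g p) - (g p - h p)).
by move: (f p) (g p) (h p) => a b c; nra.
Qed.

Lemma sqdist_scale c f g : measurable_fun D f -> measurable_fun D g ->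
  sqdist (fun p => c * f p) (fun p => c * g p) = ((c ^+ 2)%:E * sqdist f g)%E.
Proof.
move=> mf mg; rewrite /sqdist -ge0_integralZl//.
- by apply: eq_integral => p _; rewrite -EFinM -mulrBr exprMn.
- exact: measurable_sqdist.
- by move=> p _; rewrite lee_fin sqr_ge0.
- by rewrite lee_fin sqr_ge0.
Qed.

Lemma sqdist_shift f g h : sqdist (fun p => f p + h p) (fun p => g p + h p) = sqdist f g.
Proof. by apply: eq_integral => p _; rewrite opprD addrACA subrr addr0. Qed.

Variable C : set (T -> R).
Hypothesis C_meas : forall c, C c -> measurable_fun D c.
Hypothesis C_add : forall c c', C c -> C c' -> C (fun p => c p + c' p).
Hypothesis C_scale : forall a c, C c -> C (fun p => a * c p).

Definition approximable w := measurable_fun D w /\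
  forall e : R, 0 < e -> exists c, C c /\ (sqdist w c <= e%:E)%E.

Lemma C_approximable c : C c -> approximable c.
Proof.
move=> Cc; split=> [|e e0]; first exact: C_meas.
exists c; split=> //; rewrite /sqdist (eq_integral (cst 0%E)) ?integral0 ?lee_fin ?ltW//.
by move=> p _; rewrite subrr expr0n.
Qed.

Lemma approximable_lim w : measurable_fun D w ->
  (forall e : R, 0 < e -> exists w', approximable w' /\ (sqdist w w' <= e%:E)%E) ->
  approximable w.
Proof.
move=> mw H; split=> // e e0.
have e4 : 0 < e / 4 by rewrite divr_gt0.
have [w' [[mw' aw'] ww']] := H _ e4; have [c [Cc w'c]] := aw' _ e4.
exists c; split=> //; apply: le_trans (sqdist_triangle mw mw' (C_meas Cc)) _.
apply: (@le_trans _ _ (2%:E * (e / 4)%:E + 2%:E * (e / 4)%:E)%E).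
  by apply: leeD; rewrite lee_pmul2l// ?fin_numE//= lte_fin.
by rewrite -!EFinM -EFinD lee_fin; lra.
Qed.

Lemma approximable_scale a w : approximable w -> approximable (fun p => a * w p).
Proof.
move=> [mw aw]; split=> [|e e0]; first exact: measurable_funM.
have a0 : 0 < a ^+ 2 + 1 by rewrite ltr_wpDl// sqr_ge0.
have [c [Cc wc]] := aw (e / (a ^+ 2 + 1)) (divr_gt0 e0 a0).
exists (fun p => a * c p); split; first exact: C_scale.
rewrite sqdist_scale//; last exact: C_meas.
apply: (@le_trans _ _ ((a ^+ 2)%:E * (e / (a ^+ 2 + 1))%:E)%E).
  by apply: lee_wpmul2l => //; rewrite lee_fin sqr_ge0.
rewrite -EFinM lee_fin mulrCA -[leRHS]mulr1 ler_wpM2l ?(ltW e0)//.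
by rewrite ler_pdivrMr// mul1r lerDl.
Qed.

Lemma approximable_add w w' : approximable w -> approximable w' ->
  approximable (fun p => w p + w' p).
Proof.
move=> [mw aw] [mw' aw']; split=> [|e e0]; first exact: measurable_funD.
have e4 : 0 < e / 4 by rewrite divr_gt0.
have [c [Cc wc]] := aw _ e4; have [c' [Cc' wc']] := aw' _ e4.
have mc := C_meas Cc; have mc' := C_meas Cc'.
exists (fun p => c p + c' p); split; first exact: C_add.
apply: le_trans (sqdist_triangle (g := fun p => c p + w' p) _ _ _) _.
- exact: measurable_funD.
- exact: measurable_funD.
- exact: measurable_funD.
rewrite sqdist_shift.
have -> : sqdist (fun p => c p + w' p) (fun p => c p + c' p) = sqdist w' c'.
  by apply: eq_integral => p _; rewrite opprD addrACA subrr add0r.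
apply: (@le_trans _ _ (2%:E * (e / 4)%:E + 2%:E * (e / 4)%:E)%E).
  by apply: leeD; rewrite lee_pmul2l// ?fin_numE//= lte_fin.
by rewrite -!EFinM -EFinD lee_fin; lra.
Qed.

Lemma eq_approximable w w' : (forall p, D p -> w p = w' p) -> approximable w -> approximable w'.
Proof.
move=> ww' [mw aw]; split.
  by apply: eq_measurable_fun mw => p; rewrite inE; exact: ww'.
move=> e e0; have [c [Cc wc]] := aw e e0; exists c; split=> //.
suff -> : sqdist w' c = sqdist w c by [].
by apply: eq_integral => p; rewrite inE => /ww' ->.
Qed.

Lemma approximable_dominated (w_ : nat -> T -> R) w g :
  (forall n, approximable (w_ n)) -> measurable_fun D w ->
  (forall p, D p -> (w_ ^~ p) @ \oo --> w p) ->
  mu.-integrable D (fun p => (g p)%:E) ->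
  (forall n p, D p -> (w p - w_ n p) ^+ 2 <= g p) -> approximable w.
Proof.
move=> aw mw cw ig wg; apply: approximable_lim => // e e0.
have m_ n : measurable_fun D (EFin \o (fun p => (w p - w_ n p) ^+ 2)).
  by apply: measurable_sqdist => //; exact: (aw n).1.
have c0 : {ae mu, forall p, D p -> (fun n => ((w p - w_ n p) ^+ 2)%:E) @ \oo --> (cst 0%E : T -> \bar R) p}.
  apply: aeW => p Dp /=; apply: cvg_EFin; first by near=> n.
  have : (fun n => w p - w_ n p) @ \oo --> w p - w p.
    by apply: cvgB; [exact: cvg_cst|exact: cw].
  rewrite subrr => h.
  rewrite (_ : (0 : R) = 0 * 0); last by rewrite mulr0.
  rewrite (_ : _ \o _ = fun n => (w p - w_ n p) * (w p - w_ n p)); first exact: cvgM.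
  by apply/funext => n /=; rewrite expr2.
have dom : {ae mu, forall p n, D p -> (`|((w p - w_ n p) ^+ 2)%:E| <= (g p)%:E)%E}.
  by apply: aeW => p n Dp; rewrite lee_fin ger0_norm ?sqr_ge0// wg.
have [_ _ C0] := dominated_convergence mD m_ (measurable_cst _) c0 ig dom.
rewrite integral0 in C0.
have : \forall n \near \oo, (\int[mu]_(p in D) ((w p - w_ n p) ^+ 2)%:E < e%:E)%E.
  apply: (C0 [set u | (u < e%:E)%E]); apply: open_nbhs_nbhs; split; first exact: open_ereal_lt_ereal.
  by rewrite /= lte_fin.
move=> [n _ /(_ n (leqnn n))] H; exists (w_ n); split=> //.
exact: ltW.
Unshelve. all: by end_near. Qed.

Lemma approximable_sum (I : Type) (s : seq I) (F : I -> T -> R) :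
  approximable (fun=> 0) -> (forall i, approximable (F i)) ->
  approximable (fun p => \sum_(i <- s) F i p).
Proof.
move=> a0 aF; elim: s => [|i s IH].
  by apply: eq_approximable a0 => p _; rewrite big_nil.
by apply: eq_approximable (approximable_add (aF i) IH) => p _; rewrite big_cons.
Qed.

Hypothesis D_fin : (mu D < +oo)%E.

Lemma approximable_indic_dynkin (G : set (set T)) :
  setI_closed G -> (forall A, G A -> measurable A) ->
  (forall A, G A -> approximable \1_A) -> approximable \1_setT ->
  forall A, <<s G >> A -> measurable A /\ approximable \1_A.
Proof.
move=> GI Gm Ga aT A; rewrite -(setI_closed_g_dynkin_g_sigma_algebra GI).
have : <<d G >> `<=` [set B | measurable B /\ approximable \1_B]; last exact.
apply: smallest_sub; last by move=> B GB; split; [exact: Gm|exact: Ga].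
split.
- by split=> //; exact: measurableT.
- move=> B [mB aB]; split; first exact: measurableC.
  apply: eq_approximable (approximable_add aT (approximable_scale (-1) aB)) => p _.
  by rewrite !indicE in_setC in_setT /=; case: (p \in B) => /=; ring.
- move=> F tF GF.
  have mF : measurable (\bigcup_k F k) by apply: bigcupT_measurable => k; exact: (GF k).1.
  split=> //.
  have aS n : approximable \1_(\bigcup_(i < n) F i).
    elim: n => [|n IH].
      rewrite bigcup_mkord big_ord0; apply: eq_approximable (approximable_scale 0 aT) => p _.
      by rewrite mul0r indic0.
    apply: eq_approximable (approximable_add IH (GF n).2) => p _.
    rewrite !bigcup_mkord big_ord_recr /= indicE [in LHS]indicE [RHS]indicE in_setU.
    have : (p \in \big[setU/set0]_(i < n) F i) && (p \in F n) = false.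
      apply/negbTE/negP => /andP[]; rewrite !inE -bigcup_mkord => -[m /= mn Fm] Fn.
      have /eqP := tF m n I I (ex_intro _ p (conj Fm Fn)).
      by rewrite ltn_eqF.
    case: (p \in \big[_/_]_(_ < _) _); case: (p \in F n) => //= _; rewrite ?addr0 ?add0r//.
  apply: (approximable_dominated (w_ := fun n => \1_(\bigcup_(i < n) F i)) (g := cst 1)) => //.
  + move=> p Dp; rewrite [\1_(\bigcup_k F k) p]indicE.
    have [Fp|nFp] := pselect ((\bigcup_k F k) p); last first.
      rewrite memNset//; apply: cvg_near_cst; near=> n.
      by rewrite indicE memNset// => -[m _ Fm]; apply: nFp; exists m.
    rewrite mem_set//; case: Fp => m _ Fm; apply: cvg_near_cst; near=> n.
    rewrite indicE mem_set//; exists m => //=; near: n; exact: nbhs_infty_gt.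
  + apply: (measurable_bounded_integrable (f := cst 1)) => //.
    by exists 1; split; [exact: num_real|move=> r r1 p _ /=; rewrite normr1 ltW].
  + move=> n p _; rewrite !indicE /=.
    by case: (_ \in _); case: (_ \in _); rewrite ?subrr ?subr0 ?sub0r ?sqrrN ?expr1n ?expr0n ?ler01.
Unshelve. all: by end_near. Qed.

Hypothesis indic_approximable : forall A, measurable A -> approximable \1_A.

Import HBNNSimple.

Lemma nnsfun_approximable (f : {nnsfun T >-> R}) : approximable f.
Proof.
have a0 : approximable (fun=> 0).
  apply: eq_approximable (approximable_scale 0 (indic_approximable measurableT)) => p _.
  by rewrite mul0r.
have := @approximable_sum R (finmap.enum_fset (fset_set (range f))) (fun y p => y * \1_(f @^-1` [set y]) p) a0.
move=> H; apply: eq_approximable (H _) => [p _|y]; last first.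
  by apply: approximable_scale; apply: indic_approximable; exact: measurable_sfunP.
by rewrite [RHS]fimfunE fsbig_finite.
Qed.

Lemma approximable_ge0 f : measurable_fun D f -> (forall p, 0 <= f p) ->
  mu.-integrable D (fun p => (f p ^+ 2)%:E) -> approximable f.
Proof.
move=> mf f0 if2; have mf' : measurable_fun D (EFin \o f) by exact/measurable_EFinP.
pose g n : T -> R := nnsfun_approx mD mf' n.
have gf n p : D p -> 0 <= g n p <= f p.
  move=> Dp; rewrite fun_ge0 /= -lee_fin /g nnsfun_approxE.
  by apply: le_approx => // q _; rewrite lee_fin.
apply: (approximable_dominated (w_ := g) (g := fun p => f p ^+ 2)) => //.
- by move=> n; exact: nnsfun_approximable.
- move=> p Dp.
  have f0' q : D q -> (0 <= (EFin \o f) q)%E by move=> _; rewrite lee_fin.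
  have /fine_cvgP[_] := cvg_nnsfun_approx mD mf' f0' Dp.
  exact.
- move=> n p Dp; have /andP[g0 gf'] := gf n p Dp.
  by rewrite lerXn2r ?nnegrE ?subr_ge0// gerBl.
Qed.

Lemma approximable_L2 f : measurable_fun D f ->
  mu.-integrable D (fun p => (f p ^+ 2)%:E) -> approximable f.
Proof.
move=> mf if2.
have P (g : T -> R) : measurable_fun D g -> (forall p, 0 <= g p <= `|f p|) -> approximable g.
  move=> mg g0; apply: approximable_ge0 => //.
    by move=> p; have /andP[] := g0 p.
  apply: le_integrable if2 => //.
    by apply/measurable_EFinP; exact: measurable_funX.
  move=> p _; rewrite !abse_EFin lee_fin !ger0_norm ?sqr_ge0//.
  by have /andP[h1 h2] := g0 p; rewrite -[leRHS]real_normK ?num_real// lerXn2r// nnegrE.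
have ap : approximable (fun p => Num.max (f p) 0).
  apply: P => [|p]; first exact: measurable_maxr.
  by rewrite le_max lexx orbT /= ge_max ler_norm normr_ge0.
have an : approximable (fun p => Num.max (- f p) 0).
  apply: P => [|p]; first by apply: measurable_maxr => //; exact: measurable_funN.
  by rewrite le_max lexx orbT /= ge_max -normrN ler_norm normr_ge0.
apply: eq_approximable (approximable_add ap (approximable_scale (-1) an)) => p _.
rewrite mulN1r; have [fp|fp] := lerP 0 (f p).
  by rewrite ?(max_l fp) (max_r (x := - f p)) ?oppr_le0// subr0.
by rewrite ?(max_r (ltW fp)) (max_l (x := - f p)) ?oppr_ge0 ?ltW// opprK add0r.
Qed.

End square_approximation.

Section cutoff_functions.
Context {R : realType}.

Lemma odd_primitive (L a : R) (f : R -> R) : 0 < a -> a <= L - a -> smooth f ->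
  (forall s, ~~ (a <= s <= L - a) -> f s = 0) -> (forall s, f (L - s) = - f s) ->
  exists F : R -> R, [/\ smooth F, forall s, isD F s (f s) &
    forall s, ~~ (a <= s <= L - a) -> F s = 0].
Proof.
move=> a0 aL sf f0 fodd; have cf := smooth_continuous sf.
have [F [dF F0]] := @continuous_primitive R f (-1) cf.
have fneg s : s <= 0 -> f s = 0.
  by move=> s0; apply: f0; rewrite negb_and -!ltNge (le_lt_trans s0).
have Fneg := F0 fneg.
have dF' s : isD F s (f s).
  have [s1|s1] := ltP (-1) s; first exact: dF.
  have sn : s < 0 by lra.
  rewrite fneg ?ltW//; apply: (isD_near (f := fun=> 0)); last exact: isD_cst.
  by near=> u; rewrite Fneg// ltW//; near: u; exact: lt_nbhsl.
have cF s : {for s, continuous F} by exact: isD_continuous (dF' s).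
have Flow s : s <= a -> F s = 0.
  move=> sa; have [s0|s0] := leP s 0; first exact: Fneg.
  rewrite -(Fneg 0)//; apply: (isD_cst_eq (a := 0) (b := a) (f := F)); last 2 first.
  - by rewrite ltW.
  - by rewrite lexx ltW.
  - by move=> u /andP[u0 ua]; apply: isD_eq (dF' u) _; apply: f0; rewrite negb_and -!ltNge ua.
  - by move=> u _; exact: cF.
have Fsym s : F (L - s) = F s.
  have dG u : isD (fun v => F (L - v) - F v) u 0.
    apply: isD_eq; first apply: isDB (dF' u); first apply: (isD_comp (f := F)); first exact: dF'.
      by apply: isDB; [exact: isD_cst|exact: isD_id].
    by rewrite /= fodd; ring.
  suff : F (L - s) - F s = F (L - L / 2) - F (L / 2).
    by rewrite (_ : L - L / 2 = L / 2) ?subrr; [move/eqP; rewrite subr_eq0 => /eqP|lra].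
  apply: (isD_cst_eq (a := Num.min s (L / 2)) (b := Num.max s (L / 2))
    (f := fun v => F (L - v) - F v)).
  - by move=> u _; exact: dG.
  - by move=> u _; exact: isD_continuous (dG u).
  - by rewrite ge_min le_max lexx.
  - by rewrite ge_min le_max lexx !orbT.
exists F; split=> //; first exact: smooth_primitive dF' sf.
move=> s; rewrite negb_and -!ltNge => /orP[h|h]; first by rewrite Flow// ltW.
by rewrite -Fsym Flow//; lra.
Unshelve. all: by end_near. Qed.

Definition cutoff (a b : R) (n : nat) (s : R) : R :=
  expinv 0 (n%:R * (s - a)) * expinv 0 (n%:R * (b - s)).

Lemma cutoff_smooth a b n : smooth (cutoff a b n).
Proof.
have H1 := @smooth_affine R _ n%:R (- (n%:R * a)) (@expinv_smooth R 0).
have H2 := @smooth_affine R _ (- n%:R) (n%:R * b) (@expinv_smooth R 0).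
have := smoothM H1 H2; rewrite (_ : (fun t => _) = cutoff a b n)//.
by apply/funext => s; rewrite /cutoff; congr (expinv _ _ * expinv _ _); ring.
Qed.

Lemma expinv0_le1 (t : R) : expinv 0 t <= 1.
Proof.
rewrite /expinv; case: ifPn => // t0.
by rewrite expr0 invr1 mul1r -expR0 ler_expR oppr_le0 invr_ge0 ltW.
Qed.

Lemma cutoff_itv a b n s : 0 <= cutoff a b n s <= 1.
Proof.
rewrite /cutoff mulr_ge0 ?expinv_ge0//= -[leRHS]mulr1.
by apply: ler_pM; rewrite ?expinv_ge0 ?expinv0_le1.
Qed.

Lemma cutoff_eq0 a b n s : ~~ (a < s < b) -> cutoff a b n s = 0.
Proof.
rewrite negb_and -!leNgt => /orP[h|h].
  by rewrite /cutoff /expinv ltNge mulr_ge0_le0 ?subr_le0//= mul0r.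
by rewrite /cutoff [expinv 0 (n%:R * (b - s))]/expinv ltNge mulr_ge0_le0 ?subr_le0//= mulr0.
Qed.

Lemma expinv0_cvg (c : R) : 0 < c -> (fun n : nat => expinv 0 (n%:R * c)) @ \oo --> (1 : R).
Proof.
move=> c0; apply: (@cvg_trans _ ((fun n : nat => expR (- (n%:R * c)^-1)) @ \oo)).
  apply: near_eq_cvg; near=> n; rewrite /expinv ifT ?expr0 ?invr1 ?mul1r//.
  by rewrite mulr_gt0// ltr0n; near: n; exact: nbhs_infty_gt.
have V : (fun n : nat => (n%:R : R)^-1) @ \oo --> (0 : R).
  apply/gtr0_cvgV0; last exact: cvgr_idn.
  by near=> n; rewrite ltr0n; near: n; exact: nbhs_infty_gt.
have H : (fun n : nat => - (n%:R * c)^-1) @ \oo --> (- (c^-1 * 0) : R).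
  apply: cvgN; rewrite (_ : (fun n : nat => (n%:R * c)^-1) = (fun n : nat => c^-1 * n%:R^-1)).
    by apply: cvgM; [exact: cvg_cst|exact: V].
  by apply/funext => n; rewrite invfM mulrC.
have := cvg_comp _ _ H (@continuous_expR R _).
by rewrite mulr0 oppr0 expR0.
Unshelve. all: by end_near. Qed.

Lemma cutoff_cvg a b s : (fun n => cutoff a b n s) @ \oo --> (if a < s < b then 1 else 0 : R).
Proof.
case: ifPn => [/andP[as_ sb]|h].
  by rewrite -[X in _ --> X]mulr1; apply: cvgM; apply: expinv0_cvg; rewrite subr_gt0.
rewrite (_ : (fun n => _) = cst 0); first exact: cvg_cst.
by apply/funext => n; rewrite cutoff_eq0.
Qed.

End cutoff_functions.

(** * Density of divergences of tangential fields *)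

Section strip_density.
Context {R : realType} (L delta : R) (x y x1 y1 x2 y2 k k1 : R -> R).
Context (S : curve_strip L delta x y x1 y1 x2 y2 k k1).
Local Notation Phi := (strip_map x y x1 y1).
Local Notation Q := (in_rect L delta).
Local Notation D := (strip_set L delta x y x1 y1).
Local Notation Psi := (strip_coord L delta x y x1 y1).
Context (Phi_inj : forall s1 r1 s2 r2, 0 < s1 < L -> 0 < r1 < delta ->
  0 < s2 < L -> 0 < r2 < delta -> Phi s1 r1 = Phi s2 r2 -> s1 = s2 /\ r1 = r2).
Local Notation plane := (measurableTypeR R * measurableTypeR R)%type.
Local Notation mu := (@leb2 R).
Local Notation ev := (expr_eval L k).
Local Notation lift := (expr_lift L delta x y x1 y1 k).
Local Notation csupp := (csupp L delta k).

Lemma strip_measurable : measurable (D : set plane).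
Proof. by apply: open_measurable2; exact: strip_set_open S. Qed.

Lemma strip_finite : (mu D < +oo)%E.
Proof.
have cx := continuous_isD (x_isD S); have cy := continuous_isD (y_isD S).
have cx1 := continuous_isD (x1_isD S); have cy1 := continuous_isD (y1_isD S).
have cK : compact ((fun q => Phi q.1 q.2) @` (`[0, L] `*` `[0, delta])).
  apply: continuous_compact; last by apply: compact_setX; exact: segment_compact.
  apply: continuous_subspaceT.
  have c1 := @continuous_fst R R; have c2 := @continuous_snd R R.
  apply: continuous_pairing; [apply: continuousD_fun|apply: continuousB_fun].
  + exact: continuous_comp_fun cx c1.
  + exact: (continuousM_fun c2 (continuous_comp_fun cy1 c1)).
  + exact: continuous_comp_fun cy c1.
  + exact: (continuousM_fun c2 (continuous_comp_fun cx1 c1)).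
have [A [A0 KA]] := compact_box cK.
have [mB Bfin] := box_measure (ltW A0).
apply: le_lt_trans Bfin; apply: le_measure; rewrite ?inE//; first exact: strip_measurable.
move=> p [s [r [[/andP[s0 sL] /andP[r0 rd]] ->]]].
have /KA[h1 h2] : ((fun q => Phi q.1 q.2) @` (`[0, L] `*` `[0, delta])) (Phi s r).
  by exists (s, r) => //; split; rewrite /= in_itv /= !ltW.
by split; rewrite /= in_itv /= -ler_norml ltW.
Qed.

(* The second condition solves, in the coordinates, the equation div(Z T) = odd part of u;
   this is possible with Z of compact support because the odd part has mean zero along
   each curve r = const. *)
Definition solvable (u : expr) : Prop := csupp u /\
  exists Z, csupp Z /\ forall s r, Q s r ->
    ev (expr_ds S Z) s r = (1 + r * k s) * ((ev u s r - ev u (L - s) r) / 2).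

Lemma solvable_add u v : solvable u -> solvable v -> solvable (EAdd u v).
Proof.
move=> [cu [Z [cZ ZE]]] [cv [W [cW WE]]]; split; first exact: csupp_add.
exists (EAdd Z W); split; first exact: csupp_add.
by move=> s r q0 /=; rewrite ZE// WE//; field.
Qed.

Lemma solvable_scale c u : solvable u -> solvable (EMul (ECst c) u).
Proof.
move=> [cu [Z [cZ ZE]]]; split; first exact: (csupp_mul _ cu).2.
exists (EMul (ECst c) Z); split; first exact: (csupp_mul _ cZ).2.
by move=> s r q0 /=; rewrite ZE// (isD_derive1 (isD_cst c s)); field.
Qed.

Lemma odd_product_primitive (f eta : R -> R) (sf : smooth f) (seta : smooth eta) (a c d : R) :
  0 < a -> a <= L - a -> 0 < c -> d < delta ->
  (forall s, ~~ (a <= s <= L - a) -> f s = 0) -> (forall s, f (L - s) = - f s) ->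
  (forall r, ~~ (c <= r <= d) -> eta r = 0) ->
  exists Z, csupp Z /\ forall s r, Q s r ->
    ev (expr_ds S Z) s r = (1 + r * k s) * (f s * eta r).
Proof.
move=> a0 aL c0 dd f0 fodd eta0.
have [F0 [sF0 dF0 F00]] := odd_primitive a0 aL sf f0 fodd.
have sfk : smooth (fun s => f s * k s) by exact: smoothM sf (k_smooth S).
have fk0 s : ~~ (a <= s <= L - a) -> f s * k s = 0 by move=> /f0 ->; rewrite mul0r.
have fkodd s : f (L - s) * k (L - s) = - (f s * k s).
  rewrite fodd mulNr; have [sI|sI] := boolP (a <= s <= L - a); last by rewrite f0// !mul0r.
  by rewrite (curvature_sym S)//; move/andP: sI => [? ?]; lra.
have [F1 [sF1 dF1 F10]] := odd_primitive a0 aL sfk fk0 fkodd.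
exists (EMul (ER seta) (EAdd (ES sF0) (EMul (ER (@smooth_id R)) (ES sF1)))); split.
  exists a, (L - a), c, d; split=> //; first by rewrite ltrBlDr ltrDl.
  move=> s r q0; rewrite negb_and /= => /orP[h|h]; last by rewrite eta0// mul0r.
  by rewrite F00// F10// mulr0 addr0 mulr0.
by move=> s r q0 /=; rewrite (isD_derive1 (dF0 s)) (isD_derive1 (dF1 s)); ring.
Qed.

Lemma solvable_cutoff (a b c d : R) (m : nat) : 0 < a -> b < L -> 0 < c -> d < delta ->
  solvable (EMul (ES (@cutoff_smooth R a b m)) (ER (@cutoff_smooth R c d m))).
Proof.
move=> a0 bL c0 dd; have L0 := L_gt0 S.
have sub (a' b' : R) s : a' <= a -> b <= b' -> ~~ (a' <= s <= b') -> cutoff a b m s = 0.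
  move=> aa bb nb; apply: cutoff_eq0; apply: contra nb => /andP[h1 h2].
  by rewrite (le_trans aa (ltW h1)) (le_trans (ltW h2) bb).
have cutoff0 r : ~~ (c <= r <= d) -> cutoff c d m r = 0.
  by move=> nb; apply: cutoff_eq0; apply: contra nb => /andP[h1 h2]; rewrite !ltW.
split.
  exists a, b, c, d; split=> // s r q0; rewrite negb_and /= => /orP[h|h].
    by rewrite (sub a b)// mul0r.
  by rewrite cutoff0// mulr0.
pose a1 := Num.min (Num.min a (L - b)) (L / 2).
have a10 : 0 < a1 by rewrite !lt_min a0 subr_gt0 bL divr_gt0.
have [e1 [e2 e3]] : a1 <= a /\ (a1 <= L - b /\ a1 <= L / 2).
  by rewrite /a1 !ge_min !lexx !orbT.
pose f s := 2^-1 * (cutoff a b m s - cutoff a b m (-1 * s + L)).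
have sf : smooth f.
  apply: smoothM; first exact: smooth_cst.
  apply: smoothB; first exact: cutoff_smooth.
  exact: (@smooth_affine R (cutoff a b m) (-1) L (@cutoff_smooth R a b m)).
have f0 s : ~~ (a1 <= s <= L - a1) -> f s = 0.
  move=> nb; rewrite /f (sub a1 (L - a1))//; [|lra].
  rewrite (sub a1 (L - a1)) ?subrr ?mulr0//; [lra|].
  by apply: contra nb => /andP[h1 h2]; apply/andP; split; lra.
have fodd s : f (L - s) = - f s.
  rewrite /f (_ : -1 * (L - s) + L = s); last by ring.
  by rewrite (_ : L - s = -1 * s + L); [ring|ring].
have [|Z [cZ ZE]] := odd_product_primitive sf (@cutoff_smooth R c d m) a10 _ c0 dd f0 fodd cutoff0.
  by lra.
exists Z; split=> // s r q0; rewrite ZE//= /f (_ : L - s = -1 * s + L); last by ring.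
by field.
Qed.

Definition solvable_lifts : set (plane -> R) := [set w | exists u, solvable u /\ w = lift u].

Lemma lift_measurable u : csupp u -> measurable_fun (D : set plane) (lift u : plane -> R).
Proof.
move=> cu; apply: measurable_funTS; apply: continuous_measurable2.
exact: lift_continuous S Phi_inj _ cu.
Qed.

Lemma solvable_lifts_measurable w : solvable_lifts w -> measurable_fun (D : set plane) w.
Proof. by move=> [u [[cu _] ->]]; exact: lift_measurable. Qed.

Lemma solvable_lifts_add w w' : solvable_lifts w -> solvable_lifts w' ->
  solvable_lifts (fun p => w p + w' p).
Proof.
move=> [u [su ->]] [v [sv ->]]; exists (EAdd u v); split; first exact: solvable_add.
by apply/funext => p; rewrite /lift; case: pselect => //= _; rewrite addr0.
Qed.

Lemma solvable_lifts_scale c w : solvable_lifts w -> solvable_lifts (fun p => c * w p).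
Proof.
move=> [u [su ->]]; exists (EMul (ECst c) u); split; first exact: solvable_scale.
by apply/funext => p; rewrite /lift; case: pselect => //= _; rewrite mulr0.
Qed.

Local Notation approx := (approximable mu D solvable_lifts).

Definition strip_rect (a b c d : R) : set plane :=
  [set p | D p /\ (a < (Psi p).1 < b /\ c < (Psi p).2 < d)].

Definition strip_rects : set (set plane) := [set A | exists a b c d,
  [/\ 0 < a, b < L, 0 < c, d < delta & A = strip_rect a b c d]].

Lemma strip_rectsI : setI_closed strip_rects.
Proof.
move=> _ _ [a [b [c [d [a0 bL c0 dd ->]]]]] [a' [b' [c' [d' [a0' bL' c0' dd' ->]]]]].
exists (Num.max a a'), (Num.min b b'), (Num.max c c'), (Num.min d d').
split; rewrite ?lt_max ?gt_min ?a0 ?bL ?c0 ?dd//.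
apply/seteqP; split=> p; rewrite /strip_rect /= !lt_min !gt_max.
  by move=> [[Dp [/andP[-> ->] /andP[-> ->]]] [_ [/andP[-> ->] /andP[-> ->]]]].
by move=> [Dp [/andP[/andP[-> ->] /andP[-> ->]] /andP[/andP[-> ->] /andP[-> ->]]]].
Qed.

Lemma strip_rect_open a b c d : open (strip_rect a b c d : set (R * R)).
Proof.
rewrite openE => p [Dp [h1 h2]].
have nD : \forall q \near p, D q by apply: open_nbhs_nbhs; split=> //; exact: strip_set_open S.
have cP := strip_coord_continuous S Phi_inj Dp.
have c1 : {for p, continuous (fun q => (Psi q).1)}.
  by apply: cvg_comp; [exact: cP|exact: continuous_fst].
have c2 : {for p, continuous (fun q => (Psi q).2)}.
  by apply: cvg_comp; [exact: cP|exact: continuous_snd].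
case/andP: h1 => a1 b1; case/andP: h2 => c1' d1.
near=> q; split; first by near: q.
split; apply/andP; split; near: q.
- exact: (cvgr_gt _ c1).
- exact: (cvgr_lt _ c1).
- exact: (cvgr_gt _ c2).
- exact: (cvgr_lt _ c2).
Unshelve. all: by end_near. Qed.

Lemma strip_rect_approximable (a b c d : R) : 0 < a -> b < L -> 0 < c -> d < delta ->
  approx \1_(strip_rect a b c d).
Proof.
move=> a0 bL c0 dd.
pose w n : plane -> R := lift (EMul (ES (@cutoff_smooth R a b n)) (ER (@cutoff_smooth R c d n))).
have mD := strip_measurable.
have w01 n p : 0 <= w n p <= 1.
  rewrite /w /lift; case: pselect => /= _; last by rewrite lexx ler01.
  have /andP[u0 u1] := cutoff_itv a b n (Psi p).1; have /andP[v0 v1] := cutoff_itv c d n (Psi p).2.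
  by rewrite mulr_ge0//= -[leRHS]mulr1 ler_pM.
apply: (approximable_dominated mD solvable_lifts_measurable (w_ := w) (g := cst 1)).
- move=> n; apply: (C_approximable _ solvable_lifts_measurable).
  by exists (EMul (ES (@cutoff_smooth R a b n)) (ER (@cutoff_smooth R c d n))); split=> //; exact: solvable_cutoff.
- by apply: measurable_indic; apply: open_measurable2; exact: strip_rect_open.
- move=> p Dp.
  have -> : \1_(strip_rect a b c d) p =
      (if a < (Psi p).1 < b then 1 else 0) * (if c < (Psi p).2 < d then 1 else 0) :> R.
    rewrite indicE; case: ifPn => h1; case: ifPn => h2; rewrite ?mulr1 ?mul0r ?mulr0.
    + by rewrite mem_set.
    + by rewrite memNset// => -[_ [_]]; rewrite (negbTE h2).
    + by rewrite memNset// => -[_ []]; rewrite (negbTE h1).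
    + by rewrite memNset// => -[_ []]; rewrite (negbTE h1).
  rewrite (_ : w ^~ p = fun n => cutoff a b n (Psi p).1 * cutoff c d n (Psi p).2).
    by apply: cvgM; exact: cutoff_cvg.
  by apply/funext => n; rewrite /w liftE.
- apply: (measurable_bounded_integrable (f := cst 1)) => //; first exact: strip_finite.
  by exists 1; split; [exact: num_real|move=> r r1 p _ /=; rewrite normr1 ltW].
- move=> n p _; have /andP[w0 w1] := w01 n p; rewrite indicE /=.
  by case: (_ \in _) => /=; nra.
Qed.

Lemma strip_full_approximable : approx \1_setT.
Proof.
have mD := strip_measurable; have L0 := L_gt0 S; have d0 := delta_gt0 S.
have V : (fun n : nat => (n.+1%:R : R)^-1) @ \oo --> (0 : R) by exact: cvg_harmonic.
pose E n := strip_rect n.+1%:R^-1 (L - n.+1%:R^-1) n.+1%:R^-1 (delta - n.+1%:R^-1).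
have p0 n : (0 : R) < n.+1%:R^-1 by rewrite invr_gt0 ltr0n.
apply: (approximable_dominated mD solvable_lifts_measurable (w_ := fun n => \1_(E n)) (g := cst 1)).
- by move=> n; apply: strip_rect_approximable => //; rewrite ltrBlDr ltrDl.
- exact: measurable_indic.
- move=> p Dp; have [[/andP[s0 sL] /andP[r0 rd]] _] := strip_coordP Dp.
  apply: cvg_near_cst; near=> n; rewrite !indicE mem_set ?in_setT//.
  split=> //; split; apply/andP; split; [|rewrite ltrBrDl -ltrBrDr| |rewrite ltrBrDl -ltrBrDr];
    near: n; apply: (cvgr_lt _ V); rewrite ?subr_gt0//.
- apply: (measurable_bounded_integrable (f := cst 1)) => //; first exact: strip_finite.
  by exists 1; split; [exact: num_real|move=> r r1 p _ /=; rewrite normr1 ltW].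
- move=> n p _; rewrite !indicE /= in_setT.
  by case: (_ \in _) => /=; rewrite ?subrr ?subr0 ?expr1n ?expr0n ?ler01.
Unshelve. all: by end_near. Qed.

End strip_density.

Lemma open_generated_measurable {R : realType}
  (A : set (measurableTypeR R * measurableTypeR R)) :
  measurable A -> <<s [set U | open (U : set (R * R))] >> A.
Proof.
move=> mA.
pose T' := g_sigma_algebraType [set U : set (R * R) | open U].
pose h (p : T') : measurableTypeR R * measurableTypeR R := p.
have mo (f : R * R -> R) : continuous f ->
    measurable_fun setT ((f : T' -> measurableTypeR R)).
  move=> /continuousP cf; apply: (measurability _ (measurable_realfun.RGenOpens.measurableE R)).
  move=> _ [_ [a [b ->] <-]]; rewrite setTI; apply: sub_sigma_algebra.
  exact/cf/interval_open.
have mh : measurable_fun setT h.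
  by apply/measurable_fun_pairP; split; apply: mo; [exact: continuous_fst|exact: continuous_snd].
have := mh measurableT A mA.
by rewrite setTI.
Qed.

Section strip_density.
Context {R : realType} (L delta : R) (x y x1 y1 x2 y2 k k1 : R -> R).
Context (S : curve_strip L delta x y x1 y1 x2 y2 k k1).
Local Notation Phi := (strip_map x y x1 y1).
Local Notation Q := (in_rect L delta).
Local Notation D := (strip_set L delta x y x1 y1).
Local Notation Psi := (strip_coord L delta x y x1 y1).
Context (Phi_inj : forall s1 r1 s2 r2, 0 < s1 < L -> 0 < r1 < delta ->
  0 < s2 < L -> 0 < r2 < delta -> Phi s1 r1 = Phi s2 r2 -> s1 = s2 /\ r1 = r2).
Local Notation plane := (measurableTypeR R * measurableTypeR R)%type.
Local Notation mu := (@leb2 R).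
Local Notation approx := (approximable mu D (solvable_lifts S)).
Local Notation rects := (strip_rects L delta x y x1 y1).
Local Notation rect := (strip_rect L delta x y x1 y1).

Lemma rects_open (U : set (R * R)) : open U -> <<s rects >> (U `&` D).
Proof.
move=> oU.
pose E (a b c d : rat) : set plane :=
  if pselect ([/\ (0 : R) < ratr a, ratr b < L, (0 : R) < ratr c, ratr d < delta &
    rect (ratr a) (ratr b) (ratr c) (ratr d) `<=` U])
  then rect (ratr a) (ratr b) (ratr c) (ratr d) else set0.
have -> : U `&` D = \bigcup_a \bigcup_b \bigcup_c \bigcup_d E a b c d.
  apply/seteqP; split=> [p [Up Dp]|p [a _ [b _ [c _ [d _]]]]]; last first.
    by rewrite /E; case: pselect => [[_ _ _ _ sU] /= rp|//]; split; [exact: sU|exact: rp.1].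
  have [q0 pE] := strip_coordP Dp; have [/andP[s0 sL] /andP[r0 rd]] := q0.
  have cPhi : continuous (fun q : R * R => Phi q.1 q.2).
    have cx := continuous_isD (x_isD S); have cy := continuous_isD (y_isD S).
    have cx1 := continuous_isD (x1_isD S); have cy1 := continuous_isD (y1_isD S).
    have c1 := @continuous_fst R R; have c2 := @continuous_snd R R.
    apply: continuous_pairing; [apply: continuousD_fun|apply: continuousB_fun].
    + exact: continuous_comp_fun cx c1.
    + exact: (continuousM_fun c2 (continuous_comp_fun cy1 c1)).
    + exact: continuous_comp_fun cy c1.
    + exact: (continuousM_fun c2 (continuous_comp_fun cx1 c1)).
  have : nbhs (Psi p) [set q | U (Phi q.1 q.2)].
    by apply: cPhi; rewrite -pE; apply: open_nbhs_nbhs.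
  move=> /nbhs_ballP[e /= e0 eU].
  set s := (Psi p).1 in s0 sL q0 pE; set r := (Psi p).2 in r0 rd q0 pE.
  have ra (u v : R) : u < v -> exists q : rat, u < ratr q < v.
    by move=> /rat_in_itvoo[q]; rewrite in_itv; exists q.
  have [a /andP[a1 a2]] : exists q : rat, Num.max 0 (s - e) < ratr q < s.
    by apply: ra; rewrite gt_max s0 /= ltrBlDr ltrDl.
  have [b /andP[b1 b2]] : exists q : rat, s < ratr q < Num.min L (s + e).
    by apply: ra; rewrite lt_min sL /= ltrDl.
  have [c /andP[c1 c2]] : exists q : rat, Num.max 0 (r - e) < ratr q < r.
    by apply: ra; rewrite gt_max r0 /= ltrBlDr ltrDl.
  have [d /andP[d1 d2]] : exists q : rat, r < ratr q < Num.min delta (r + e).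
    by apply: ra; rewrite lt_min rd /= ltrDl.
  move: a1 b2 c1 d2; rewrite !gt_max !lt_min => /andP[a0 ae] /andP[bL be] /andP[c0 ce] /andP[dd de].
  exists a => //; exists b => //; exists c => //; exists d => //.
  rewrite /E; case: pselect => [_ /=|[]].
    by split=> //; rewrite a2 b1 c2 d1.
  split=> // q [Dq [/andP[h1 h2] /andP[h3 h4]]].
  have [_ ->] := strip_coordP Dq; apply: eU; split; rewrite /ball /= -/s -/r ltr_distlC;
    by apply/andP; split; [exact: lt_trans h1 || exact: lt_trans h3|exact: lt_trans h2 _ || exact: lt_trans h4 _].
have mE a b c d : <<s rects >> (E a b c d).
  rewrite /E; case: pselect => [[a0 bL c0 dd _]|_] /=.
    by apply: sub_sigma_algebra; exists (ratr a), (ratr b), (ratr c), (ratr d).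
  exact: (@measurable0 _ (g_sigma_algebraType rects)).
do 4 (apply: (@bigcupT_measurable_rat _ (g_sigma_algebraType rects)) => ?).
exact: mE.
Qed.

Lemma rects_measurable (A : set plane) : measurable A -> <<s rects >> (A `&` D).
Proof.
move=> /open_generated_measurable.
have : <<s [set U | open (U : set (R * R))] >> `<=` [set A : set (R * R) | <<s rects >> (A `&` D)].
  pose T' := g_sigma_algebraType rects.
  apply: smallest_sub => [|U oU]; last exact: rects_open.
  split.
  - by rewrite /= set0I; exact: (@measurable0 _ T').
  - move=> B /= mB; rewrite setTD.
    rewrite (_ : _ `&` _ = (setT `&` D) `\` (B `&` D)).
      apply: (@measurableD _ T') => //; rewrite -/(<<s rects >> _).
      by apply: rects_open; exact: openT.
    by rewrite setTI; apply/seteqP; split=> p /=; tauto.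
  - by move=> F /= mF; rewrite setI_bigcupl; exact: (@bigcupT_measurable _ T').
by move=> /[apply].
Qed.

Lemma strip_L2_approximable (f : plane -> R) : measurable_fun (D : set plane) f ->
  mu.-integrable D (fun p => (f p ^+ 2)%:E) -> approx f.
Proof.
move=> mf if2; have mD := strip_measurable S.
have CM := @solvable_lifts_measurable _ _ _ _ _ _ _ _ _ _ _ S Phi_inj.
have CA := @solvable_lifts_add _ _ _ _ _ _ _ _ _ _ _ S.
have CS := @solvable_lifts_scale _ _ _ _ _ _ _ _ _ _ _ S.
suff indic A : measurable A -> approx \1_A by exact: (approximable_L2 mD CM CA CS indic mf if2).
move=> mA; have Gm B : rects B -> measurable B.
  by move=> [a [b [c [d [_ _ _ _ ->]]]]]; apply: open_measurable2; exact: (strip_rect_open S Phi_inj).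
have Ga B : rects B -> approx \1_B.
  by move=> [a [b [c [d [a0 bL c0 dd ->]]]]]; exact: strip_rect_approximable.
have GI := @strip_rectsI R L delta x y x1 y1.
have [_] := approximable_indic_dynkin mD CM CA CS (strip_finite S) GI Gm Ga
  (strip_full_approximable S Phi_inj) (rects_measurable mA).
by apply: eq_approximable => p Dp; rewrite !indicE in_setI (mem_set Dp) andbT.
Qed.

End strip_density.

(** * Square-integrable functions and reflection *)

Section square_integrable.
Context d (T : measurableType d) (R : realType) (mu : {measure set T -> \bar R}).
Context (D : set T) (mD : measurable D).
Implicit Types f g h : T -> R.

Definition integrableR f := mu.-integrable D (EFin \o f).

Definition square_integrable f :=
  measurable_fun D f /\ mu.-integrable D (fun p => (f p ^+ 2)%:E).

Lemma integrableRD f g : integrableR f -> integrableR g -> integrableR (fun p => f p + g p).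
Proof. by move=> hf hg; exact: (integrableD mD hf hg). Qed.

Lemma integrableRB f g : integrableR f -> integrableR g -> integrableR (fun p => f p - g p).
Proof. by move=> hf hg; exact: (integrableB mD hf hg). Qed.

Lemma integrableRZ c f : integrableR f -> integrableR (fun p => c * f p).
Proof. by move=> hf; exact: (integrableZl mD c hf). Qed.

Lemma integrableR_le f g : measurable_fun D f -> integrableR g ->
  (forall p, D p -> `|f p| <= g p) -> integrableR f.
Proof.
move=> mf hg fg; apply: le_integrable hg => //; first exact/measurable_EFinP.
by move=> p Dp; rewrite !abse_EFin lee_fin (le_trans (fg p Dp))// ler_norm.
Qed.

Lemma eq_integrableR f g : (forall p, D p -> f p = g p) -> integrableR f -> integrableR g.
Proof. by move=> fg; apply: eq_integrable => // p; rewrite inE => Dp /=; rewrite fg. Qed.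

Lemma square_integrable_mul f g : square_integrable f -> square_integrable g ->
  integrableR (fun p => f p * g p).
Proof.
move=> [mf hf] [mg hg].
apply: (@integrableR_le _ (fun p => f p ^+ 2 + g p ^+ 2)).
- exact: measurable_funM.
- exact: integrableRD.
- move=> p _; rewrite normrM -[f p ^+ 2]real_normK ?num_real// -[g p ^+ 2]real_normK ?num_real//.
  by set a := `|f p|; set b := `|g p|; have := sqr_ge0 (a - b); have := sqr_ge0 (a + b); nra.
Qed.

Lemma square_integrableD f g : square_integrable f -> square_integrable g ->
  square_integrable (fun p => f p + g p).
Proof.
move=> sf sg; split; first by apply: measurable_funD; [exact: sf.1|exact: sg.1].
apply: (@eq_integrableR (fun p => f p ^+ 2 + 2 * (f p * g p) + g p ^+ 2)).
  by move=> p _; ring.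
apply: integrableRD; last exact: sg.2.
by apply: integrableRD; [exact: sf.2|apply: integrableRZ; exact: square_integrable_mul].
Qed.

Lemma square_integrableZ c f : square_integrable f -> square_integrable (fun p => c * f p).
Proof.
move=> [mf hf]; split; first by apply: measurable_funM => //; exact: measurable_cst.
apply: (@eq_integrableR (fun p => c ^+ 2 * f p ^+ 2)); first by move=> p _; ring.
exact: integrableRZ.
Qed.

Lemma square_integrableB f g : square_integrable f -> square_integrable g ->
  square_integrable (fun p => f p - g p).
Proof.
move=> sf sg; have := square_integrableD sf (square_integrableZ (-1) sg).
by under [X in square_integrable X]eq_fun do rewrite mulN1r.
Qed.

Lemma sqdistE f g : square_integrable f -> square_integrable g ->
  sqdist mu D f g = (\int[mu]_(p in D) ((f p - g p) ^+ 2))%R%:E.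
Proof.
move=> sf sg; rewrite /sqdist /Rintegral fineK//.
exact: (integrable_fin_num mD (square_integrableB sf sg).2).
Qed.

Lemma integral_sq_gt0 f : square_integrable f -> ~ {ae mu, forall p, D p -> f p = 0} ->
  0 < (\int[mu]_(p in D) (f p ^+ 2))%R.
Proof.
move=> [mf hf] nf; rewrite lt_neqAle Rintegral_ge0 ?andbT; last by move=> p _; exact: sqr_ge0.
apply/negP => /eqP I0; apply: nf.
have := integrable_fin_num mD hf; rewrite fin_numElt => /andP[_ Ioo].
have I00 : (\int[mu]_(p in D) `|(f p ^+ 2)%:E| = 0)%E.
  under eq_integral do rewrite abse_EFin ger0_norm ?sqr_ge0//.
  rewrite -[LHS]fineK; first by move: I0; rewrite /Rintegral => <-.
  exact: (integrable_fin_num mD hf).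
have [|h _] := @ae_eq_integral_abs _ T R mu D mD (fun p => (f p ^+ 2)%:E) _.
  by case/integrableP: hf.
move: (h I00); apply: filterS => p h' Dp.
by move: (h' Dp) => /= [] /eqP; rewrite sqrf_eq0 => /eqP.
Qed.

End square_integrable.

Section reflection.
Context {R : realType}.
Local Notation plane := (measurableTypeR R * measurableTypeR R)%type.
Local Notation mu := (@leb2 R).

Definition reflect_y (p : plane) : plane := (- p.1, p.2).

Lemma measurable_reflect_y : measurable_fun setT reflect_y.
Proof.
apply/measurable_fun_pairP; split.
  exact: (measurableT_comp (@oppr_measurable R setT) (@measurable_fst _ _ _ _)).
exact: measurable_snd.
Qed.

Lemma leb2_reflect_y (A : set plane) : measurable A -> pushforward mu reflect_y A = mu A.
Proof.
move=> mA; apply/esym; rewrite /leb2.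
pose m1 := @lebesgue_measure R.
pose m0 : {measure set plane -> \bar R} := pushforward mu reflect_y.
pose m' := m0 measurable_reflect_y.
apply: (@product_measure_unique _ _ _ _ R m1 m1 m') => // B C mB mC.
rewrite /m' /m0 /= /pushforward.
have -> : reflect_y @^-1` (B `*` C) = ((-%R : R -> R) @^-1` B) `*` C by [].
have mN : measurable ((-%R : R -> R) @^-1` B).
  by have := @oppr_measurable R setT measurableT B mB; rewrite setTI.
rewrite [LHS](@product_measure1E _ _ _ _ R m1 m1)//.
by congr (_ * _)%E; exact: lebesgue_measureN.
Qed.

Lemma integral_reflect_y (D : set plane) (f : plane -> \bar R) :
  measurable D -> measurable_fun D f -> (forall p, D p -> (0 <= f p)%E) ->
  (forall p, D p -> D (reflect_y p)) ->
  (\int[mu]_(p in D) f (reflect_y p) = \int[mu]_(p in D) f p)%E.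
Proof.
move=> mD mf f0 DD.
have DE : reflect_y @^-1` D = D.
  apply/seteqP; split=> p; last exact: DD.
  by move=> /DD; rewrite /reflect_y /= opprK; case: p.
rewrite -[in LHS]DE -(ge0_integral_pushforward measurable_reflect_y mu mD mf).
  by apply: eq_measure_integral => [|? A mA _]; [exact: measurable_reflect_y|exact: leb2_reflect_y].
by move=> p; rewrite inE; exact: f0.
Qed.

End reflection.

(** * The lower bound *)

Section lower_bound.
Context {R : realType} (L delta : R) (x y x1 y1 x2 y2 k k1 : R -> R).
Context (S : curve_strip L delta x y x1 y1 x2 y2 k k1).
Local Notation Phi := (strip_map x y x1 y1).
Local Notation Q := (in_rect L delta).
Local Notation D := (strip_set L delta x y x1 y1).
Local Notation Psi := (strip_coord L delta x y x1 y1).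
Context (Phi_inj : forall s1 r1 s2 r2, 0 < s1 < L -> 0 < r1 < delta ->
  0 < s2 < L -> 0 < r2 < delta -> Phi s1 r1 = Phi s2 r2 -> s1 = s2 /\ r1 = r2).
Local Notation plane := (measurableTypeR R * measurableTypeR R)%type.
Local Notation mu := (@leb2 R).
Local Notation ev := (expr_eval L k).
Local Notation lift := (expr_lift L delta x y x1 y1 k).
Local Notation csupp := (csupp L delta k).
Local Notation X1 := (ES (x1_smooth S)).
Local Notation Y1 := (ES (y1_smooth S)).
Local Notation ds := (expr_ds S).

Lemma liftD u v p : lift (EAdd u v) p = lift u p + lift v p.
Proof. by rewrite /expr_lift; case: pselect => //= _; rewrite addr0. Qed.

Lemma liftM u v p : lift (EMul u v) p = lift u p * lift v p.
Proof. by rewrite /expr_lift; case: pselect => //= _; rewrite mulr0. Qed.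

Lemma eq_lift u v : (forall s r, Q s r -> ev u s r = ev v s r) -> forall p, lift u p = lift v p.
Proof.
move=> uv p; have [Dp|nDp] := pselect (D p); last by rewrite !lift_out.
by rewrite !liftE// uv//; exact: (strip_coordP Dp).1.
Qed.

Lemma lift_integrableT u : csupp u -> mu.-integrable setT (EFin \o (lift u : plane -> R)).
Proof.
move=> cu; have [K [cK _ K0]] := csupp_compact S cu.
exact: compact_support_integrable (lift_continuous S Phi_inj cu) cK K0.
Qed.

Lemma lift_integrable u : csupp u -> integrableR mu D (lift u).
Proof.
move=> cu; apply: (integrableS measurableT (strip_measurable S)) => //.
exact: lift_integrableT.
Qed.

Lemma lift_square_integrable u : csupp u -> square_integrable mu D (lift u).
Proof.
move=> cu; split; first exact: lift_measurable S Phi_inj _ cu.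
have := lift_integrable (csupp_mul u cu).1.
by apply: eq_integrableR (strip_measurable S) _ _ _ => p _; rewrite liftM expr2.
Qed.

Lemma lift_RintegralT u : (\int[mu]_(p in D) lift u p)%R = (\int[mu]_p lift u p)%R.
Proof.
rewrite Rintegral_mkcond; apply: eq_Rintegral => p _; rewrite /patch.
by case: ifPn => // /negP h; rewrite lift_out// => Dp; apply: h; rewrite inE.
Qed.

Lemma lift_partial_integral u : csupp u ->
  (\int[mu]_(p in D) lift (expr_d1 S u) p)%R = 0 /\
  (\int[mu]_(p in D) lift (expr_d2 S u) p)%R = 0.
Proof.
move=> cu; have [c1 c2] := csupp_d12 S cu; have [K [cK KD K0]] := csupp_compact S cu.
have [K1 [cK1 _ K10]] := csupp_compact S c1; have [K2 [cK2 _ K20]] := csupp_compact S c2.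
rewrite !lift_RintegralT; split.
- apply: (integral_partial1_eq0 (F := lift u) (K := K `|` K1)).
  + by move=> p; exact: lift_isD1.
  + exact: lift_continuous S Phi_inj _ c1.
  + exact: compactU.
  + by move=> p nK; apply: K0 => Kp; apply: nK; left.
  + by move=> p nK; apply: K10 => Kp; apply: nK; right.
- apply: (integral_partial2_eq0 (F := lift u) (K := K `|` K2)).
  + by move=> p; exact: lift_isD2.
  + exact: lift_continuous S Phi_inj _ c2.
  + exact: compactU.
  + by move=> p nK; apply: K0 => Kp; apply: nK; left.
  + by move=> p nK; apply: K20 => Kp; apply: nK; right.
Qed.

(* The divergence of Z times the unit tangent is Z_s / J. *)
Lemma lift_div Z p : lift (expr_d1 S (EMul Z X1)) p + lift (expr_d2 S (EMul Z Y1)) p =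
  lift (EMul (ds Z) EJinv) p.
Proof.
rewrite -liftD; apply: eq_lift => s r [sL _] /=.
have [/isD_derive1 -> /isD_derive1 ->] := frenet S sL.
have := arclength S (s := s); case/andP: sL => s0 sL; rewrite !ltW// => /(_ isT) e3.
set zr := ev (expr_dr _ _) _ _; set zs := ev (expr_ds _ _) _ _; set z := ev Z _ _; set j := _^-1.
transitivity (zs * j * (x1 s ^+ 2 + y1 s ^+ 2)); first by ring.
by rewrite e3 mulr1.
Qed.

Lemma H1_div v h1 h2 Z : H1 D v h1 h2 -> csupp Z ->
  (\int[mu]_(p in D) (v p * lift (EMul (ds Z) EJinv) p))%R =
  - (\int[mu]_(p in D) (h1 p * lift (EMul Z X1) p + h2 p * lift (EMul Z Y1) p))%R.
Proof.
move=> [Lv L1 L2 weak] cZ; have mD := strip_measurable S.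
have cX := (csupp_mul X1 cZ).1; have cY := (csupp_mul Y1 cZ).1.
have tX : test_function D (lift (EMul Z X1)) by exact: lift_test_function S Phi_inj _ cX.
have tY : test_function D (lift (EMul Z Y1)) by exact: lift_test_function S Phi_inj _ cY.
have [wX _] := weak _ tX; have [_ wY] := weak _ tY.
rewrite (partial1_lift S Phi_inj cX) in wX; rewrite (partial2_lift S Phi_inj cY) in wY.
have sX := lift_square_integrable cX; have sY := lift_square_integrable cY.
have s1 := lift_square_integrable (csupp_d12 S cX).1.
have s2 := lift_square_integrable (csupp_d12 S cY).2.
have E1 := RintegralD mD (square_integrable_mul mD L1 sX) (square_integrable_mul mD L2 sY).
have E2 := RintegralD mD (square_integrable_mul mD Lv s1) (square_integrable_mul mD Lv s2).
apply: etrans (etrans E2 _); first by apply: eq_Rintegral => p _; rewrite -lift_div mulrDr.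
apply: etrans (congr2 +%R wX wY) _; rewrite -opprD.
exact: (congr1 -%R (esym E1)).
Qed.

Lemma lift_wirtinger Z (M : R) : csupp Z -> 0 < M -> (forall s r, Q s r -> 1 + r * k s <= M) ->
  (pi / L) ^+ 2 / M ^+ 2 * (\int[mu]_(p in D) (lift Z p ^+ 2))%R <=
  (\int[mu]_(p in D) (lift (EMul (ds Z) EJinv) p ^+ 2))%R.
Proof.
move=> cZ M0 JM; have mD := strip_measurable S.
pose V := EMul (EMul Z Z) (@Ecot R).
have cV : csupp V by apply: (csupp_mul _ _).1; exact: (csupp_mul _ cZ).1.
have cX := (csupp_mul X1 cV).1; have cY := (csupp_mul Y1 cV).1.
have [IX _] := lift_partial_integral cX; have [_ IY] := lift_partial_integral cY.
have iX := lift_integrable (csupp_d12 S cX).1; have iY := lift_integrable (csupp_d12 S cY).2.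
have sZ := lift_square_integrable cZ.
have sW := lift_square_integrable (csupp_mul EJinv (csupp_d S cZ).1).1.
set c := (pi / L) ^+ 2.
have I0 : (\int[mu]_(p in D) (lift (EMul (ds V) EJinv) p))%R = 0.
  have := RintegralD mD iX iY; rewrite IX IY addr0 => <-.
  by apply: eq_Rintegral => p _; rewrite lift_div.
have cdV := (csupp_mul EJinv (csupp_d S cV).1).1.
have iV := lift_integrable cdV.
rewrite -(RintegralZl _ mD sZ.2) -[leLHS]add0r -[X in X + _ <= _](mulr0 M^-1) -I0.
rewrite -(RintegralZl _ mD iV).
rewrite -(RintegralD mD (integrableRZ mD M^-1 iV) (integrableRZ mD (c / M ^+ 2) sZ.2)).
apply: le_Rintegral => //.
- by apply: integrableRD => //; apply: integrableRZ => //; exact: sZ.2.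
- exact: sW.2.
move=> p Dp; have [q0 _] := strip_coordP Dp; rewrite !liftE//=.
move: (JM _ _ q0) (rect_jacobian_gt0 S q0).
set s := (Psi p).1; set r := (Psi p).2; set J := 1 + r * k s => JM' J0.
rewrite (_ : (pi / L) ^+ 2 = c)//.
set z := ev Z s r; set zs := ev (ds Z) s r; set f := scaled_cot L s.
have c0 : 0 <= c by exact: sqr_ge0.
set j := J^-1; set m := M^-1.
have m0 : 0 < m by rewrite invr_gt0.
have mj : m <= j by rewrite lef_pV2.
have j0 : 0 < j by exact: lt_le_trans mj.
rewrite -subr_ge0 [leRHS](_ : _ = zs ^+ 2 * (j * (j - m)) + m * j * (zs - z * f) ^+ 2 +
  c * z ^+ 2 * (m * (j - m))); last by rewrite /m; field; rewrite gt_eqF.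
have jm : 0 <= j - m by rewrite subr_ge0.
have t1 := mulr_ge0 (sqr_ge0 zs) (mulr_ge0 (ltW j0) jm).
have t2 := mulr_ge0 (mulr_ge0 (ltW m0) (ltW j0)) (sqr_ge0 (zs - z * f)).
have t3 := mulr_ge0 (mulr_ge0 c0 (sqr_ge0 z)) (mulr_ge0 (ltW m0) jm).
exact: addr_ge0 (addr_ge0 t1 t2) t3.
Qed.

Lemma reflect_strip p : D p -> D (reflect_y p) /\
  Psi (reflect_y p) = (L - (Psi p).1, (Psi p).2).
Proof.
move=> Dp; have [q0 pE] := strip_coordP Dp.
set s := (Psi p).1 in q0 pE *; set r := (Psi p).2 in q0 pE *.
have [/andP[s0 sL] rd] := q0.
have q1 : Q (L - s) r by split=> //; apply/andP; split; lra.
have sI : 0 <= s <= L by rewrite !ltW.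
have E : reflect_y p = Phi (L - s) r by apply: etrans (esym (strip_map_sym S r sI)); rewrite -pE.
by split; [exists (L - s), r|rewrite E strip_coordK].
Qed.

Lemma odd_eigenvalue_ge (M nu : R) : 0 < M -> (forall s r, Q s r -> 1 + r * k s <= M) ->
  odd_neumann_eigenvalue D nu -> (pi / L) ^+ 2 / M ^+ 2 <= nu.
Proof.
move=> M0 JM [u [[u_n0 [g1 [g2 [Hu weak]]]] u_odd]].
have mD := strip_measurable S; have [Lu Lg1 Lg2 _] := Hu.
set lam := (pi / L) ^+ 2 / M ^+ 2.
have lam0 : 0 < lam.
  by rewrite divr_gt0// exprn_gt0// divr_gt0 ?pi_gt0// (L_gt0 S).
set N := (\int[mu]_(p in D) (u p ^+ 2))%R.
set G := (\int[mu]_(p in D) (g1 p ^+ 2 + g2 p ^+ 2))%R.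
have N0 : 0 < N by exact: integral_sq_gt0.
have GE : G = nu * N.
  have -> : G = (\int[mu]_(p in D) (g1 p * g1 p + g2 p * g2 p))%R.
    by apply: eq_Rintegral => p _; rewrite !expr2.
  by rewrite (weak _ _ _ Hu); congr (_ * _); apply: eq_Rintegral => p _; rewrite expr2.
suff NG e : 0 < e -> N <= G / lam + e.
  have : N <= G / lam by apply/ler_addgt0Pr => e e0; exact: NG.
  by rewrite ler_pdivlMr// GE mulrC ler_pM2r.
move=> e0; have [_ /(_ e e0)[_ [[v [[cv [Z [cZ ZE]]] ->]] uv]]] :=
  strip_L2_approximable S Phi_inj Lu.1 Lu.2.
set w := lift (EMul (ds Z) EJinv).
have wE p : D p -> w p = (lift v p - lift v (reflect_y p)) / 2.
  move=> Dp; have [Dp' PE] := reflect_strip Dp; have [q0 _] := strip_coordP Dp.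
  rewrite /w !liftE// PE /= ZE//; field.
  by rewrite gt_eqF// (rect_jacobian_gt0 S q0).
have sv := lift_square_integrable cv.
have sw : square_integrable mu D w.
  exact: lift_square_integrable (csupp_mul EJinv (csupp_d S cZ).1).1.
have suv := square_integrableB mD Lu sv.
have suw := square_integrableB mD Lu sw.
have Euw : (\int[mu]_(p in D) ((u p - w p) ^+ 2))%R <= e.
  rewrite -lee_fin -(sqdistE mD Lu sw).
  apply: le_trans uv.
  pose F p : \bar R := ((u p - lift v p) ^+ 2)%:E.
  have mF : measurable_fun D F by case/integrableP: suv.2.
  have F0 p : D p -> (0 <= F p)%E by rewrite lee_fin sqr_ge0.
  have DD p : D p -> D (reflect_y p) by move=> /reflect_strip[].
  have mFr : measurable_fun D (F \o reflect_y).
    apply: (measurable_comp mD _ mF); first by move=> _ [p /DD Dp <-].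
    by apply: measurable_funTS; exact: measurable_reflect_y.
  have F0r p : D p -> (0 <= (F \o reflect_y) p)%E by rewrite lee_fin sqr_ge0.
  have h0 : (0 <= (2^-1)%:E :> \bar R)%E by rewrite lee_fin.
  apply: (@le_trans _ _ (\int[mu]_(p in D) ((2^-1)%:E * F p + (2^-1)%:E * (F \o reflect_y) p))%E).
    apply: ae_ge0_le_integral => //.
    - by move=> p _; rewrite lee_fin sqr_ge0.
    - by case/integrableP: suw.2.
    - by move=> p Dp; rewrite adde_ge0// mule_ge0//; [exact: F0|exact: F0r].
    - by apply: emeasurable_funD; exact: measurable_funeM.
    apply: (@filterS _ _ (ae_filter_ringOfSetsType mu) _ _ _ u_odd) => p up Dp.
    rewrite /= /F -!EFinM -EFinD lee_fin (wE _ Dp) (up Dp : u (reflect_y p) = _).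
    set a := u p; set b := lift v p; set c := lift v _.
    rewrite -subr_ge0 (_ : _ - _ = 4^-1 * (b + c) ^+ 2 :> R); last by field.
    by rewrite mulr_ge0// sqr_ge0.
  rewrite ge0_integralD//; first last.
  - exact: measurable_funeM.
  - by move=> p Dp; rewrite mule_ge0//; exact: F0r.
  - exact: measurable_funeM.
  - by move=> p Dp; rewrite mule_ge0//; exact: F0.
  have rE : (\int[mu]_(p in D) (F \o reflect_y) p = \int[mu]_(p in D) F p)%E.
    exact: integral_reflect_y mD mF F0 DD.
  rewrite !ge0_integralZl_EFin// rE.
  rewrite -ge0_muleDl ?lee_fin// -EFinD (_ : 2^-1 + 2^-1 = 1 :> R) ?mul1e//.
  by field.
have sX := lift_square_integrable (csupp_mul X1 cZ).1.
have sY := lift_square_integrable (csupp_mul Y1 cZ).1.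
have sZ := lift_square_integrable cZ.
have Wirt : lam * (\int[mu]_(p in D) (lift Z p ^+ 2))%R <= (\int[mu]_(p in D) (w p ^+ 2))%R.
  exact: lift_wirtinger.
have gX := square_integrable_mul mD Lg1 sX; have gY := square_integrable_mul mD Lg2 sY.
have ig : integrableR mu D (fun p => g1 p ^+ 2 + g2 p ^+ 2).
  by apply: integrableRD => //; [exact: Lg1.2|exact: Lg2.2].
set Iuw := (\int[mu]_(p in D) (u p * w p))%R.
have uwE : Iuw = - (\int[mu]_(p in D) (g1 p * lift (EMul Z X1) p + g2 p * lift (EMul Z Y1) p))%R.
  exact: H1_div Hu cZ.
have iuw := square_integrable_mul mD Lu sw.
have sq : (\int[mu]_(p in D) ((u p - w p) ^+ 2))%R =
    N - 2 * Iuw + (\int[mu]_(p in D) (w p ^+ 2))%R.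
  rewrite -(RintegralZl _ mD iuw) -(RintegralB mD Lu.2 (integrableRZ mD 2 iuw)).
  rewrite -(RintegralD mD (integrableRB mD Lu.2 (integrableRZ mD 2 iuw)) sw.2).
  by apply: eq_Rintegral => p _; ring.
have young : 2 * Iuw <= lam^-1 * G + lam * (\int[mu]_(p in D) (lift Z p ^+ 2))%R.
  rewrite uwE mulrN -mulNr -(RintegralZl _ mD (integrableRD mD gX gY)).
  rewrite -(RintegralZl _ mD ig) -(RintegralZl _ mD sZ.2).
  rewrite -(RintegralD mD (integrableRZ mD lam^-1 ig) (integrableRZ mD lam sZ.2)).
  apply: le_Rintegral => //.
  - exact: integrableRZ mD _ _ (integrableRD mD gX gY).
  - by apply: integrableRD => //; apply: integrableRZ => //; exact: sZ.2.
  move=> p Dp; have [[/andP[s0 sL] _] _] := strip_coordP Dp.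
  have XE : lift X1 p = x1 (Psi p).1 by rewrite liftE.
  have YE : lift Y1 p = y1 (Psi p).1 by rewrite liftE.
  have -> : lift (EMul Z X1) p = lift Z p * x1 (Psi p).1 by rewrite -XE; exact: liftM.
  have -> : lift (EMul Z Y1) p = lift Z p * y1 (Psi p).1 by rewrite -YE; exact: liftM.
  have sI : 0 <= (Psi p).1 <= L by rewrite (ltW s0) (ltW sL).
  move: (arclength S sI).
  set a := x1 _; set b := y1 _; set z := lift Z p => e3.
  rewrite -subr_ge0 (_ : _ - _ = lam^-1 * ((g1 p + lam * z * a) ^+ 2 + (g2 p + lam * z * b) ^+ 2)
    + lam * z ^+ 2 * (1 - (a ^+ 2 + b ^+ 2)) :> R); last by field; rewrite gt_eqF.
  by rewrite e3 subrr mulr0 addr0 mulr_ge0 ?invr_ge0 ?addr_ge0 ?sqr_ge0 ?(ltW lam0).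
have arith (a b c n i : R) : b <= c -> 2 * i <= a + b -> n - 2 * i + c <= e -> n <= a + e.
  move=> h1 h2 h3; rewrite -(lerD2r (b + c)); apply: le_trans (le_trans (lerD (lerD h1 h2) h3) _).
    by rewrite [leLHS](_ : _ = (b + 2 * i) + (n - 2 * i + c)) ?lexx//; ring.
  by rewrite [leLHS](_ : _ = a + e + (b + c)) ?lexx//; ring.
by rewrite sq in Euw; rewrite [G / lam]mulrC; exact: arith Wirt young Euw.
Qed.

End lower_bound.

(** * Equality for a segment *)

Section bounded_products.
Context d (T : measurableType d) (R : realType) (mu : {measure set T -> \bar R}).
Context (D : set T) (mD : measurable D) (D_fin : (mu D < +oo)%E).
Implicit Types f g h : T -> R.

Lemma bounded_square_integrable f C : measurable_fun D f -> (forall p, D p -> `|f p| <= C) ->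
  square_integrable mu D f.
Proof.
move=> mf fC; split=> //.
apply: (@integrableR_le _ _ _ mu D mD (fun p => f p ^+ 2) (fun=> C ^+ 2)).
- exact: measurable_funX.
- apply: (measurable_bounded_integrable (f := fun=> C ^+ 2)) => //.
  exists (C ^+ 2); split; first exact: num_real.
  by move=> r r1 p _ /=; rewrite ger0_norm ?sqr_ge0// ltW.
- by move=> p Dp; rewrite normrX lerXn2r ?nnegrE// ?fC// (le_trans _ (fC p Dp)).
Qed.

Lemma square_integrable_abs f : square_integrable mu D f -> integrableR mu D (fun p => `|f p|).
Proof.
move=> [mf hf].
have i1 : integrableR mu D (fun=> 1).
  apply: (measurable_bounded_integrable (f := fun=> 1)) => //.
  by exists 1; split; [exact: num_real|move=> r r1 p _ /=; rewrite normr1 ltW].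
apply: (integrableR_le mD _ (integrableRD mD hf i1)).
  exact: measurableT_comp.
move=> p _; rewrite normr_id; have := sqr_ge0 (`|f p| - 1).
rewrite -[f p ^+ 2]real_normK ?num_real//; have : 0 <= `|f p| := normr_ge0 _; set a := `|f p|; nra.
Qed.

Lemma dominated_product h (w_ : nat -> T -> R) (w : T -> R) (C : R) : square_integrable mu D h ->
  (forall n, measurable_fun D (w_ n)) -> (forall p, D p -> (fun n => w_ n p) @ \oo --> w p) ->
  (forall n p, D p -> `|w_ n p| <= C) ->
  (fun n => (\int[mu]_(p in D) (h p * w_ n p))%R) @ \oo --> (\int[mu]_(p in D) (h p * w p))%R.
Proof.
move=> sh mw_ ww wC; have mw : measurable_fun D w by exact: measurable_fun_cvg mw_ ww.
have ih := integrableRZ mD C (square_integrable_abs sh).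
have mE g : measurable_fun D g -> measurable_fun D (EFin \o (fun p => h p * g p)).
  by move=> mg; apply/measurable_EFinP; apply: measurable_funM => //; exact: sh.1.
have c0 : {ae mu, forall p, D p -> (fun n => (h p * w_ n p)%:E) @ \oo --> (EFin \o (fun p => h p * w p)) p}.
  apply: aeW => p Dp /=; apply: cvg_EFin; first by near=> n.
  by apply: cvgM; [exact: cvg_cst|exact: ww].
have dom : {ae mu, forall p n, D p -> (`|(h p * w_ n p)%:E| <= (C * `|h p|)%:E)%E}.
  by apply: aeW => p n Dp; rewrite lee_fin normrM mulrC ler_wpM2r// wC.
have [iw _ C0] := dominated_convergence mD (fun n => mE _ (mw_ n)) (mE _ mw) c0 ih dom.
apply: fine_cvg; rewrite /Rintegral fineK//; exact: (integrable_fin_num mD iw).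
Unshelve. all: by end_near. Qed.

End bounded_products.

Section first_coordinate.
Context {R : realType}.
Local Notation plane := (measurableTypeR R * measurableTypeR R)%type.
Local Notation mu := (@leb2 R).

Lemma partial_off_support (K : set (R * R)) (phi : R * R -> R) : compact K ->
  (forall p, ~ K p -> phi p = 0) ->
  forall p, ~ K p -> partial1 phi p = 0 /\ partial2 phi p = 0.
Proof.
move=> cK phi0 p Kp.
have oK : open (~` K) by rewrite openC; apply: compact_closed.
have nK : nbhs p (~` K) by apply: open_nbhs_nbhs.
split; apply: isD_derive1; apply: (isD_near (f := fun=> 0)); try exact: isD_cst.
  by apply: filterS (near_line1 nK) => t /phi0 ->.
by apply: filterS (near_line2 nK) => t /phi0 ->.
Qed.

Lemma Rintegral_support (D K : set (R * R)) (G : R * R -> R) : K `<=` D ->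
  (forall p, ~ K p -> G p = 0) -> (\int[mu]_(p in D) G p)%R = (\int[mu]_p G p)%R.
Proof.
move=> KD G0; rewrite Rintegral_mkcond; apply: eq_Rintegral => p _; rewrite /patch.
by case: ifPn => // /negP h; rewrite G0// => Kp; apply: h; rewrite inE; exact: KD.
Qed.

Lemma H1_first_coordinate (D : set (R * R)) (f f' : R -> R) (C : R) :
  open D -> (mu D < +oo)%E -> (forall t, isD f t (f' t)) -> continuous f' ->
  (forall t, `|f t| <= C) -> (forall t, `|f' t| <= C) ->
  H1 D (fun p => f p.1) (fun p => f' p.1) (fun=> 0).
Proof.
move=> oD Dfin df cf' fC f'C; have mD := open_measurable2 oD.
have cf : continuous f := continuous_isD df.
have c1 (g : R -> R) : continuous g -> continuous (fun p : R * R => g p.1).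
  by move=> cg; exact: continuous_comp_fun cg (@continuous_fst R R).
have C0 : 0 <= C := le_trans (normr_ge0 _) (fC 0).
have L2f (g : R -> R) : continuous g -> (forall t, `|g t| <= C) -> L2 D (fun p => g p.1).
  move=> cg gC; apply: (bounded_square_integrable mD Dfin (C := C)) => [|p _]; last exact: gC.
  by apply: measurable_funTS; apply: continuous_measurable2; exact: c1.
split; [exact: L2f|exact: L2f| |].
  by apply: (L2f (fun=> 0)) => [t|t]; [exact: cvg_cst|rewrite normr0].
move=> phi [Cphi [K [cK KD phi0]]].
have [cphi [dphi1 dphi2 [cphi1 _] [cphi2 _]]] := Cphi 1%N.
have off := partial_off_support cK phi0.
have int (G : R * R -> R) : continuous G -> (forall p, ~ K p -> G p = 0) -> integrableR mu D G.
  move=> cG G0; apply: (integrableS measurableT mD) => //.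
  exact: compact_support_integrable cG cK G0.
split.
- have cA := continuousM_fun (c1 _ cf) cphi1; have cB := continuousM_fun (c1 _ cf') cphi.
  have A0 p : ~ K p -> f p.1 * partial1 phi p = 0 by move=> /off[-> _]; rewrite mulr0.
  have B0 p : ~ K p -> f' p.1 * phi p = 0 by move=> /phi0 ->; rewrite mulr0.
  apply/eqP; rewrite -subr_eq0 opprK; apply/eqP.
  apply: etrans (esym (RintegralD mD (int _ cA A0) (int _ cB B0))) _.
  apply: etrans (Rintegral_support KD _) _; first by move=> p Kp; rewrite A0// B0// addr0.
  apply: (integral_partial1_eq0 (F := fun p => f p.1 * phi p) (K := K)) => //.
  + move=> p /=; apply: isD_eq; first by apply: isDM; [exact: df|exact/derivable_isD/dphi1].
    by rewrite [f' _ * _]mulrC; case: p.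
  + exact: continuousD_fun.
  + by move=> p /phi0 ->; rewrite mulr0.
  + by move=> p Kp; rewrite A0// B0// addr0.
- have cA := continuousM_fun (c1 _ cf) cphi2.
  have A0 p : ~ K p -> f p.1 * partial2 phi p = 0 by move=> /off[_ ->]; rewrite mulr0.
  have -> : (\int[mu]_(p in D) (0 * phi p))%R = 0.
    by under eq_Rintegral do rewrite mul0r; rewrite Rintegral_cst// mul0r.
  rewrite oppr0; apply: etrans (Rintegral_support KD A0) _.
  apply: (integral_partial2_eq0 (F := fun p => f p.1 * phi p) (K := K)) => //.
  + move=> p /=; apply: isD_eq; first by apply: isDM; [exact: isD_cst|exact/derivable_isD/dphi2].
    by rewrite mulr0 addr0; case: p.
  + by move=> p /phi0 ->; rewrite mulr0.
Qed.

End first_coordinate.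

Section full_cutoff.
Context {R : realType}.
Implicit Types (s t L : R) (n : nat).

Lemma expinv_le_inv m t : 0 < t -> expinv m t <= t ^- m.
Proof.
move=> t0; have t1 : 0 <= t ^- m by rewrite invr_ge0 exprn_ge0// ltW.
rewrite /expinv t0 -[leRHS]mulr1; apply: ler_wpM2l => //.
by rewrite -[leRHS]expR0 ler_expR oppr_le0 invr_ge0 ltW.
Qed.

Lemma expinv0_ge t : 0 < t -> 1 - t^-1 <= expinv 0 t.
Proof. by move=> t0; rewrite /expinv t0 expr0 invr1 mul1r; exact: expR_ge1Dx. Qed.

Definition edge t : R := (t + 1) * expinv 2 t.

Lemma edge_ge0 t : 0 <= edge t.
Proof.
rewrite /edge; have [t0|t0] := ltP 0 t; last by rewrite /expinv ltNge t0 mulr0.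
by rewrite mulr_ge0 ?expinv_ge0// addr_ge0// ltW.
Qed.

Lemma edge_le_inv t : 1 <= t -> edge t <= 2 * t^-1.
Proof.
move=> t1; have t0 : 0 < t by lra.
apply: (@le_trans _ _ ((t + t) * t ^- 2)).
  by apply: ler_pM; rewrite ?expinv_ge0 ?expinv_le_inv// ?lerD//; lra.
by rewrite le_eqVlt; apply/orP; left; apply/eqP; field; rewrite gt_eqF.
Qed.

Lemma edge_le t : edge t <= 54.
Proof.
have [t1|t1] := leP 1 t.
  apply: le_trans (edge_le_inv t1) _; have : t^-1 <= 1 by rewrite invf_le1//; lra.
  by lra.
have [t0|t0] := ltP 0 t; last by rewrite /edge /expinv ltNge t0 mulr0.
have := expinv_le 2 t0; rewrite /edge => h.
have h0 := expinv_ge0 2 t.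
have h27 : expinv 2 t <= 27.
  apply: le_trans h _; rewrite (_ : 3 ^+ 3 = 27 :> R); last by ring.
  by lra.
by set a := expinv 2 t in h0 h27 *; nra.
Qed.

Lemma shifted_inv_le s : 0 < s -> \forall n \near \oo,
  1 <= n.+1%:R * s - 1 /\ (n.+1%:R * s - 1)^-1 <= 2 / s * n.+1%:R^-1.
Proof.
move=> s0; have V : (fun n : nat => (n.+1%:R : R)^-1) @ \oo --> (0 : R) by exact: cvg_harmonic.
near=> n.
have n0 : (0 : R) < n.+1%:R by rewrite ltr0n.
have h : 2 <= n.+1%:R * s.
  have : n.+1%:R^-1 < s / 2 by near: n; apply: (cvgr_lt _ V); rewrite divr_gt0.
  rewrite -ltf_pV2 ?posrE ?invr_gt0 ?divr_gt0// invrK invf_div => /ltW.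
  by rewrite ler_pdivrMr.
split; first by lra.
rewrite (_ : 2 / s * _ = (n.+1%:R * s / 2)^-1); last by field; rewrite gt_eqF//= gt_eqF.
rewrite lef_pV2 ?posrE; [|lra|lra].
by lra.
Unshelve. all: by end_near. Qed.

Lemma edge_cvg s : 0 < s -> (fun n => edge (n.+1%:R * s - 1)) @ \oo --> (0 : R).
Proof.
move=> s0; have V : (fun n : nat => (n.+1%:R : R)^-1) @ \oo --> (0 : R) by exact: cvg_harmonic.
apply: (@squeeze_cvgr _ _ _ _ (fun=> 0) (fun n => 2 * (2 / s * n.+1%:R^-1))).
- near=> n; rewrite edge_ge0 /=.
  have [h1 h2] : 1 <= n.+1%:R * s - 1 /\ (n.+1%:R * s - 1)^-1 <= 2 / s * n.+1%:R^-1.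
    by near: n; exact: shifted_inv_le.
  by apply: le_trans (edge_le_inv h1) _; rewrite ler_pM2l.
- exact: cvg_cst.
- have -> : (0 : R) = 2 * (2 / s * 0) by rewrite !mulr0.
  exact: (cvgM (cvg_cst _) (cvgM (cvg_cst _) V)).
Unshelve. all: by end_near. Qed.

Lemma expinv0_shifted_cvg s : 0 < s -> (fun n => expinv 0 (n.+1%:R * s - 1)) @ \oo --> (1 : R).
Proof.
move=> s0; have V : (fun n : nat => (n.+1%:R : R)^-1) @ \oo --> (0 : R) by exact: cvg_harmonic.
apply: (@squeeze_cvgr _ _ _ _ (fun n => 1 - 2 / s * n.+1%:R^-1) (fun=> 1)).
- near=> n; rewrite expinv0_le1 andbT.
  have [h1 h2] : 1 <= n.+1%:R * s - 1 /\ (n.+1%:R * s - 1)^-1 <= 2 / s * n.+1%:R^-1.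
    by near: n; exact: shifted_inv_le.
  have h3 : 0 < n.+1%:R * s - 1 by lra.
  by apply: le_trans (expinv0_ge h3); rewrite lerD2l lerN2.
- suff : (fun n : nat => 1 - 2 / s * n.+1%:R^-1) @ \oo --> 1 - 2 / s * (0 : R).
    by rewrite mulr0 subr0.
  by apply: cvgB; [exact: cvg_cst|exact: (cvgM (cvg_cst _) V)].
- exact: cvg_cst.
Unshelve. all: by end_near. Qed.

Definition full_cutoff L n s : R := cutoff n.+1%:R^-1 (L - n.+1%:R^-1) n.+1 s.

Lemma full_cutoffE L n s :
  full_cutoff L n s = expinv 0 (n.+1%:R * s - 1) * expinv 0 (n.+1%:R * (L - s) - 1).
Proof. by rewrite /full_cutoff /cutoff; congr (expinv _ _ * expinv _ _); field. Qed.

Lemma full_cutoff_cvg L s : 0 < s < L -> (fun n => full_cutoff L n s) @ \oo --> (1 : R).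
Proof.
move=> /andP[s0 sL]; rewrite (_ : (fun n => _) = fun n =>
    expinv 0 (n.+1%:R * s - 1) * expinv 0 (n.+1%:R * (L - s) - 1)).
  by rewrite -[X in _ --> X]mulr1; apply: cvgM; apply: expinv0_shifted_cvg; lra.
by apply/funext => n; exact: full_cutoffE.
Qed.

Lemma full_cutoff_isD L n s : isD (full_cutoff L n) s
  (n.+1%:R * (expinv 2 (n.+1%:R * s - 1) * expinv 0 (n.+1%:R * (L - s) - 1) -
              expinv 0 (n.+1%:R * s - 1) * expinv 2 (n.+1%:R * (L - s) - 1))).
Proof.
apply: (isD_ext (f := fun s => expinv 0 (n.+1%:R * s - 1) * expinv 0 (n.+1%:R * (L - s) - 1))).
  by move=> u; rewrite full_cutoffE.
have d1 : isD (fun s => n.+1%:R * s - 1) s n.+1%:R.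
  apply: isD_eq; first by apply: isDB (isD_cst 1 s); apply: isDM (isD_id s); exact: isD_cst.
  by rewrite /=; ring.
have d2 : isD (fun s => n.+1%:R * (L - s) - 1) s (- n.+1%:R).
  apply: isD_eq; first by apply: isDB (isD_cst 1 s); apply: isDM; [exact: isD_cst|exact: isDB (isD_cst L s) (isD_id s)].
  by rewrite /=; ring.
apply: isD_eq; first by apply: isDM; apply: isD_comp; [exact: expinv_isD|exact: d1|exact: expinv_isD|exact: d2].
by rewrite /=; ring.
Qed.

Lemma sin_le_id t : 0 <= t -> sin t <= t.
Proof.
move=> t0; rewrite -subr_ge0 -[leLHS](_ : 0 - sin 0 = 0); last by rewrite sin0 subr0.
apply: (isD_le (f := fun t => t - sin t) (f' := fun t => 1 - cos t)) => //.
- by move=> u _; apply: isDB; [exact: isD_id|exact: is_derive_sin].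
- move=> u _; apply: (isD_continuous (d := 1 - cos u)).
  by apply: isDB; [exact: isD_id|exact: is_derive_sin].
Qed.

End full_cutoff.

Section half_wave.
Context {R : realType} (L : R) (L_gt0 : 0 < L).
Implicit Types (s : R) (n : nat).
Local Notation c := (pi / L).

Definition half_wave n s : R := sin (c * s) * full_cutoff L n s.

Lemma half_wave_smooth n : smooth (half_wave n).
Proof.
apply: smoothM; last exact: cutoff_smooth.
by apply/smoothP => m; exact: (smoothn_sin_cos m c).1.
Qed.

Lemma sin_wave_bounds s : 0 < s < L -> [/\ 0 <= sin (c * s), sin (c * s) <= c * s & sin (c * s) <= c * (L - s)].
Proof.
move=> /andP[s0 sL]; have c0 : 0 < c by rewrite divr_gt0 ?pi_gt0.
have e : sin (c * s) = sin (c * (L - s)).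
  have -> : c * (L - s) = - (c * s) + pi by field; rewrite gt_eqF.
  by rewrite sinDpi sinN opprK.
have h1 : 0 <= c * s by rewrite mulr_ge0// ltW.
have h2 : 0 <= c * (L - s) by rewrite mulr_ge0 ?subr_ge0// ltW.
split; last by rewrite e; exact: sin_le_id.
  apply: sin_ge0_pi; rewrite h1 /=.
  by rewrite -subr_ge0 (_ : pi - _ = c * (L - s))//; field; rewrite gt_eqF.
exact: sin_le_id.
Qed.

(* The sine vanishes linearly at both ends, which compensates the growth of the
   derivative of the cutoff. *)
Lemma half_wave_derive n s : 0 < s < L ->
  `|derive1 (half_wave n) s - c * cos (c * s) * full_cutoff L n s| <=
  c * (edge (n.+1%:R * s - 1) + edge (n.+1%:R * (L - s) - 1)).
Proof.
move=> sL; have [w0 w1 w2] := sin_wave_bounds sL.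
have dl : isD (fun s => c * s) s c.
  by apply: isD_eq; [apply: isDM; [exact: isD_cst|exact: isD_id]|rewrite /=; ring].
have dsn : isD (fun s => sin (c * s)) s (cos (c * s) * c).
  by apply: (isD_comp (f := sin)) => //; exact: is_derive_sin.
rewrite (isD_derive1 (isDM dsn (full_cutoff_isD L n s))).
have c0 : 0 < c by rewrite divr_gt0 ?pi_gt0.
rewrite /edge !subrK; move: w0 w1 w2 (expinv_ge0 2 (n.+1%:R * s - 1))
  (expinv_ge0 2 (n.+1%:R * (L - s) - 1)) (expinv_ge0 0 (n.+1%:R * s - 1))
  (expinv_ge0 0 (n.+1%:R * (L - s) - 1)) (expinv0_le1 (n.+1%:R * s - 1))
  (expinv0_le1 (n.+1%:R * (L - s) - 1)) (ler0n R n.+1).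
set w := sin _; set a := expinv 2 _; set b := expinv 2 _; set p := expinv 0 _; set q := expinv 0 _.
set N := n.+1%:R; set f := full_cutoff _ _ _ => w0 w1 w2 a0 b0 p0 q0 p1 q1 N0.
rewrite (_ : _ - _ = N * (w * (a * q)) - N * (w * (p * b))); last by ring.
have B u v z : 0 <= u -> 0 <= v <= 1 -> w <= c * z -> 0 <= N * (w * (u * v)) <= c * (N * z * u).
  move=> u0 /andP[v0 v1] wz; rewrite !mulr_ge0//=.
  rewrite (_ : c * (N * z * u) = N * (c * z * u)); last by ring.
  rewrite ler_wpM2l//; apply: ler_pM => //; first exact: mulr_ge0.
  by rewrite -[leRHS]mulr1 ler_wpM2l.
have /andP[h1 h2] := B a q s a0 (introT andP (conj q0 q1)) w1.
have /andP[h3 h4] := B b p (L - s) b0 (introT andP (conj p0 p1)) w2.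
apply: le_trans (ler_normB _ _) _; rewrite !ger0_norm// 1?[p * b]mulrC//.
by rewrite mulrDr lerD.
Qed.

Lemma half_wave_derive_le n s : 0 < s < L -> `|derive1 (half_wave n) s| <= 109 * c.
Proof.
move=> sL; have := half_wave_derive n sL.
have e1 := edge_le (n.+1%:R * s - 1); have e2 := edge_le (n.+1%:R * (L - s) - 1).
have c0 : 0 < c by rewrite divr_gt0 ?pi_gt0.
set d := derive1 _ _; set g := c * cos _ * _ => h.
have hg : `|g| <= c.
  rewrite /g 2!normrM (gtr0_norm c0) -mulrA -[leRHS]mulr1 ler_pM2l//.
  have /andP[f0 f1] := cutoff_itv n.+1%:R^-1 (L - n.+1%:R^-1) n.+1 s.
  rewrite /full_cutoff (ger0_norm f0) -[leRHS]mulr1; apply: ler_pM => //.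
  exact: cos_max.
rewrite -[d](subrK g); apply: le_trans (ler_normD _ _) _.
apply: le_trans (lerD h hg) _.
rewrite -[X in _ + X <= _]mulr1 -mulrDr [109 * c]mulrC ler_pM2l//.
by lra.
Qed.

Lemma half_wave_derive_cvg s : 0 < s < L ->
  (fun n => derive1 (half_wave n) s) @ \oo --> c * cos (c * s).
Proof.
move=> sL; have /andP[s0 sL'] := sL.
have f1 : (fun n => c * cos (c * s) * full_cutoff L n s) @ \oo --> c * cos (c * s).
  by rewrite -[X in _ --> X]mulr1; exact: (cvgM (cvg_cst _) (full_cutoff_cvg sL)).
have f2 : (fun n => derive1 (half_wave n) s - c * cos (c * s) * full_cutoff L n s) @ \oo --> (0 : R).
  apply/norm_cvg0P.
  apply: (@squeeze_cvgr _ _ _ _ (fun=> 0)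
    (fun n => c * (edge (n.+1%:R * s - 1) + edge (n.+1%:R * (L - s) - 1)))).
  - by near=> n; rewrite normr_ge0 half_wave_derive.
  - exact: cvg_cst.
  - have -> : (0 : R) = c * (0 + 0) by rewrite addr0 mulr0.
    apply: (cvgM (cvg_cst _) (cvgD _ _)); apply: edge_cvg => //.
    by rewrite subr_gt0.
rewrite -[X in _ --> X]add0r (_ : (fun n => derive1 (half_wave n) s) = fun n =>
    (derive1 (half_wave n) s - c * cos (c * s) * full_cutoff L n s) +
    c * cos (c * s) * full_cutoff L n s); first exact: cvgD f2 f1.
by apply/funext => n; rewrite subrK.
Unshelve. all: by end_near. Qed.

Lemma half_wave_le n s : `|half_wave n s| <= 1.
Proof.
have /andP[f0 f1] := cutoff_itv n.+1%:R^-1 (L - n.+1%:R^-1) n.+1 s.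
rewrite /half_wave normrM /full_cutoff (ger0_norm f0) -[leRHS]mulr1; apply: ler_pM => //.
exact: sin_max.
Qed.

Lemma half_wave_cvg s : 0 < s < L -> (fun n => half_wave n s) @ \oo --> sin (c * s).
Proof.
move=> sL; rewrite -[X in _ --> X]mulr1.
exact: (cvgM (cvg_cst _) (full_cutoff_cvg sL)).
Qed.

End half_wave.

Section flat_strip.
Context {R : realType} (L delta : R) (x y x1 y1 x2 y2 k k1 : R -> R).
Context (S : curve_strip L delta x y x1 y1 x2 y2 k k1).
Local Notation Phi := (strip_map x y x1 y1).
Local Notation Q := (in_rect L delta).
Local Notation D := (strip_set L delta x y x1 y1).
Local Notation Psi := (strip_coord L delta x y x1 y1).
Context (Phi_inj : forall s1 r1 s2 r2, 0 < s1 < L -> 0 < r1 < delta ->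
  0 < s2 < L -> 0 < r2 < delta -> Phi s1 r1 = Phi s2 r2 -> s1 = s2 /\ r1 = r2).
Context (flat : forall s, 0 < s < L -> k s = 0).
Local Notation plane := (measurableTypeR R * measurableTypeR R)%type.
Local Notation mu := (@leb2 R).
Local Notation ev := (expr_eval L k).
Local Notation lift := (expr_lift L delta x y x1 y1 k).
Local Notation csupp := (csupp L delta k).
Local Notation ds := (expr_ds S).
Local Notation c := (pi / L).
Local Notation e := (x1 (L / 2)).

Lemma flat_tangent s : 0 <= s <= L -> x1 s = e /\ y1 s = 0.
Proof.
move=> sL; have hI := half_itv S; have hI' : 0 <= L / 2 <= L.
  by case/andP: hI => ? ?; rewrite !ltW.
have y10 : y1 (L / 2) = 0.
  have [_] := sym_derive S hI'; rewrite (_ : L - L / 2 = L / 2); last by field.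
  by move=> h; lra.
split.
  apply: (isD_cst_eq (a := 0) (b := L)) => // u uL.
    by apply: isD_eq; [exact: (frenet S uL).1|rewrite flat// mul0r oppr0].
  exact: isD_continuous (x1_isD S u).
rewrite -y10; apply: (isD_cst_eq (a := 0) (b := L)) => // u uL.
  by apply: isD_eq; [exact: (frenet S uL).2|rewrite flat// mul0r].
exact: isD_continuous (y1_isD S u).
Qed.

Lemma flat_sign : e ^+ 2 = 1.
Proof.
have /andP[? ?] := half_itv S; have hI : 0 <= L / 2 <= L by rewrite !ltW.
by have := arclength S hI; rewrite (flat_tangent hI).2 expr0n addr0.
Qed.

Lemma flat_map s r : 0 < s < L -> Phi s r = (e * (s - L / 2), y (L / 2) - r * e).
Proof.
move=> sL; have sL' : 0 <= s <= L by case/andP: sL => ? ?; rewrite !ltW.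
have /andP[h1 h2] := half_itv S; have hI : 0 <= L / 2 <= L by rewrite !ltW.
have [xE yE] := flat_tangent sL'.
have x0 : x (L / 2) = 0.
  have [+ _] := sym_all S hI; rewrite (_ : L - L / 2 = L / 2); last by field.
  by move=> h; lra.
have yc : y s = y (L / 2).
  apply: (isD_cst_eq (a := 0) (b := L)) => // u uL.
    have uL' : 0 <= u <= L by case/andP: uL => ? ?; rewrite !ltW.
    by apply: isD_eq; [exact: y_isD S u|rewrite (flat_tangent uL').2].
  exact: isD_continuous (y_isD S u).
have xc : x s - e * s = x (L / 2) - e * (L / 2).
  have dx u : isD (fun u => x u - e * u) u (x1 u - e).
    apply: isD_eq; first by apply: isDB; [exact: x_isD S u|apply: isDM; [exact: isD_cst|exact: isD_id]].
    by rewrite /=; ring.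
  apply: (isD_cst_eq (a := 0) (b := L) (f := fun u => x u - e * u)) => // u uL.
    have uL' : 0 <= u <= L by case/andP: uL => ? ?; rewrite !ltW.
    by apply: isD_eq; [exact: dx|rewrite (flat_tangent uL').1 subrr].
  exact: isD_continuous (dx u).
rewrite /strip_map xE yE yc mulr0 addr0; congr (_, _).
by rewrite mulrBr; move: xc; rewrite x0 sub0r => <-; rewrite addrC subrK.
Qed.

Definition wave (p : R * R) : R := sin (c * p.1).

Lemma flat_coord p : D p -> c * p.1 = e * (c * (Psi p).1 - pi / 2).
Proof.
move=> /strip_coordP[[sL _]]; rewrite flat_map//.
set s := (Psi p).1 => pE.
rewrite [in LHS]pE /=; have L0 := L_gt0 S; field.
by rewrite gt_eqF.
Qed.

Lemma flat_sign_cases (P : R -> Prop) : P 1 -> P (-1) -> P e.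
Proof.
move=> P1 PN; have := flat_sign => /eqP; rewrite sqrf_eq1 => /orP[/eqP ->|/eqP ->] //.
Qed.

Lemma wave_strip p : D p -> wave p = - e * cos (c * (Psi p).1) /\
  cos (c * p.1) = sin (c * (Psi p).1).
Proof.
move=> Dp; rewrite /wave flat_coord//; move: (Psi p).1 => s.
apply: (flat_sign_cases (P := fun a => sin (a * (c * s - pi / 2)) = - a * cos (c * s) /\
  cos (a * (c * s - pi / 2)) = sin (c * s))).
  by rewrite !mul1r sinBpihalf cosBpihalf mulN1r.
by rewrite !mulN1r sinN cosN sinBpihalf cosBpihalf !opprK ?mul1r.
Qed.

Let eta n := full_cutoff delta n.
Let eta_smooth n : smooth (eta n).
Proof. exact: cutoff_smooth. Qed.
Let Z n := EMul (ES (@half_wave_smooth R L n)) (ER (@eta_smooth n)).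

Lemma flat_test_csupp n : csupp (Z n).
Proof.
have n0 : (0 : R) < n.+1%:R^-1 by rewrite invr_gt0 ltr0n.
exists n.+1%:R^-1, (L - n.+1%:R^-1), n.+1%:R^-1, (delta - n.+1%:R^-1).
split; rewrite ?ltrBlDr ?ltrDl// => s r _; rewrite negb_and /= => /orP[h|h].
  rewrite /half_wave /full_cutoff cutoff_eq0 ?mulr0 ?mul0r//.
  by apply: contra h => /andP[h1 h2]; rewrite !ltW.
rewrite /eta /full_cutoff cutoff_eq0 ?mulr0//.
by apply: contra h => /andP[h1 h2]; rewrite !ltW.
Qed.

Lemma flat_test_lift n p : D p ->
  [/\ lift (EMul (ds (Z n)) EJinv) p = derive1 (half_wave L n) (Psi p).1 * eta n (Psi p).2,
      lift (EMul (Z n) (ES (x1_smooth S))) p = half_wave L n (Psi p).1 * eta n (Psi p).2 * e &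
      lift (EMul (Z n) (ES (y1_smooth S))) p = 0].
Proof.
move=> Dp; have [[sL rd] _] := strip_coordP Dp.
have sL' : 0 <= (Psi p).1 <= L by case/andP: sL => ? ?; rewrite !ltW.
have [xE yE] := flat_tangent sL'.
rewrite !liftE// /expr_eval -/expr_eval xE yE flat//; split=> //; last by rewrite mulr0.
by rewrite [in LHS]/= mulr0 add0r mulr0 addr0 invr1 mulr1 mulrC.
Qed.

Lemma flat_weak v h1 h2 : H1 D v h1 h2 ->
  (\int[mu]_(p in D) (v p * (c * cos (c * (Psi p).1))))%R =
  - (\int[mu]_(p in D) (h1 p * (sin (c * (Psi p).1) * e)))%R.
Proof.
move=> Hv; have mD := strip_measurable S; have Dfin := strip_finite S.
have [Lv Lh1 Lh2 _] := Hv; have L0 := L_gt0 S.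
have c0 : 0 < c by rewrite divr_gt0 ?pi_gt0.
have eta_cvg p : D p -> (fun n => eta n (Psi p).2) @ \oo --> (1 : R).
  by move=> /strip_coordP[[_ rd] _]; exact: full_cutoff_cvg.
have eta_le n r : `|eta n r| <= 1.
  by have /andP[e0 e1] := cutoff_itv n.+1%:R^-1 (delta - n.+1%:R^-1) n.+1 r; rewrite ger0_norm.
have C1 : (fun n => (\int[mu]_(p in D) (v p * lift (EMul (ds (Z n)) EJinv) p))%R) @ \oo -->
    (\int[mu]_(p in D) (v p * (c * cos (c * (Psi p).1))))%R.
  apply: (dominated_product (C := 109 * c) mD Dfin Lv).
  - by move=> n; apply: lift_measurable S Phi_inj _ (csupp_mul EJinv (csupp_d S (flat_test_csupp n)).1).1.
  - move=> p Dp; have [[sL rd] _] := strip_coordP Dp.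
    rewrite (_ : (fun n => _) = fun n => derive1 (half_wave L n) (Psi p).1 * eta n (Psi p).2); last first.
      by apply/funext => n; have [] := flat_test_lift n Dp.
    rewrite -[X in _ --> X]mulr1; apply: cvgM; last exact: eta_cvg.
    exact: half_wave_derive_cvg.
  - move=> n p Dp; have [[sL rd] _] := strip_coordP Dp.
    have [-> _ _] := flat_test_lift n Dp.
    rewrite normrM -[leRHS]mulr1; apply: ler_pM => //.
    exact: half_wave_derive_le.
have C2 : (fun n => (\int[mu]_(p in D) (h1 p * lift (EMul (Z n) (ES (x1_smooth S))) p))%R) @ \oo -->
    (\int[mu]_(p in D) (h1 p * (sin (c * (Psi p).1) * e)))%R.
  apply: (dominated_product (C := `|e|) mD Dfin Lh1).
  - by move=> n; apply: lift_measurable S Phi_inj _ (csupp_mul _ (flat_test_csupp n)).1.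
  - move=> p Dp; have [[sL rd] _] := strip_coordP Dp.
    rewrite (_ : (fun n => _) = fun n => half_wave L n (Psi p).1 * eta n (Psi p).2 * e); last first.
      by apply/funext => n; have [] := flat_test_lift n Dp.
    rewrite -[sin _]mulr1; apply: cvgM; last exact: cvg_cst.
    by apply: cvgM; [exact: half_wave_cvg|exact: eta_cvg].
  - move=> n p Dp; have [_ lE _] := flat_test_lift n Dp.
    apply: etrans (congr1 (fun t => `|t| <= _) lE) _.
    rewrite normrM ler_piMl// normrM -[leRHS]mulr1; apply: ler_pM => //.
    exact: half_wave_le.
have E n : (\int[mu]_(p in D) (v p * lift (EMul (ds (Z n)) EJinv) p))%R =
   - (\int[mu]_(p in D) (h1 p * lift (EMul (Z n) (ES (x1_smooth S))) p))%R.
  have HD := H1_div S Phi_inj Hv (flat_test_csupp n).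
  apply: etrans HD _; congr (- _).
  apply: eq_Rintegral => p; rewrite inE => Dp.
  have [_ _ Y0] := flat_test_lift n Dp.
  by apply: etrans (congr1 (fun t => _ + h2 p * t) Y0) _; rewrite mulr0 addr0.
have C3 : (fun n => (\int[mu]_(p in D) (v p * lift (EMul (ds (Z n)) EJinv) p))%R) @ \oo -->
    - (\int[mu]_(p in D) (h1 p * (sin (c * (Psi p).1) * e)))%R.
  by apply: (cvg_trans _ (cvgN C2)); apply: near_eq_cvg; near=> n; exact: (esym (E n)).
exact: (cvg_unique _ C1 C3).
Unshelve. all: by end_near. Qed.

Lemma wave_isD t : isD (fun t => sin (c * t)) t (c * cos (c * t)).
Proof.
have dl : isD (fun s => c * s) t c.
  by apply: isD_eq; [apply: isDM; [exact: isD_cst|exact: isD_id]|rewrite /=; ring].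
apply: isD_eq; first by apply: (isD_comp (f := sin)) dl; exact: is_derive_sin.
exact: mulrC.
Qed.

Lemma wave_H1 : H1 D wave (fun p => c * cos (c * p.1)) (fun=> 0).
Proof.
have c0 : 0 < c by rewrite divr_gt0 ?pi_gt0 ?(L_gt0 S).
apply: (H1_first_coordinate (C := 1 + c) (f := fun t => sin (c * t)) (f' := fun t => c * cos (c * t))).
- exact: strip_set_open S.
- exact: strip_finite S.
- exact: wave_isD.
- have sc : smooth (fun t => cos (c * t)).
    by apply/smoothP => m; exact: (smoothn_sin_cos m c).2.
  by apply: continuousM_fun; [move=> t; exact: cvg_cst|exact: smooth_continuous].
- by move=> t; apply: le_trans (sin_max _) _; rewrite lerDl ltW.
- move=> t; rewrite normrM (gtr0_norm c0).
  apply: (@le_trans _ _ (c * 1)); first by rewrite ler_pM2l// cos_max.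
  by rewrite mulr1 lerDr.
Qed.

Lemma wave_neumann : neumann_solution D (c ^+ 2) wave.
Proof.
exists (fun p => c * cos (c * p.1)), (fun=> 0); split; first exact: wave_H1.
move=> v h1 h2 Hv; have mD := strip_measurable S; have [Lv Lh1 _ _] := Hv.
have [Lw Lg _ _] := wave_H1.
have i1 := square_integrable_mul mD Lw Lv; have i2 := square_integrable_mul mD Lg Lh1.
have ee : e * e = 1 by rewrite -expr2 flat_sign.
have c0 : c != 0 by rewrite gt_eqF// divr_gt0 ?pi_gt0 ?(L_gt0 S).
set I := (\int[mu]_(p in D) (h1 p * (sin (c * (Psi p).1) * e)))%R.
have iI : integrableR mu D (fun p => h1 p * (sin (c * (Psi p).1) * e)).
  apply: (eq_integrableR (strip_measurable S) _ (integrableRZ mD (e / c) i2)) => p Dp.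
  rewrite (wave_strip Dp).2; move: (sin _) => sn; move: c c0 => w w0.
  by field.
have IE : - I = - (c * e) * (\int[mu]_(p in D) (wave p * v p))%R.
  rewrite /I -(flat_weak Hv) -(RintegralZl _ mD i1).
  apply: eq_Rintegral => p; rewrite inE => Dp; rewrite (wave_strip Dp).1.
  rewrite (_ : - (c * e) * _ = e * e * (v p * (c * cos (c * (Psi p).1)))); last by ring.
  by rewrite ee mul1r.
transitivity (c * e * I).
  rewrite /I -(RintegralZl _ mD iI).
  apply: eq_Rintegral => p; rewrite inE => Dp; rewrite mul0r addr0 (wave_strip Dp).2.
  rewrite (_ : c * e * _ = e * e * (c * sin (c * (Psi p).1) * h1 p)); last by ring.
  by rewrite ee mul1r.
have IE' : I = c * e * (\int[mu]_(p in D) (wave p * v p))%R.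
  by apply: oppr_inj; rewrite IE mulNr.
by rewrite IE' mulrA mulrACA ee mulr1 expr2.
Qed.

Lemma wave_nonzero : ~ {ae mu, forall p, D p -> wave p = 0}.
Proof.
move=> w0; have L0 := L_gt0 S; have d0 := delta_gt0 S.
pose a := Num.min (y (L / 2)) (y (L / 2) - delta * e).
pose b := Num.max (y (L / 2)) (y (L / 2) - delta * e).
have ab : a < b.
  rewrite /a /b; apply: (flat_sign_cases (P := fun e => Num.min _ (_ - delta * e) < Num.max _ (_ - delta * e))).
    by rewrite gt_min !lt_max mulr1 !ltrBlDr !ltrDl d0 !orbT.
  by rewrite gt_min !lt_max mulrN1 opprK !ltrDl d0 !orbT.
pose B : set plane := `]0, L / 2[%classic `*` `]a, b[%classic.
have mB : measurable B by apply: measurableX; exact: measurable_itv.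
have : mu B = 0.
  apply/(measure_negligible mB); apply: negligibleS w0 => -[p1 p2] [] /=.
  rewrite !in_itv /= => /andP[p10 p1L] p2ab.
  have [sL rd] : 0 < L / 2 + e * p1 < L /\ 0 < e * (y (L / 2) - p2) < delta.
    move: p2ab; rewrite /a /b.
    apply: (flat_sign_cases (P := fun e => Num.min _ (_ - delta * e) < p2 < Num.max _ (_ - delta * e) ->
      0 < L / 2 + e * p1 < L /\ 0 < e * (y (L / 2) - p2) < delta)).
      by rewrite mulr1 gt_min lt_max => /andP[/orP[] ? /orP[] ?]; split; lra.
    by rewrite mulrN1 gt_min lt_max => /andP[/orP[] ? /orP[] ?]; split; lra.
  have Dp : D (p1, p2).
    exists (L / 2 + e * p1), (e * (y (L / 2) - p2)); split; first by split.
    have ee : e * e = 1 by rewrite -expr2 flat_sign.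
    have A1 (w h q : R) : w * w = 1 -> q = w * (h + w * q - h).
      by move=> ww; rewrite addrAC subrr add0r mulrA ww mul1r.
    have A2 (w h q : R) : w * w = 1 -> q = h - w * (h - q) * w.
      by move=> ww; rewrite mulrAC ww mul1r subKr.
    by rewrite flat_map//; apply: congr2; [exact: A1|exact: A2].
  move=> /(_ Dp); rewrite /wave /= => /eqP; apply/negP; rewrite gt_eqF//.
  apply: (sin_scaled_gt0 S); rewrite p10 /=.
  by have /andP[_ h] := half_itv S; exact: lt_trans p1L h.
rewrite /leb2 /B product_measure1E//; try exact: measurable_itv.
rewrite [X in (X * _)%E]lebesgue_measure_itv [X in (_ * X)%E]lebesgue_measure_itv /=.
rewrite !lte_fin ab ifT ?divr_gt0// -!EFinB -EFinM => -[] /eqP.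
by rewrite subr0 mulf_eq0 subr_eq0 !gt_eqF//= divr_gt0.
Qed.

Lemma flat_odd_eigenvalue : odd_neumann_eigenvalue D (c ^+ 2).
Proof.
exists wave; split; first by split; [exact: wave_nonzero|exact: wave_neumann].
by apply: aeW => p _; rewrite /wave /= mulrN sinN.
Qed.

End flat_strip.

Section straight.
Context {R : realType} (L delta : R) (x y x1 y1 x2 y2 k k1 : R -> R).
Context (S : curve_strip L delta x y x1 y1 x2 y2 k k1).

Lemma segment_flat (p q : R * R) :
  [set (x s, y s) | s in `[0, L]] = segment p q -> forall s, 0 < s < L -> k s = 0.
Proof.
move=> E; have L0 := L_gt0 S.
have img s : 0 <= s <= L -> exists t, x s = (1 - t) * p.1 + t * q.1 /\ y s = (1 - t) * p.2 + t * q.2.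
  move=> sL; have : segment p q (x s, y s) by rewrite -E; exists s => //=; rewrite in_itv.
  by move=> [t _ [<- <-]]; exists t.
pose n1 := p.2 - q.2; pose n2 := q.1 - p.1.
have line s : 0 <= s <= L -> n1 * x s + n2 * y s = n1 * p.1 + n2 * p.2.
  by move=> /img[t [-> ->]]; rewrite /n1 /n2; ring.
have n0 : n1 != 0 \/ n2 != 0.
  have [n10|] := eqVneq n1 0; last by left.
  have [n20|] := eqVneq n2 0; last by right.
  exfalso; have pq1 : q.1 = p.1 by apply/eqP; rewrite -subr_eq0 -/n2 n20.
  have pq2 : q.2 = p.2 by apply/esym/eqP; rewrite -subr_eq0 -/n1 n10.
  have I0 : 0 <= (0 : R) <= L by rewrite lexx ltW.
  have IL : 0 <= L <= L by rewrite lexx ltW.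
  have [t [x0 y0]] := img 0 I0; have [u [xL yL]] := img L IL.
  suff : 0 = L :> R by move=> h; move: L0; rewrite -h ltxx.
  apply: (curve_inj S); rewrite ?in_itv//= ?x0 ?xL ?y0 ?yL ?pq1 ?pq2; ring.
have dline s : 0 < s < L -> n1 * x1 s + n2 * y1 s = 0.
  move=> sL; have d1 : isD (fun s => n1 * x s + n2 * y s) s (n1 * x1 s + n2 * y1 s).
    apply: isD_eq; first by apply: isDD; apply: isDM; [exact: isD_cst|exact: x_isD S s|exact: isD_cst|exact: y_isD S s].
    by rewrite /=; ring.
  rewrite -(isD_derive1 d1); apply: isD_derive1.
  apply: (isD_near (f := fun=> n1 * p.1 + n2 * p.2)); last exact: isD_cst.
  by apply: filterS (near_itv sL) => u uL; rewrite line.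
have ddline s : 0 < s < L -> n1 * x2 s + n2 * y2 s = 0.
  move=> sL; have d1 : isD (fun s => n1 * x1 s + n2 * y1 s) s (n1 * x2 s + n2 * y2 s).
    apply: isD_eq; first by apply: isDD; apply: isDM; [exact: isD_cst|exact: x1_isD S s|exact: isD_cst|exact: y1_isD S s].
    by rewrite /=; ring.
  rewrite -(isD_derive1 d1); apply: isD_derive1.
  apply: (isD_near (f := fun=> 0)); last exact: isD_cst.
  case/andP: sL => s0 sL; near=> u; rewrite dline//.
  by apply/andP; split; near: u; [exact: lt_nbhsr|exact: lt_nbhsl].
move=> s sL; have := dline s sL; have := ddline s sL; rewrite (curvatureE S).
move: (x1 s) (y1 s) (x2 s) (y2 s) => a b c d h2 h1.
have k1_0 : n1 * (a * d - b * c) = 0.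
  rewrite (_ : n1 * _ = d * (n1 * a + n2 * b) - b * (n1 * c + n2 * d)); last by ring.
  by rewrite h1 h2 !mulr0 subr0.
have k2_0 : n2 * (a * d - b * c) = 0.
  rewrite (_ : n2 * _ = a * (n1 * c + n2 * d) - c * (n1 * a + n2 * b)); last by ring.
  by rewrite h1 h2 !mulr0 subr0.
case: n0 => /negPf n0.
  by move/eqP: k1_0; rewrite mulf_eq0 n0 => /eqP.
by move/eqP: k2_0; rewrite mulf_eq0 n0 => /eqP.
Unshelve. all: by end_near. Qed.

Definition jacobian_max : R := 1 + (if 0 <= k (L / 2) then delta else 0) * k (L / 2).

Lemma jacobian_max_gt0 : 0 < jacobian_max.
Proof.
rewrite /jacobian_max; case: ifPn => k0; last by rewrite mul0r addr0.
by rewrite ltr_pwDl// mulr_ge0// ltW// (delta_gt0 S).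
Qed.

Lemma jacobian_le_max s r : 0 <= s <= L -> 0 <= r <= delta -> 1 + r * k s <= jacobian_max.
Proof.
move=> sL /andP[r0 rd]; rewrite /jacobian_max lerD2l.
have h := curvature_le_mid S sL; have h' := ler_wpM2l r0 h.
apply: le_trans h' _; case: ifPn => k0; first by rewrite ler_wpM2r.
by rewrite mul0r mulr_ge0_le0// ltW// ltNge.
Qed.

Lemma jacobian_min : is_min [set b | exists r s : R, [/\ r \in `[0, delta], s \in `[0, L] &
  b = 1 / (1 + r * k s) ^+ 2]] (1 / jacobian_max ^+ 2).
Proof.
have /andP[h0 hL] := half_itv S; have d0 := delta_gt0 S.
split.
  exists (if 0 <= k (L / 2) then delta else 0), (L / 2); split=> //.
    by rewrite in_itv /=; case: ifPn => _; rewrite lexx ltW.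
  by rewrite in_itv /= !ltW.
move=> _ [r [s [+ + ->]]]; rewrite !in_itv /= => rd sL.
have J0 := jacobian_gt0 S sL rd; have JM := jacobian_le_max sL rd.
rewrite ler_pdivrMr ?exprn_gt0 ?jacobian_max_gt0// mulrAC mul1r ler_pdivlMr ?exprn_gt0// mul1r.
by rewrite lerXn2r// ?nnegrE ltW// jacobian_max_gt0.
Qed.

End straight.

Theorem theorem1p1 (R : realType) (L : R) (x y : R -> R) (delta : R)
    (L_gt0 : 0 < L)
    (x_smooth : smooth x) (y_smooth : smooth y)
    (gamma_simple_nonclosed : forall s t : R, s \in `[0, L] -> t \in `[0, L] ->
       x s = x t -> y s = y t -> s = t)
    (gamma_arclength : forall s : R, s \in `[0, L] ->
       derive1 x s ^+ 2 + derive1 y s ^+ 2 = 1)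
    (gamma_sym : forall s : R, s \in `[0, L / 2] ->
       x (L - s) = - x s /\ y (L - s) = y s)
    (k_concave : concave_on `[0, L] (curvature x y))
    (delta_gt0 : 0 < delta)
    (delta_k : forall s : R, s \in `[0, L] -> 0 < 1 + delta * curvature x y s)
    (D_simply_connected : simply_connected (strip x y L delta)) :
  exists B : R,
    [/\ is_min [set b | exists r s : R, [/\ r \in `[0, delta], s \in `[0, L] &
                  b = 1 / (1 + r * curvature x y s) ^+ 2]] B,
        ((B * (pi ^+ 2 / L ^+ 2))%:E <= mu1_odd (strip x y L delta))%E &
        (exists p q : R * R,
            [set (x s, y s) | s in `[0, L]] = segment p q) ->
        mu1_odd (strip x y L delta) = (B * (pi ^+ 2 / L ^+ 2))%:E].
Proof.
have x1s := smooth_derive1 x_smooth; have y1s := smooth_derive1 y_smooth.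
have x2s := smooth_derive1 x1s; have y2s := smooth_derive1 y1s.
have ks : smooth (curvature x y).
  exact: (smoothB (smoothM x1s y2s) (smoothM y1s x2s)).
have S : curve_strip L delta x y (derive1 x) (derive1 y) (derive1 (derive1 x)) (derive1 (derive1 y))
    (curvature x y) (derive1 (curvature x y)).
  by apply: (CurveStrip L_gt0 delta_gt0 (fun s => smooth_isD s x_smooth) (fun s => smooth_isD s y_smooth)
    (fun s => smooth_isD s x1s) (fun s => smooth_isD s y1s) (fun s => smooth_isD s ks)
    x1s y1s ks (fun=> erefl) gamma_simple_nonclosed gamma_arclength gamma_sym k_concave delta_k).
have Phi_inj := strip_map_inj S D_simply_connected erefl.
have DE : strip x y L delta = strip_set L delta x y (derive1 x) (derive1 y).
  apply/seteqP; split=> p [s [r]].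
    by move=> [sL rd ->]; exists s, r.
  by move=> [[sL rd] ->]; exists s, r.
rewrite DE; exists (1 / jacobian_max L delta (curvature x y) ^+ 2).
have M0 := jacobian_max_gt0 S.
have lower : ((1 / jacobian_max L delta (curvature x y) ^+ 2 * (pi ^+ 2 / L ^+ 2))%:E <=
    mu1_odd (strip_set L delta x y (derive1 x) (derive1 y)))%E.
  apply: le_ereal_inf_tmp => _ [nu [nu0 nuE] <-]; rewrite lee_fin.
  apply: le_trans (odd_eigenvalue_ge S Phi_inj M0 _ nuE).
    by rewrite expr_div_n mul1r mulrC.
  move=> s r [/andP[s0 sL] /andP[r0 rd]]; apply: (jacobian_le_max S); by rewrite !ltW.
split=> //; first exact: jacobian_min S.
move=> [p [q /(segment_flat S) flat]].
apply/eqP; rewrite eq_le lower andbT.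
have -> : jacobian_max L delta (curvature x y) = 1.
  by rewrite /jacobian_max (flat _ (half_itv S)) mulr0 addr0.
apply: ereal_inf_lbound; exists ((pi / L) ^+ 2).
  split; last exact: flat_odd_eigenvalue S Phi_inj flat.
  by rewrite gt_eqF// exprn_gt0// divr_gt0// pi_gt0.
by rewrite expr1n divr1 mul1r expr_div_n.
Qed.
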